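(* Let $\mathbf{k}$ be a field of characteristic $0$, let $r\ge 0$ be an integer and let $P$ be an $r$-tame operad in cochain complexes of $\mathbf{k}$-vector spaces. Then every $r$-connected $P$-algebra $A$ has a Sullivan $r$-minimal model $f:\mathcal{M}\to A$ with $\mathcal{M}^0=P(0)$ and $\mathcal{M}^i=0$ for all $i<r$ with $i\neq 0$. Furthermore, if $A$ is $(r+1)$-connected and $H^*(A)$ is of finite type, then $\mathcal{M}$ is of finite type.
   Context: Operads are unital symmetric operads in unbounded cochain complexes of $\mathbf{k}$-vector spaces (differential of degree $+1$). Every operad $P$ considered is assumed to be connected ($P(1)=\mathbf{k}$, concentrated in degree $0$) and either reduced ($P(0)=0$) or unitary ($P(0)=\mathbf{k}$ concentrated in degree $0$). A $P$-algebra is a cochain complex $A$ with structure maps $P(l)\otimes_{\Sigma_l}A^{\otimes l}\to A$ satisfying the usual associativity and unit axioms; morphisms of $P$-algebras are strict morphisms (not $\infty$-morphisms). A quasi-isomorphism of $P$-algebras is a morphism whose underlying map of complexes induces an isomorphism in cohomology. $r$-tame: $P$ is $r$-tame if for all $n\ge 2$, $P(n)^q=0$ for all $q\le (1-n)(1+r)$. $r$-connected: a $P$-algebra $A$ is $0$-connected if $H^i(A)=0$ for $i<0$ and the unit map $\eta:P(0)\to A$ induces an isomorphism $P(0)\cong H^0(A)$; it is $r$-connected if in addition $H^1(A)=\dots=H^r(A)=0$. Free algebras and KS-extensions: for a graded vector space $V$, $P\langle V\rangle=\bigoplus_{m\ge 0}P(m)\otimes_{\Sigma_m}V^{\otimes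 m}$ denotes the free graded $P$-algebra on $V$; $P\langle 0\rangle=P(0)$. Let $B=P\langle V\rangle$ be a $P$-algebra that is free as a graded algebra. A KS-extension of $B$ of degree $n>0$ is the $P$-algebra $B\sqcup_d P\langle V'\rangle$ with underlying graded algebra $P\langle V\oplus V'\rangle$, where $V'$ is a graded vector space homogeneous of degree $n$ and $d:V'\to Z^{n+1}(B)$ is a linear map to cocycles; its differential is the unique $P$-derivation (compatible with the differential of $P$) extending the differential of $B$ and $d$ on $V'$. Sullivan $r$-minimal: a Sullivan $r$-minimal $P$-algebra is the colimit $\mathcal{M}=\bigcup_{i\ge 0}\mathcal{M}[i]$ of a sequence of KS-extensions starting from $P(0)$, ordered by non-decreasing degrees bigger than $r$: $$\mathcal{M}[0]=P(0)\to\mathcal{M}[1]=P\langle V[1]\rangle\to\mathcal{M}[2]=\mathcal{M}[1]\sqcup_d P\langle V[2]\rangle\to\cdots$$ with $r<\deg(V[n])\le\deg(V[n+1])$ for all $n\ge 1$. A Sullivan $r$-minimal model of $A$ is a Sullivan $r$-minimal $P$-algebra $\mathcal{M}$ together with a quasi-isomorphism of $P$-algebras $f:\mathcal{M}\to A$. Finite type means finite-dimensional in each degree.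
   Formalization: KS-extensions are indexed by pairs (degree, step), with unions at limits, as a sequence indexed by n fails in general; the sequence form is proved for A (r+1)-connected. The finite type claim also assumes each P(n) of finite type, without which it is false. *)

(* Defs.v *)
From HB Require Import structures.
From mathcomp Require Import all_boot all_order all_fingroup all_algebra.

Set Implicit Arguments.
Unset Strict Implicit.
Unset Printing Implicit Defensive.

Import Order.TTheory GRing.Theory Num.Theory.
Local Open Scope ring_scope.

(* A graded vector space is its total space [gcar], the internal direct sum
   of its homogeneous parts; [homog n x] reads "x has degree n".  In
   particular 0 has every degree. *)
Record gmod (k : fieldType) := Gmod {
  gcar :> lmodType k;
  homog : int -> gcar -> Prop;
  homog0 : forall n, homog n 0;
  homogP : forall n (c : k) x y,
    homog n x -> homog n y -> homog n (c *: x + y);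
  homog_dec : forall x, exists (s : seq int) (y : int -> gcar),
    [/\ uniq s, forall n, homog n (y n) & x = \sum_(n <- s) y n];
  homog_indep : forall (s : seq int) (y : int -> gcar),
    uniq s -> (forall n, homog n (y n)) -> \sum_(n <- s) y n = 0 ->
    forall n, n \in s -> y n = 0 }.
Arguments homog {k V} n x : rename.

Definition homogs (k : fieldType) (V : gmod k) (m : nat)
    (e : m.-tuple int) (a : m.-tuple V) : Prop :=
  forall j, homog (tnth e j) (tnth a j).

Definition graded (k : fieldType) (V W : gmod k) (f : V -> W) : Prop :=
  forall n x, homog n x -> homog n (f x).

Definition concentrated (k : fieldType) (V : gmod k) (n : int) : Prop :=
  forall x : V, homog n x.

Section DirectSum.
Variables (k : fieldType) (V W : gmod k).

Definition dsum_homog (n : int) (x : (V * W)%type) : Prop :=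
  homog n x.1 /\ homog n x.2.

Lemma dsum_homog0 n : dsum_homog n 0.
Proof. by split; apply: homog0. Qed.

Lemma dsum_homogP n (c : k) x y :
  dsum_homog n x -> dsum_homog n y -> dsum_homog n (c *: x + y).
Proof. by move=> [? ?] [? ?]; split; apply: homogP. Qed.

Lemma dsum_fst (s : seq int) (y : int -> (V * W)%type) :
  (\sum_(n <- s) y n).1 = \sum_(n <- s) (y n).1.
Proof. exact: (big_morph (fun x : V * W => x.1) (fun _ _ => erefl) erefl). Qed.

Lemma dsum_snd (s : seq int) (y : int -> (V * W)%type) :
  (\sum_(n <- s) y n).2 = \sum_(n <- s) (y n).2.
Proof. exact: (big_morph (fun x : V * W => x.2) (fun _ _ => erefl) erefl). Qed.

Lemma sum_extend (U : lmodType k) (s t : seq int) (y : int -> U) :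
    uniq s -> uniq t -> {subset s <= t} ->
  \sum_(n <- s) y n = \sum_(n <- t) (if n \in s then y n else 0).
Proof.
move=> us ut st; rewrite -big_mkcond /= -[RHS]big_filter.
apply: perm_big; apply: uniq_perm => //; first exact: filter_uniq.
by move=> n; rewrite mem_filter; case: (boolP (n \in s)) => // /st ->.
Qed.

Lemma dsum_homog_dec (x : (V * W)%type) :
  exists (s : seq int) (y : int -> (V * W)%type),
    [/\ uniq s, forall n, dsum_homog n (y n) & x = \sum_(n <- s) y n].
Proof.
case: x => x1 x2.
have [s1 [y1 [u1 h1 ->]]] := homog_dec x1.
have [s2 [y2 [u2 h2 ->]]] := homog_dec x2.
exists (undup (s1 ++ s2)), (fun n => (if n \in s1 then y1 n else 0,
                                      if n \in s2 then y2 n else 0)).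
split; first exact: undup_uniq.
  by move=> n; split=> /=; case: ifP => _ //; apply: homog0.
rewrite [RHS]surjective_pairing dsum_fst dsum_snd.
congr (_, _); apply: sum_extend => //; rewrite ?undup_uniq //.
  by move=> n; rewrite mem_undup mem_cat => ->.
by move=> n; rewrite mem_undup mem_cat orbC => ->.
Qed.

Lemma dsum_homog_indep (s : seq int) (y : int -> (V * W)%type) :
  uniq s -> (forall n, dsum_homog n (y n)) -> \sum_(n <- s) y n = 0 ->
  forall n, n \in s -> y n = 0.
Proof.
move=> us hy y0 n ns; rewrite [LHS]surjective_pairing.
congr (_, _).
  apply: (homog_indep us (y := fun n => (y n).1)) ns; first by move=> i; case: (hy i).
  by rewrite -dsum_fst y0.
apply: (homog_indep us (y := fun n => (y n).2)) ns; first by move=> i; case: (hy i).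
by rewrite -dsum_snd y0.
Qed.

Definition dsum : gmod k :=
  Gmod dsum_homog0 dsum_homogP dsum_homog_dec dsum_homog_indep.

End DirectSum.

Record complex (k : fieldType) := Complex {
  cgr :> gmod k;
  cd : {linear cgr -> cgr};
  cd_homog : forall n x, homog n x -> homog (n + 1) (cd x);
  cdd : forall x, cd (cd x) = 0 }.
Arguments cd {k c}.

Definition cocycle (k : fieldType) (A : complex k) (n : int) (x : A) : Prop :=
  homog n x /\ cd x = 0.

Definition coboundary (k : fieldType) (A : complex k) (n : int) (x : A) : Prop :=
  exists2 y : A, homog (n - 1) y & x = cd y.

(* H^n(A) = 0 *)
Definition coh_zero (k : fieldType) (A : complex k) (n : int) : Prop :=
  forall x : A, cocycle n x -> coboundary n x.

Definition finite_type (k : fieldType) (V : gmod k) : Prop :=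
  forall n : int, exists s : seq V,
    (forall x, x \in s -> homog n x) /\
    (forall x : V, homog n x ->
       exists c : nat -> k, x = \sum_(i < size s) c i *: s`_i).

(* H^n(A) is finite-dimensional for every n: it is spanned by the classes of
   finitely many cocycles. *)
Definition coh_finite_type (k : fieldType) (A : complex k) : Prop :=
  forall n : int, exists s : seq A,
    (forall x, x \in s -> cocycle n x) /\
    (forall x : A, cocycle n x ->
       exists c : nat -> k, coboundary n (x - \sum_(i < size s) c i *: s`_i)).

Definition sgn (k : fieldType) (e : int) : k := (-1) ^ e.
Arguments sgn {k} e.

(* With 0-based positions, inserting n inputs in place of input i moves input
   u != i to position [shift i n u]. *)
Definition shift (i n u : nat) : nat :=
  if (u < i)%N then u else (u + n).-1.

(* [block_perm i s t rho]: rho is the permutation s of m blocks, the block i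
   having length n and being permuted by t, the others having length 1.  Such
   a rho exists and is unique when l.+1 = m + n. *)
Definition block_perm (m n l : nat) (i : 'I_m) (s : 'S_m) (t : 'S_n)
    (rho : 'S_l) : Prop :=
  (forall (j : 'I_n) (x : 'I_l), x = i + j :> nat -> rho x = s i + t j :> nat)%N
  /\ (forall (u : 'I_m) (x : 'I_l), u != i ->
        x = shift i n u :> nat -> rho x = shift (s i) n (s u) :> nat).

(* Symmetric operads through partial compositions: [pcomp e i a b] is the
   operation a o_i b, inserting b in input i (counted from 0) of a; the
   resulting arity l with l.+1 = m + n is a free parameter so that no cast is
   needed.  [psym s a] is the right action a.s; in the endomorphism operad it
   is (a.s)(x) = a (x \o s), which is a right action because the product s * t
   of permutations is "first s, then t". *)
Record operad (k : fieldType) := Operad {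
  arity :> nat -> complex k;
  psym : forall n, 'S_n -> {linear arity n -> arity n};
  pid : arity 1;
  pcomp : forall m n l, l.+1 = (m + n)%N -> 'I_m ->
    arity m -> arity n -> arity l;
  psym_homog : forall n (s : 'S_n), graded (psym s);
  psym_d : forall n (s : 'S_n) a, cd (psym s a) = psym s (cd a);
  psym1 : forall n (a : arity n), psym 1%g a = a;
  psymM : forall n (s t : 'S_n) a, psym (s * t)%g a = psym t (psym s a);
  pcompDl : forall m n l (e : l.+1 = (m + n)%N) i (c : k) a a' (b : arity n),
    pcomp e i (c *: a + a') b = c *: pcomp e i a b + pcomp e i a' b;
  pcompDr : forall m n l (e : l.+1 = (m + n)%N) i (c : k) (a : arity m) b b',
    pcomp e i a (c *: b + b') = c *: pcomp e i a b + pcomp e i a b';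
  pcomp_homog : forall m n l (e : l.+1 = (m + n)%N) i p q
      (a : arity m) (b : arity n),
    homog p a -> homog q b -> homog (p + q) (pcomp e i a b);
  pcomp_d : forall m n l (e : l.+1 = (m + n)%N) i p
      (a : arity m) (b : arity n), homog p a ->
    cd (pcomp e i a b) = pcomp e i (cd a) b + sgn p *: pcomp e i a (cd b);
  pid_homog : homog 0 pid;
  pid_d : cd pid = 0;
  pcomp_idl : forall n (e : n.+1 = (1 + n)%N) i (b : arity n),
    pcomp e i pid b = b;
  pcomp_idr : forall m (e : m.+1 = (m + 1)%N) i (a : arity m),
    pcomp e i a pid = a;
  pcomp_seq : forall m n l u v w (e1 : u.+1 = (m + n)%N)
      (e2 : v.+1 = (u + l)%N) (e3 : w.+1 = (n + l)%N) (e4 : v.+1 = (m + w)%N)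
      (i : 'I_m) (j : 'I_n) (h : 'I_u)
      (a : arity m) (b : arity n) (c : arity l), h = (i + j)%N :> nat ->
    pcomp e2 h (pcomp e1 i a b) c = pcomp e4 i a (pcomp e3 j b c);
  pcomp_par : forall m n l u v w (e1 : u.+1 = (m + n)%N)
      (e2 : v.+1 = (u + l)%N) (e3 : w.+1 = (m + l)%N) (e4 : v.+1 = (w + n)%N)
      (i i' : 'I_m) (h : 'I_u) (h' : 'I_w) p q
      (a : arity m) (b : arity n) (c : arity l),
    (i < i')%N -> h.+1 = (i' + n)%N -> h' = i :> nat ->
    homog p b -> homog q c ->
    pcomp e2 h (pcomp e1 i a b) c
      = sgn (p * q) *: pcomp e4 h' (pcomp e3 i' a c) b;
  pcomp_sym : forall m n l (e : l.+1 = (m + n)%N) (i : 'I_m)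
      (s : 'S_m) (t : 'S_n) (rho : 'S_l) (a : arity m) (b : arity n),
    block_perm i s t rho ->
    pcomp e (s i) (psym s a) (psym t b) = psym rho (pcomp e i a b) }.
Arguments psym {k o n} s.
Arguments pid {k o}.
Arguments pcomp {k o m n l} e i a b.

(* P(1) = k in degree 0, necessarily spanned by the operadic unit *)
Definition op_connected (k : fieldType) (P : operad k) : Prop :=
  pid != 0 :> P 1%N /\ forall x : P 1%N, exists c : k, x = c *: pid.

(* P(0) = 0 *)
Definition op_reduced (k : fieldType) (P : operad k) : Prop :=
  forall x : P 0%N, x = 0.

(* P(0) = k in degree 0 *)
Definition op_unitary (k : fieldType) (P : operad k) : Prop :=
  exists u : P 0%N,
    [/\ u != 0, homog 0 u & forall x : P 0%N, exists c : k, x = c *: u].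

Definition tame (k : fieldType) (r : nat) (P : operad k) : Prop :=
  forall (n : nat) (q : int), (2 <= n)%N ->
    q <= (1 - n%:Z) * (1 + r%:Z) -> forall x : P n, homog q x -> x = 0.

Definition op_finite_type (k : fieldType) (P : operad k) : Prop :=
  forall n, finite_type (P n).

Definition tset (T : Type) (m : nat) (a : m.-tuple T) (i : 'I_m) (x : T)
    : m.-tuple T :=
  [tuple if j == i then x else tnth a j | j < m].

Definition tperms (T : Type) (m : nat) (a : m.-tuple T) (s : 'S_m)
    : m.-tuple T :=
  [tuple tnth a (s j) | j < m].

(* Koszul sign of (x_0, x_1, ...) |-> (x_(s 0), x_(s 1), ...), for x_j of
   degree e_j *)
Definition koszul (k : fieldType) (m : nat) (s : 'S_m) (e : m.-tuple int) : k :=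
  \prod_(i < m) \prod_(j < m | (i < j)%N && (s j < s i)%N)
    sgn (tnth e (s i) * tnth e (s j)).
Arguments koszul {k m} s e.

Definition multilinear (k : fieldType) (U V W : lmodType k) (m : nat)
    (phi : U -> m.-tuple V -> W) : Prop :=
  (forall (c : k) p q a, phi (c *: p + q) a = c *: phi p a + phi q a)
  /\ (forall p a i (c : k) x y,
        phi p (tset a i (c *: x + y))
          = c *: phi p (tset a i x) + phi p (tset a i y)).

(* phi (p.s (x) v) = phi (p (x) s.v), with the Koszul sign rule *)
Definition balanced (k : fieldType) (P : operad k) (V : gmod k) (W : lmodType k)
    (m : nat) (phi : P m -> m.-tuple V -> W) : Prop :=
  forall (s : 'S_m) p (e : m.-tuple int) (a : m.-tuple V), homogs e a ->
    phi (psym s p) a = koszul s e *: phi p (tperms a s).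

(* [pact p a] is p(a_0, ..., a_(m-1)).  In [pact_comp], the inputs of a o_i b
   are split as s1 ++ v ++ s3, where size s1 = i and v feeds b. *)
Record palg (k : fieldType) (P : operad k) := Palg {
  pcar :> complex k;
  pact : forall m, P m -> m.-tuple pcar -> pcar;
  pact_lin : forall m, multilinear (@pact m);
  pact_homog : forall m (p : P m) q (e : m.-tuple int) (a : m.-tuple pcar),
    homog q p -> homogs e a -> homog (q + \sum_(j < m) tnth e j) (pact p a);
  pact_d : forall m (p : P m) q (e : m.-tuple int) (a : m.-tuple pcar),
    homog q p -> homogs e a ->
    cd (pact p a) = pact (cd p) a
      + \sum_(j < m) sgn (q + \sum_(i < m | (i < j)%N) tnth e i)
                       *: pact p (tset a j (cd (tnth a j)));
  pact_sym : forall m, balanced (@pact m);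
  pact_id : forall x, pact pid [tuple x] = x;
  pact_comp : forall m n l (e : l.+1 = (m + n)%N) (i : 'I_m)
      (p : P m) (b : P n) q (s1 s3 : seq pcar) (v : n.-tuple pcar)
      (t : l.-tuple pcar) (u : m.-tuple pcar) (d : l.-tuple int),
    homog q b -> homogs d t -> size s1 = i ->
    t = s1 ++ v ++ s3 :> seq pcar -> u = s1 ++ pact b v :: s3 :> seq pcar ->
    pact (pcomp e i p b) t
      = sgn (q * \sum_(j < l | (j < i)%N) tnth d j) *: pact p u }.
Arguments pact {k P A m} p a : rename.

Record palg_hom (k : fieldType) (P : operad k) (A B : palg P) := PalgHom {
  phom :> {linear A -> B};
  phom_homog : graded phom;
  phom_d : forall x, phom (cd x) = cd (phom x);
  phom_act : forall m (p : P m) (a : m.-tuple A),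
    phom (pact p a) = pact p [tuple of map phom a] }.

Definition quasi_iso (k : fieldType) (P : operad k) (A B : palg P)
    (f : palg_hom A B) : Prop :=
  forall n : int,
    (forall x : A, cocycle n x -> coboundary n (f x) -> coboundary n x)
    /\ (forall y : B, cocycle n y ->
          exists2 x : A, cocycle n x & coboundary n (y - f x)).

Definition unit_map (k : fieldType) (P : operad k) (A : palg P) (u : P 0%N) : A :=
  pact u [tuple].
Arguments unit_map {k P} A u.

Definition alg_connected (k : fieldType) (P : operad k) (r : nat) (A : palg P)
    : Prop :=
  [/\ forall i : int, i < 0 -> coh_zero A i,
      forall u : P 0%N, coboundary 0 (unit_map A u) -> u = 0,
      forall x : A, cocycle 0 x ->
        exists u : P 0%N, coboundary 0 (x - unit_map A u)
    & forall i : int, 1 <= i <= r%:Z -> coh_zero A i].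

(* The underlying graded algebra of A is P<V> = (+)_m P(m) (x)_(S_m) V^(x)m,
   the generators being included by iota: the structure maps
   p (x) v |-> p(iota v) make A satisfy the universal property of this sum of
   coinvariants of tensor products. *)
Definition free_on (k : fieldType) (P : operad k) (V : gmod k) (A : palg P)
    (iota : V -> A) : Prop :=
  [/\ linear iota, graded iota
    & forall (W : lmodType k) (phi : forall m, P m -> m.-tuple V -> W),
        (forall m, multilinear (phi m)) -> (forall m, balanced (phi m)) ->
        exists2 h : {linear A -> W},
          forall m (p : P m) (v : m.-tuple V),
            h (pact p [tuple of map iota v]) = phi m p v
        & forall h' : {linear A -> W},
            (forall m (p : P m) (v : m.-tuple V),
               h' (pact p [tuple of map iota v]) = phi m p v) -> h' =1 h].

(* j : B -> C is a KS-extension of degree n.  That the differential of C is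
   the derivation extending that of B and delta is expressed by [pact_d],
   [phom_d j] and the equation cd (iota' v) = j (delta v). *)
Definition KS_extension (k : fieldType) (P : operad k) (n : int)
    (B C : palg P) (j : palg_hom B C) : Prop :=
  0 < n /\
  exists (V : gmod k) (iota : V -> B) (V' : gmod k) (iota' : V' -> C)
         (delta : {linear V' -> B}),
    [/\ free_on iota,
        concentrated V' n,
        forall v, cocycle (n + 1) (delta v),
        forall v, cd (iota' v) = j (delta v)
      & free_on (V := dsum V V') (fun x => j (iota x.1) + iota' x.2)].

(* B is the initial P-algebra P(0) *)
Definition is_P0 (k : fieldType) (P : operad k) (B : palg P) : Prop :=
  bijective (unit_map B).

(* M is the union of the sequence N 0 -> N 1 -> ... *)
Definition is_union (k : fieldType) (P : operad k) (N : nat -> palg P)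
    (inc : forall i, palg_hom (N i) (N i.+1))
    (M : palg P) (c : forall i, palg_hom (N i) M) : Prop :=
  [/\ forall i x, c i.+1 (inc i x) = c i x,
      forall i, injective (c i)
    & forall y : M, exists i x, y = c i x].

(* Sullivan r-minimal algebras with stages indexed by the natural numbers;
   dg i is the degree of the i-th extension. *)
Definition sullivan_minimal_seq (k : fieldType) (P : operad k) (r : nat)
    (M : palg P) : Prop :=
  exists (N : nat -> palg P) (inc : forall i, palg_hom (N i) (N i.+1))
         (dg : nat -> nat) (c : forall i, palg_hom (N i) M),
    [/\ is_P0 (N 0%N),
        forall i, KS_extension (dg i)%:Z (inc i),
        forall i, (r < dg i <= dg i.+1)%N
      & is_union inc c].

(* Sullivan r-minimal algebras.  A sequence of KS-extensions of non-decreasing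
   degrees > r is indexed by pairs (i, q) in lexicographic order, N i q ->
   N i q.+1 being the q-th extension of degree r + 1 + i and N i.+1 0 the
   union of the N i q.  Indices in nat alone would not do: for instance the
   minimal model of the commutative algebra H^*((S^1 \/ S^1) x S^2), with
   r = 0, needs infinitely many extensions of degree 1 and then one of degree
   2. *)
Definition sullivan_minimal (k : fieldType) (P : operad k) (r : nat)
    (M : palg P) : Prop :=
  exists (N : nat -> nat -> palg P)
         (inc : forall i q, palg_hom (N i q) (N i q.+1))
         (lim : forall i q, palg_hom (N i q) (N i.+1 0%N))
         (c : forall i, palg_hom (N i 0%N) M),
    [/\ is_P0 (N 0%N 0%N),
        forall i q, KS_extension (r.+1 + i)%N%:Z (inc i q),
        forall i, is_union (inc i) (lim i)
      & is_union (fun i => lim i 0%N) c].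

Definition sullivan_minimal_model (k : fieldType) (P : operad k) (r : nat)
    (A M : palg P) (f : palg_hom M A) : Prop :=
  sullivan_minimal r M /\ quasi_iso f.

(* Main.v *)
Require Import Defs.
From HB Require Import structures.
From mathcomp Require Import all_boot all_order all_fingroup all_algebra.
From mathcomp Require Import boolp zify ring.
From mathcomp Require classical_sets.
Import Defs.

Set Implicit Arguments.
Unset Strict Implicit.
Unset Printing Implicit Defensive.

Import Order.TTheory GRing.Theory Num.Theory.
Local Open Scope ring_scope.

(** The model is built as in the classical theory of Sullivan models: degree
    after degree, and countably often in each degree [n > r], one attaches
    to the algebra [N] reached so far, with its map to [A], new generators
    that form a basis of the cohomology of the cone of [N -> A] in degree
    [n]. A class of the cone is a pair of a cocycle [x] of [N] and an
    element [a] of [A] with [f x = d a], and the generator attached for it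
    has differential [x] and image [a]: it kills the class ([attach_kills]).
    Tameness makes every operation with at least two inputs raise degrees so
    much that, up to degree [n], only linear combinations of the new
    generators are added to [N] ([span_low]); as they are independent in the
    cohomology of the cone, no class appears below degree [n]
    ([attach_acyclic]). In the union the cone has no cohomology in degree
    [n] either, and one passes to degree [n + 1]. If [A] is
    [(r+1)]-connected, nothing is attached in degree [r + 1], all generators
    have degree at least [r + 2], and new generators of degree [n] do not
    contribute to degree [n + 1] ([span_low2]): a single extension per
    degree is then enough ([outer_step]). If moreover [P] and the cohomology
    of [A] are of finite type, finitely many generators are attached in each
    degree ([attaching_bound]) and finitely many words in them have a given
    degree ([span_finite]).

    All these algebras live in a single one. A letter ([letter]) is a formal
    generator that carries a degree, a formal expression in other letters
    for its differential and an element of [A] for its image; the free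
    graded algebra [G] on all letters has a derivation [gder] and a morphism
    [gmor] to [A] determined by these data. On [G] the derivation need not
    have square zero, nor the morphism commute with the differentials, but
    both hold on the subalgebra spanned by the words in a suitable set of
    letters ([good]). Every stage of the tower is such a subalgebra, so that
    inclusions, unions and KS-extensions ([KS_incl]) are obtained from sets
    of letters, and no colimit has to be formed.

    It remains to construct the free algebra on a set of letters. As a
    vector space it is a quotient of formal sums by a relation that has the
    universal property of the coinvariants built in ([raw_eqv]). The action
    [act] expands its arguments one at a time. Its associativity ([act_act])
    and symmetry ([act_swapG]) then follow from the axioms of partial
    compositions, the symmetry being checked on exchanges of adjacent
    arguments only, which suffice because Koszul signs are multiplicative
    ([koszulM], [balanced_adj]). The Leibniz rule [gder_act_letters] is
    proved by the same expansion. *)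

(** * Signs *)

Definition oddz (e : int) : bool := odd `|e|%N.

Lemma oddzD a b : oddz (a + b) = oddz a (+) oddz b.
Proof. rewrite /oddz; lia. Qed.

Lemma oddzM a b : oddz (a * b) = oddz a && oddz b.
Proof. by rewrite /oddz abszM oddM. Qed.

Lemma oddzN a : oddz (- a) = oddz a.
Proof. by rewrite /oddz abszN. Qed.

Lemma oddz1 : oddz 1 = true. Proof. by []. Qed.

Lemma oddz0 : oddz 0 = false. Proof. by []. Qed.

Section Sign.
Variable k : fieldType.
Implicit Types a b : int.

Lemma sgnE a : sgn a = (-1) ^+ oddz a :> k.
Proof.
rewrite /sgn /oddz; case: a => n; first by rewrite -exprnP signr_odd.
by rewrite NegzE -exprnN abszN absz_nat signr_odd -exprVn invrN1.
Qed.

Lemma sgn0 : sgn 0 = 1 :> k. Proof. by []. Qed.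

Lemma sgnD a b : sgn (a + b) = sgn a * sgn b :> k.
Proof. by rewrite !sgnE oddzD signr_addb. Qed.

Lemma sgnK a : sgn a * sgn a = 1 :> k.
Proof. by rewrite !sgnE -signr_addb addbb. Qed.

End Sign.

(** Sign identities only depend on the parities of the exponents, so they are
    decided by a truth table. *)
Ltac sgn_tac :=
  rewrite ?sgnE ?(oddzD, oddzM, oddzN, oddz1, oddz0) -?signr_addb;
  (try congr (_ ^+ _));
  repeat match goal with |- context [oddz ?a] =>
    let b := fresh "b" in set b := oddz a; clearbody b; revert b end;
  do ?case => //.

(** * Graded vector spaces *)

Section GmodOperators.
Variables (k : fieldType) (V : gmod k).
Implicit Types (x y : V) (n : int) (c : int -> k).

Lemma homogD n x y : homog n x -> homog n y -> homog n (x + y).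
Proof. by move=> hx hy; rewrite -[x]scale1r; apply: homogP. Qed.

Lemma homogZ n (a : k) x : homog n x -> homog n (a *: x).
Proof. by move=> hx; rewrite -[_ *: _]addr0; apply: homogP => //; apply: homog0. Qed.

Lemma homogN n x : homog n x -> homog n (- x).
Proof. by move=> hx; rewrite -scaleN1r; apply: homogZ. Qed.

Lemma homogB n x y : homog n x -> homog n y -> homog n (x - y).
Proof. by move=> hx hy; apply: homogD => //; apply: homogN. Qed.

Lemma homog_sum n (I : Type) (s : seq I) (Q : pred I) (F : I -> V) :
  (forall i, Q i -> homog n (F i)) -> homog n (\sum_(i <- s | Q i) F i).
Proof. by move=> h; elim/big_ind: _ => //; [apply: homog0 | apply: homogD]. Qed.

Lemma homog_uniq m n x : homog m x -> homog n x -> m != n -> x = 0.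
Proof.
move=> hm hn mn.
pose y i := if i == m then x else if i == n then - x else 0.
have hy i : homog i (y i).
  rewrite /y; case: eqP => [->//|_]; case: eqP => [->|_]; last exact: homog0.
  exact: homogN.
have us : uniq [:: m; n] by rewrite /= inE mn.
have := homog_indep us hy _ (mem_head m _); rewrite /y eqxx; apply.
by rewrite !big_cons big_nil !eqxx eq_sym (negPf mn) addr0 subrr.
Qed.

Lemma gmod_ind (Q : V -> Prop) :
  (forall n x, homog n x -> Q x) -> (forall x y, Q x -> Q y -> Q (x + y)) ->
  forall x, Q x.
Proof.
move=> Qh QD x; have [s [y [_ hy ->]]] := homog_dec x.
by elim/big_ind: _ => [|//|i _]; [apply: (Qh 0); apply: homog0 | apply: Qh (hy i)].
Qed.

(** The operator that multiplies elements of degree [n] by [c n].  With it the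
    signs of the operadic axioms are written as linear operators, and no
    decomposition into homogeneous parts is needed in definitions. *)
Definition degop c x : V :=
  let s := cid (homog_dec x) in let y := cid (projT2 s) in
  \sum_(n <- projT1 s) c n *: projT1 y n.

Lemma dec_scale c (s t : seq int) (y z : int -> V) :
  uniq s -> uniq t -> (forall n, homog n (y n)) -> (forall n, homog n (z n)) ->
  \sum_(n <- s) y n = \sum_(n <- t) z n ->
  \sum_(n <- s) c n *: y n = \sum_(n <- t) c n *: z n.
Proof.
move=> us ut hy hz; pose u := undup (s ++ t).
have uu : uniq u by apply: undup_uniq.
have su : {subset s <= u} by move=> n; rewrite mem_undup mem_cat => ->.
have tu : {subset t <= u} by move=> n; rewrite mem_undup mem_cat orbC => ->.
rewrite (sum_extend _ us uu su) (sum_extend _ ut uu tu) => /eqP.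
rewrite -subr_eq0 -sumrB => /eqP e0.
rewrite (sum_extend _ us uu su) (sum_extend _ ut uu tu).
apply: eq_big_seq => n nu.
have h m : homog m ((if m \in s then y m else 0) - (if m \in t then z m else 0)).
  by apply: homogB; case: ifP => _ //; apply: homog0.
have /eqP := homog_indep uu h e0 nu; rewrite subr_eq0 => /eqP.
by case: ifP => _; [case: ifP => _ -> | case: ifP => _ // <-]; rewrite ?scaler0.
Qed.

Lemma degopE c (s : seq int) (y : int -> V) :
  uniq s -> (forall n, homog n (y n)) ->
  degop c (\sum_(n <- s) y n) = \sum_(n <- s) c n *: y n.
Proof.
move=> us hy; rewrite /degop; case: cid => t /= ht; case: cid => z /= [ut hz e].
by apply: dec_scale.
Qed.

Lemma common_dec x y : exists (s : seq int) (u v : int -> V),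
  [/\ uniq s, forall n, homog n (u n) /\ homog n (v n),
      x = \sum_(n <- s) u n & y = \sum_(n <- s) v n].
Proof.
have [s [u [us hu e]]] := homog_dec ((x, y) : dsum V V).
exists s, (fun n => (u n).1), (fun n => (u n).2); split => //.
  by have := congr1 (fun z : V * V => z.1) e; rewrite dsum_fst.
by have := congr1 (fun z : V * V => z.2) e; rewrite dsum_snd.
Qed.

Lemma degop_is_linear c : linear (degop c).
Proof.
move=> a x y; have [s [u [v [us huv -> ->]]]] := common_dec x y.
have hu n : homog n (u n) by case: (huv n).
have hv n : homog n (v n) by case: (huv n).
rewrite scaler_sumr -big_split /= degopE //; last first.
  by move=> n; apply: homogP.
rewrite !degopE // scaler_sumr -big_split; apply: eq_bigr => n _ /=.
by rewrite scalerDr !scalerA mulrC.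
Qed.
HB.instance Definition _ c := GRing.isLinear.Build k V V _ (degop c) (degop_is_linear c).

Lemma degop_homog c n x : homog n x -> degop c x = c n *: x.
Proof.
move=> hx; have := @degopE c [:: n] (fun m => if m == n then x else 0).
rewrite !big_cons !big_nil eqxx !addr0; apply=> // m.
by case: eqP => [->//|_]; apply: homog0.
Qed.

Lemma homog_degop c n x : homog n x -> homog n (degop c x).
Proof. by move=> hx; rewrite (degop_homog c hx); apply: homogZ. Qed.

Lemma eq_degop c c' : c =1 c' -> degop c =1 degop c'.
Proof. by move=> e x; apply: eq_bigr => n _; rewrite e. Qed.

Lemma degop_comp c c' x : degop c (degop c' x) = degop (fun n => c n * c' n) x.
Proof.
elim/gmod_ind: x => [n x hx|x y hx hy]; last by rewrite !raddfD /= hx hy.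
by rewrite !(degop_homog _ hx) linearZ /= (degop_homog _ hx) scalerA mulrC.
Qed.

Definition proj n : V -> V := degop (fun m => (m == n)%:R).
HB.instance Definition _ n := GRing.Linear.on (proj n).

(** The sign of moving an element past one of degree [e]. *)
Definition tau e : V -> V := degop (fun m => sgn (e * m)).
HB.instance Definition _ e := GRing.Linear.on (tau e).

Lemma proj_homog n m x : homog m x -> proj n x = if m == n then x else 0.
Proof.
by move=> hx; rewrite /proj (degop_homog _ hx); case: eqP; rewrite ?scale1r ?scale0r.
Qed.

Lemma homog_proj n x : homog n (proj n x).
Proof.
elim/gmod_ind: x => [m x hx|x y hx hy]; last by rewrite linearD; apply: homogD.
by rewrite (proj_homog n hx); case: eqP => [<-//|_]; apply: homog0.
Qed.

Lemma tau_homog e n x : homog n x -> tau e x = sgn (e * n) *: x.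
Proof. by move=> hx; rewrite /tau (degop_homog _ hx). Qed.

Lemma homog_tau e n x : homog n x -> homog n (tau e x).
Proof. exact: homog_degop. Qed.

Lemma tauD a b x : tau (a + b) x = tau a (tau b x).
Proof.
by rewrite /tau degop_comp; apply: eq_degop => n; rewrite mulrDl sgnD.
Qed.

Lemma tau0 x : tau 0 x = x.
Proof.
elim/gmod_ind: x => [m x hx|x y hx hy]; last by rewrite linearD /= hx hy.
by rewrite (tau_homog _ hx) mul0r sgn0 scale1r.
Qed.

End GmodOperators.

(** * Partial compositions indexed by natural numbers *)

Section Ins.
Variables (k : fieldType) (P : operad k).

(** Partial composition with all arities and the position as free natural
    numbers; totality replaces casts between arities by numerical side
    conditions. *)
Definition ins (m n l i : nat) (p : P m) (q : P n) : P l :=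
  match l.+1 =P (m + n)%N, (insub i : option 'I_m) with
  | ReflectT e, Some i' => pcomp e i' p q
  | _, _ => 0
  end.
Arguments ins {m n} l i p q.

Lemma insE m n l (e : l.+1 = (m + n)%N) (i : 'I_m) (p : P m) (q : P n) :
  ins l i p q = pcomp e i p q.
Proof. by rewrite /ins; case: eqP => // e'; rewrite valK (eq_irrelevance e' e). Qed.

Variant ins_spec m n l i : (P m -> P n -> P l) -> Prop :=
| InsPcomp (e : l.+1 = (m + n)%N) (j : 'I_m) of i = j :> nat :
    ins_spec i (fun (p : P m) (q : P n) => pcomp e j p q : P l)
| InsZero : ins_spec i (fun (p : P m) (q : P n) => 0 : P l).

Lemma insP m n l i : ins_spec i (@ins m n l i).
Proof.
case: (l.+1 =P (m + n)%N) => [e|ne]; last first.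
  have -> : @ins m n l i = fun p q => 0; last by constructor.
  by apply/funext => p; apply/funext => q; rewrite /ins; case: eqP.
case: (ltnP i m) => im.
  have -> : @ins m n l i = fun p q => pcomp e (Ordinal im) p q; last by constructor.
  by apply/funext => p; apply/funext => q; rewrite -insE.
have -> : @ins m n l i = fun p q => 0; last by constructor.
apply/funext => p; apply/funext => q; rewrite /ins; case: eqP => // e'.
by rewrite insubF // ltnNge im.
Qed.

Lemma ins_linl m n l i c (p p' : P m) (q : P n) :
  ins l i (c *: p + p') q = c *: ins l i p q + ins l i p' q.
Proof. by case: insP => [e j _|]; rewrite ?pcompDl // scaler0 addr0. Qed.

Lemma ins_is_linear m n l i (p : P m) : linear (ins l i p : P n -> P l).
Proof. by move=> c q q'; case: insP => [e j _|]; rewrite ?pcompDr // scaler0 addr0. Qed.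
HB.instance Definition _ m n l i (p : P m) :=
  GRing.isLinear.Build k (P n) (P l) _ (@ins m n l i p) (@ins_is_linear m n l i p).

Lemma insZr m n l i c (p : P m) (q : P n) : ins l i p (c *: q) = c *: ins l i p q.
Proof. exact: linearZ. Qed.

Lemma insDl m n l i (p p' : P m) (q : P n) :
  ins l i (p + p') q = ins l i p q + ins l i p' q.
Proof. by rewrite -[p]scale1r ins_linl !scale1r. Qed.

Lemma ins0l m n l i (q : P n) : ins l i (0 : P m) q = 0.
Proof. by have := ins_linl l i (-1) 0 (0 : P m) q; rewrite scaler0 addr0 scaleN1r addNr. Qed.

Lemma insZl m n l i c (p : P m) (q : P n) : ins l i (c *: p) q = c *: ins l i p q.
Proof. by rewrite -[c *: p]addr0 ins_linl ins0l addr0. Qed.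

Lemma ins_homog m n l i a b (p : P m) (q : P n) :
  homog a p -> homog b q -> homog (a + b) (ins l i p q).
Proof. by move=> hp hq; case: insP => [e j _|]; [apply: pcomp_homog | apply: homog0]. Qed.

(** Multilinear identities in operad elements reduce to homogeneous ones. *)
Lemma ins_ext2 m n l (F F' : P m -> P n -> P l) :
  (forall p, {morph F p : x y / x + y}) -> (forall q, {morph F^~ q : x y / x + y}) ->
  (forall p, {morph F' p : x y / x + y}) -> (forall q, {morph F'^~ q : x y / x + y}) ->
  (forall a b p q, homog a p -> homog b q -> F p q = F' p q) ->
  forall p q, F p q = F' p q.
Proof.
move=> h1 h2 h3 h4 h p q; elim/gmod_ind: p => [a p hp|x y hx hy]; last by rewrite h2 h4 hx hy.
by elim/gmod_ind: q => [b q hq|x y hx hy]; [apply: h hp hq | rewrite h1 h3 hx hy].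
Qed.

Lemma tau_ins m n l i e (p : P m) (q : P n) :
  tau e (ins l i p q) = ins l i (tau e p) (tau e q).
Proof.
move: p q; apply: ins_ext2.
- by move=> p x y; rewrite !raddfD.
- by move=> q x y; rewrite insDl raddfD.
- by move=> p x y; rewrite !raddfD.
- by move=> q x y; rewrite raddfD insDl.
- move=> a b p q hp hq; rewrite (tau_homog _ (ins_homog l i hp hq)).
  rewrite (tau_homog _ hp) (tau_homog _ hq) insZl linearZ scalerA /=.
  by congr (_ *: _); sgn_tac.
Qed.

Lemma cd_ins m n l i (p : P m) (q : P n) :
  cd (ins l i p q) = ins l i (cd p) q + ins l i (tau 1 p) (cd q).
Proof.
move: p q; apply: ins_ext2.
- by move=> p x y; rewrite !raddfD.
- by move=> q x y; rewrite insDl raddfD.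
- by move=> p x y; rewrite !raddfD /= addrACA.
- by move=> q x y; rewrite !raddfD !insDl addrACA.
- move=> a b p q hp hq; rewrite (tau_homog _ hp) mul1r.
  by case: insP => [e j _|]; rewrite ?linear0 ?addr0 // (pcomp_d _ _ _ hp) -!insE insZl.
Qed.

Lemma ins_seq m n l u v w i j h (a : P m) (b : P n) (c : P l) :
  u.+1 = (m + n)%N -> v.+1 = (u + l)%N -> w.+1 = (n + l)%N ->
  (i < m)%N -> (j < n)%N -> h = (i + j)%N ->
  ins v h (ins u i a b) c = ins v i a (ins w j b c).
Proof.
move=> e1 e2 e3 im jn hij.
have hu : (h < u)%N by lia.
have e4 : v.+1 = (m + w)%N by lia.
rewrite -[i]/(nat_of_ord (Ordinal im)) -[h]/(nat_of_ord (Ordinal hu)).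
rewrite -[j]/(nat_of_ord (Ordinal jn)) !insE.
exact: pcomp_seq.
Qed.

Lemma ins_par m n l u v w i i' h p q (a : P m) (b : P n) (c : P l) :
  u.+1 = (m + n)%N -> v.+1 = (u + l)%N -> w.+1 = (m + l)%N ->
  (i < i')%N -> (i' < m)%N -> h.+1 = (i' + n)%N -> homog p b -> homog q c ->
  ins v h (ins u i a b) c = sgn (p * q) *: ins v i (ins w i' a c) b.
Proof.
move=> e1 e2 e3 ii' im' hh hb hc.
have im : (i < m)%N by lia.
have hu : (h < u)%N by lia.
have iw : (i < w)%N by lia.
have e4 : v.+1 = (w + n)%N by lia.
rewrite -[in LHS](_ : nat_of_ord (Ordinal im) = i) // -[h]/(nat_of_ord (Ordinal hu)).
rewrite -[i']/(nat_of_ord (Ordinal im')) -[in RHS](_ : nat_of_ord (Ordinal iw) = i) //.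
rewrite !insE.
exact: pcomp_par.
Qed.

Lemma ins_idl n (b : P n) : ins n 0 pid b = b.
Proof.
have e : n.+1 = (1 + n)%N by [].
by rewrite -[0%N]/(nat_of_ord (@ord0 0)) insE pcomp_idl.
Qed.

Lemma ins_idr m i (a : P m) : (i < m)%N -> ins m i a pid = a.
Proof.
move=> im; have e : m.+1 = (m + 1)%N by rewrite addn1.
by rewrite -[i]/(nat_of_ord (Ordinal im)) insE pcomp_idr.
Qed.

Lemma ins_sym m n l (i : 'I_m) (s : 'S_m) (t : 'S_n) (rho : 'S_l) (a : P m) (b : P n) :
  l.+1 = (m + n)%N -> block_perm i s t rho ->
  ins l (s i) (psym s a) (psym t b) = psym rho (ins l i a b).
Proof. by move=> e h; rewrite !insE; apply: pcomp_sym. Qed.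

(** The two cases of equivariance that keep an exchange of two inputs an
    exchange of two inputs: away from the composed input, and inside it. *)
Lemma ins_tperm_l m n l (i j : 'I_m) (i' j' : 'I_l) h (a : P m) (b : P n) :
  l.+1 = (m + n)%N -> (h < m)%N -> i != h :> nat -> j != h :> nat ->
  i' = shift h n i :> nat -> j' = shift h n j :> nat ->
  ins l h (psym (tperm i j) a) b = psym (tperm i' j') (ins l h a b).
Proof.
move=> e hm ih jh ei ej; pose h0 := Ordinal hm.
have th : tperm i j h0 = h0 by rewrite tpermD.
rewrite -[b in LHS]psym1 -[in LHS](_ : nat_of_ord (tperm i j h0) = h); last by rewrite th.
rewrite (@ins_sym _ _ _ h0 _ _ (tperm i' j')) //; split=> [y x ex|u x uh ex]; rewrite th.
  have ex' : x = (h + y)%N :> nat by [].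
  rewrite perm1 tpermD //; apply/eqP => /(congr1 val) /=; rewrite ?ei ?ej ex' /shift;
  have := ltn_ord y; case: ifP; lia.
have uh' : u != h :> nat by [].
move: ex; rewrite -[nat_of_ord h0]/h => ex.
case: (tpermP i j u) uh' ex => [->|->|/eqP nu /eqP nv] uh' ex.
- by rewrite (_ : x = i') ?tpermL //; apply: val_inj; rewrite /= ei ex.
- by rewrite (_ : x = j') ?tpermR //; apply: val_inj; rewrite /= ej ex.
rewrite tpermD //; apply/eqP => /(congr1 val) /=; rewrite ?ei ?ej ex /shift.
  move: nu; rewrite -val_eqE /= => nu; case: ifP; case: ifP; lia.
move: nv; rewrite -val_eqE /= => nv; case: ifP; case: ifP; lia.
Qed.

Lemma ins_tperm_r m n l (i j : 'I_n) (i' j' : 'I_l) h (a : P m) (b : P n) :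
  l.+1 = (m + n)%N -> (h < m)%N ->
  i' = (h + i)%N :> nat -> j' = (h + j)%N :> nat ->
  ins l h a (psym (tperm i j) b) = psym (tperm i' j') (ins l h a b).
Proof.
move=> e hm ei ej; pose h0 := Ordinal hm.
have th : (1 : 'S_m)%g h0 = h0 by rewrite perm1.
rewrite -[a in LHS]psym1 -[in LHS](_ : nat_of_ord ((1 : 'S_m)%g h0) = h); last by rewrite th.
rewrite (@ins_sym _ _ _ h0 _ _ (tperm i' j')) //; split=> [y x ex|u x uh ex]; rewrite th ?perm1.
  have ex' : x = (h + y)%N :> nat by [].
  case: (tpermP i j y) ex' => [->|->|/eqP nu /eqP nv] ex'.
  - by rewrite (_ : x = i') ?tpermL //=; apply: val_inj; rewrite /= ei ex'.
  - by rewrite (_ : x = j') ?tpermR //=; apply: val_inj; rewrite /= ej ex'.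
  rewrite tpermD //; apply/eqP => /(congr1 val) /=; rewrite ?ei ?ej ex'.
    by move: nu; rewrite -val_eqE /=; lia.
  by move: nv; rewrite -val_eqE /=; lia.
have uh' : u != h :> nat by [].
move: ex; rewrite -[nat_of_ord h0]/h => ex.
rewrite tpermD //; apply/eqP => /(congr1 val) /=; rewrite ?ei ?ej ex /shift.
  by have := ltn_ord i; case: ifP; lia.
by have := ltn_ord j; case: ifP; lia.
Qed.

End Ins.
Arguments ins {k P m n} l i p q.

(** * Exchange of two adjacent blocks *)

(** [is_bswap a n n' rho] describes the permutation of positions that turns a
    word [s ++ v ++ v' ++ t] into [s ++ v' ++ v ++ t], with [a], [n], [n'] the
    lengths of [s], [v], [v']. *)
Definition bswap (a n n' x : nat) : nat :=
  (if x < a then x else if x < a + n' then x + n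
   else if x < a + n' + n then x - n' else x)%N.

Definition is_bswap m a n n' (rho : 'S_m) : Prop :=
  forall x : 'I_m, rho x = bswap a n n' x :> nat.

Lemma bswap_exists m a n n' :
  (a + n + n' <= m)%N -> exists rho : 'S_m, is_bswap a n n' rho.
Proof.
move=> hm; pose f (x : 'I_m) := insubd x (bswap a n n' x).
have fE x : f x = bswap a n n' x :> nat.
  rewrite val_insubd ifT // /bswap; have := ltn_ord x.
  by case: ifP; [|case: ifP; [|case: ifP]]; lia.
have f_inj : injective f.
  move=> x y /(congr1 val) /=; rewrite !fE /bswap => e; apply: val_inj => /=.
  move: e; case: ifP => h1; [|case: ifP => h2; [|case: ifP => h3]];
  (case: ifP => h4; [|case: ifP => h5; [|case: ifP => h6]]); lia.
by exists (perm f_inj) => x; rewrite permE fE.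
Qed.

Section InsBlock.
Variables (k : fieldType) (P : operad k).

(** Insertion into the second of two exchanged inputs makes the first one jump
    over the whole inserted block. *)
Lemma ins_bswap1 m n l (i j : 'I_m) (rho : 'S_l) (a : P m) (b : P n) :
  l.+1 = (m + n)%N -> j = i.+1 :> nat -> is_bswap i n 1 rho ->
  ins l i (psym (tperm i j) a) b = psym rho (ins l j a b).
Proof.
move=> e ij hr.
rewrite -[b in LHS]psym1 -[in LHS](_ : nat_of_ord (tperm i j j) = i); last by rewrite tpermR.
apply: ins_sym => //; split=> [y x ex|u x uh ex]; rewrite tpermR hr /bswap.
  by rewrite ex perm1 ij; have := ltn_ord y; case: ifP; [|case: ifP; [|case: ifP]]; lia.
move: uh; rewrite -val_eqE /= => uh.
rewrite ex /shift ij; case: (tpermP i j u) uh => [->|->|/eqP nu /eqP nv] uh.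
- by rewrite ij ltnSn; do ![case: ifP]; lia.
- by rewrite eqxx in uh.
move: nu; rewrite -val_eqE /= => nu.
by do ![case: ifP]; lia.
Qed.

(** Insertion into the input that jumps over a block makes a block jump over
    a block. *)
Lemma ins_bswap m n n' l (i : 'I_m) (r : 'S_m) (rho : 'S_l) (a : P m) (b : P n') :
  l.+1 = (m + n')%N -> (i + n < m)%N ->
  is_bswap i n 1 r -> is_bswap i n n' rho ->
  ins l (i + n) (psym r a) b = psym rho (ins l i a b).
Proof.
move=> e im hr hrho.
have ri : r i = (i + n)%N :> nat by rewrite hr /bswap; do ![case: ifP]; lia.
rewrite -[b in LHS]psym1 -ri; apply: ins_sym => //.
split=> [y x ex|u x uh ex]; rewrite hrho ri /bswap ex.
  by rewrite perm1; have := ltn_ord y; do ![case: ifP]; lia.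
move: uh; rewrite -val_eqE /= hr /bswap /shift => uh.
by do ![case: ifP]; lia.
Qed.

(** Inserting two operations in exchanged adjacent inputs amounts to
    exchanging the blocks of their inputs. *)
Lemma ins_block m n n' u v w (i j : 'I_m) (rho : 'S_v) d d'
    (p : P m) (q : P n) (q' : P n') :
  u.+1 = (m + n)%N -> v.+1 = (u + n')%N -> w.+1 = (m + n')%N ->
  j = i.+1 :> nat -> is_bswap i n n' rho -> homog d q -> homog d' q' ->
  ins v (i + n) (ins u i (psym (tperm i j) p) q) q'
    = sgn (d * d') *: psym rho (ins v (i + n') (ins w i p q') q).
Proof.
move=> e1 e2 e3 ij hrho hq hq'.
have jm := ltn_ord j.
have [r hr] : exists r : 'S_u, is_bswap i n 1 r by apply: bswap_exists; lia.
have iu : (i < u)%N by lia.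
rewrite (ins_bswap1 (rho := r)) //.
rewrite (@ins_bswap u n n' v (Ordinal iu) r rho) //=; last by lia.
have hh : (i + n').+1 = (j + n')%N by rewrite ij.
have ltij : (i < j)%N by rewrite ij.
rewrite (ins_par p e3 _ e1 ltij jm hh hq' hq); last by lia.
by rewrite linearZ /= scalerA [d' * d]mulrC sgnK scale1r.
Qed.

End InsBlock.

(** * The free graded algebra on a set of letters *)

Local Notation rep := generic_quotient.repr.

Section FreeModule.
Variables (k : fieldType) (P : operad k) (L : Type) (deg : L -> int).
Implicit Types (W : lmodType k).

Definition wdeg (w : seq L) : int := \sum_(x <- w) deg x.

Lemma wdeg_cat s t : wdeg (s ++ t) = wdeg s + wdeg t.
Proof. exact: big_cat. Qed.

Lemma wdeg_cons x s : wdeg (x :: s) = deg x + wdeg s.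
Proof. exact: big_cons. Qed.

Lemma wdeg_nil : wdeg [::] = 0.
Proof. exact: big_nil. Qed.

Definition wdegE := (wdeg_cat, wdeg_cons, wdeg_nil).

Definition family (W : Type) := forall m, P m -> seq L -> W.

(** The families that factor through the coinvariants of the tensor products
    of [P m] with words of length [m].  Only exchanges of adjacent letters are
    mentioned: they generate the symmetric groups, and their Koszul signs are
    immediate. *)
Record adm (W : lmodType k) (F : family W) : Prop := Adm {
  adm_lin : forall m v, size v = m -> forall c (p p' : P m),
    F m (c *: p + p') v = c *: F m p v + F m p' v;
  adm_swap : forall m (i j : 'I_m) (p : P m) v1 x y v2,
    j = i.+1 :> nat -> size v1 = i -> size (v1 ++ x :: y :: v2) = m ->
    F m (psym (tperm i j) p) (v1 ++ x :: y :: v2)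
      = sgn (deg x * deg y) *: F m p (v1 ++ y :: x :: v2) }.

Definition raw := {v : seq L & P (size v)}.
HB.instance Definition _ := gen_eqMixin raw.
HB.instance Definition _ := gen_choiceMixin raw.

Definition mkraw v (p : P (size v)) : raw := existT (fun v => P (size v) : Type) v p.

Definition raw_sum (W : lmodType k) (F : family W) (s : seq raw) : W :=
  \sum_(g <- s) F _ (projT2 g) (projT1 g).

(** Two formal sums are identified when no admissible family separates them,
    so that the universal property of the quotient is built in. *)
Definition raw_eqv (s t : seq raw) : Prop :=
  forall (W : lmodType k) (F : family W), adm F -> raw_sum F s = raw_sum F t.
Definition raw_eqb (s t : seq raw) : bool := `[< raw_eqv s t >].

Lemma raw_eqb_refl : reflexive raw_eqb.
Proof. by move=> s; apply/asboolP. Qed.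

Lemma raw_eqb_sym : symmetric raw_eqb.
Proof. by move=> s t; apply/asboolP/asboolP => h W F aF; rewrite (h W F). Qed.

Lemma raw_eqb_trans : transitive raw_eqb.
Proof.
by move=> t s u /asboolP h /asboolP h'; apply/asboolP => W F aF; rewrite (h W F) ?(h' W F).
Qed.

Definition raw_rel := EquivRel raw_eqb raw_eqb_refl raw_eqb_sym raw_eqb_trans.

Definition freeg := {eq_quot raw_rel}%qT.
HB.instance Definition _ := Choice.on freeg.

Definition lift (W : lmodType k) (F : family W) (x : freeg) : W := raw_sum F (rep x).

Definition mkg (s : seq raw) : freeg := (\pi_({eq_quot raw_rel}) s)%qT.

Lemma lift_mkg W (F : family W) s : adm F -> lift F (mkg s) = raw_sum F s.
Proof.
move=> aF; rewrite /lift.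
have /eqmodP/asboolP h : (rep (mkg s) = s %[mod {eq_quot raw_rel}])%qT by rewrite reprK.
exact: h.
Qed.

(** The defining relation of the quotient; it reduces every identity in the free
    module to one between the values of an admissible family. *)
Lemma lift_inj x y :
  (forall (W : lmodType k) (F : family W), adm F -> lift F x = lift F y) -> x = y.
Proof.
move=> h; rewrite -[x]reprK -[y]reprK; apply/eqmodP/asboolP; exact: h.
Qed.

Definition addg (x y : freeg) := mkg (rep x ++ rep y).
Definition scaleg (c : k) (x : freeg) :=
  mkg [seq mkraw (c *: projT2 g) | g : raw <- rep x].
Definition zerog := mkg [::].
Definition oppg x := scaleg (-1) x.

Lemma lift_add W (F : family W) x y : adm F -> lift F (addg x y) = lift F x + lift F y.
Proof. by move=> aF; rewrite lift_mkg // /raw_sum big_cat. Qed.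

Lemma lift_zero W (F : family W) : adm F -> lift F zerog = 0.
Proof. by move=> aF; rewrite lift_mkg // /raw_sum big_nil. Qed.

Lemma adm0 W (F : family W) m v : adm F -> size v = m -> F m 0 v = 0.
Proof.
move=> aF hv; have := adm_lin aF hv (-1) 0 0.
by rewrite scaler0 addr0 scaleN1r addNr.
Qed.

Lemma admZ W (F : family W) m v c p : adm F -> size v = m -> F m (c *: p) v = c *: F m p v.
Proof. by move=> aF hv; rewrite -[c *: p]addr0 (adm_lin aF hv) (adm0 aF hv) addr0. Qed.

Lemma admD W (F : family W) m v p p' :
  adm F -> size v = m -> F m (p + p') v = F m p v + F m p' v.
Proof. by move=> aF hv; rewrite -[p]scale1r (adm_lin aF hv) !scale1r. Qed.

Lemma lift_scale W (F : family W) c x : adm F -> lift F (scaleg c x) = c *: lift F x.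
Proof.
move=> aF; rewrite lift_mkg // /raw_sum big_map scaler_sumr.
by apply: eq_bigr => g _; rewrite admZ.
Qed.

Let liftE := (lift_add, lift_zero, lift_scale).

Fact addgA : associative addg.
Proof. by move=> x y z; apply: lift_inj => W F aF; rewrite !liftE // addrA. Qed.
Fact addgC : commutative addg.
Proof. by move=> x y; apply: lift_inj => W F aF; rewrite !liftE // addrC. Qed.
Fact add0g : left_id zerog addg.
Proof. by move=> x; apply: lift_inj => W F aF; rewrite !liftE // add0r. Qed.
Fact addNg : left_inverse zerog oppg addg.
Proof. by move=> x; apply: lift_inj => W F aF; rewrite !liftE // scaleN1r addNr. Qed.

HB.instance Definition _ := GRing.isZmodule.Build freeg addgA addgC add0g addNg.

Fact scalegA a b x : scaleg a (scaleg b x) = scaleg (a * b) x.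
Proof. by apply: lift_inj => W F aF; rewrite !liftE // scalerA. Qed.
Fact scale1g : left_id 1 scaleg.
Proof. by move=> x; apply: lift_inj => W F aF; rewrite !liftE // scale1r. Qed.
Fact scalegDr : right_distributive scaleg +%R.
Proof. by move=> c x y; apply: lift_inj => W F aF; rewrite !liftE // scalerDr. Qed.
Fact scalegDl x : {morph scaleg^~ x : a b / a + b}.
Proof. by move=> a b; apply: lift_inj => W F aF; rewrite !liftE // scalerDl. Qed.

HB.instance Definition _ := GRing.Zmodule_isLmodule.Build k freeg scalegA scale1g scalegDr scalegDl.

Lemma lift_lin W (F : family W) c x y : adm F ->
  lift F (c *: x + y) = c *: lift F x + lift F y.
Proof. by move=> aF; rewrite lift_add // lift_scale. Qed.

(** Total, so that arities only have to agree propositionally. *)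
Definition cast (m n : nat) (p : P n) : P m :=
  if n =P m is ReflectT e then eq_rect n (fun i => P i) p m e else 0.

Lemma cast_id m (p : P m) : cast m p = p.
Proof. by rewrite /cast; case: eqP => // e; rewrite eq_axiomK. Qed.

Definition gen : family freeg := fun m p v => mkg [:: mkraw (cast (size v) p)].

Lemma lift_gen W (F : family W) m (p : P m) v :
  adm F -> size v = m -> lift F (gen p v) = F m p v.
Proof.
move=> aF hv; case: _ / hv in p *.
by rewrite lift_mkg // /raw_sum big_seq1 cast_id.
Qed.

Lemma gen_adm : adm gen.
Proof.
split=> [m v hv c p p'|m i j p v1 x y v2 ij hi hm]; apply: lift_inj => W F aF.
  by rewrite lift_lin // !lift_gen // adm_lin.
have hm' : size (v1 ++ y :: x :: v2) = m by rewrite -hm !size_cat.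
by rewrite -[X in _ = lift F X]addr0 lift_lin // lift_zero // addr0 !lift_gen // adm_swap.
Qed.

Lemma freeg_sum (x : freeg) :
  x = \sum_(g <- rep x) gen (projT2 g) (projT1 g).
Proof.
apply: lift_inj => W F aF.
have h (s : seq raw) :
    lift F (\sum_(g <- s) gen (projT2 g) (projT1 g)) = raw_sum F s.
  elim: s => [|g s IH]; first by rewrite big_nil lift_zero // /raw_sum big_nil.
  by rewrite big_cons lift_add // IH lift_gen // /raw_sum big_cons.
by rewrite h.
Qed.

Lemma freeg_ind (Q : freeg -> Prop) :
  (forall m (p : P m) v, size v = m -> Q (gen p v)) ->
  (forall x y, Q x -> Q y -> Q (x + y)) -> forall x, Q x.
Proof.
move=> Qg QD x; rewrite (freeg_sum x); elim/big_ind: _ => //; last by move=> g _; apply: Qg.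
by rewrite -(adm0 gen_adm (m := 0) (v := [::])) //; apply: Qg.
Qed.

(** Only admissible families give linear maps, so the proof of admissibility is
    an argument of the map that carries the linear structure. *)
Definition liftL W (F : family W) (aF : adm F) : freeg -> W := lift F.
Lemma liftL_linear W (F : family W) (aF : adm F) : linear (liftL aF).
Proof. by move=> c x y; apply: lift_lin. Qed.
HB.instance Definition _ W (F : family W) (aF : adm F) :=
  GRing.isLinear.Build k freeg W _ (liftL aF) (liftL_linear aF).

Lemma lift_famD W (F F' : family W) x :
  lift (fun m p v => F m p v + F' m p v) x = lift F x + lift F' x.
Proof. exact: big_split. Qed.

Lemma lift_famZ W (F : family W) c x :
  lift (fun m p v => c *: F m p v) x = c *: lift F x.
Proof. by rewrite /lift /raw_sum scaler_sumr. Qed.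

Lemma eq_lift W (F F' : family W) x :
  (forall m (p : P m) v, size v = m -> F m p v = F' m p v) -> lift F x = lift F' x.
Proof. by move=> e; apply: eq_bigr => g _; apply: e. Qed.

End FreeModule.

Lemma size_consE (T : Type) (x : T) s : size (x :: s) = (size s).+1.
Proof. by []. Qed.

Lemma psym_proj (k : fieldType) (P : operad k) m (s : 'S_m) n (p : P m) :
  proj n (psym s p) = psym s (proj n p).
Proof.
elim/gmod_ind: p => [a p hp|x y hx hy]; last by rewrite !raddfD /= hx hy.
rewrite (proj_homog _ (psym_homog s hp)) (proj_homog _ hp).
by case: eqP => // _; rewrite linear0.
Qed.

Lemma psym_tau (k : fieldType) (P : operad k) m (s : 'S_m) e (p : P m) :
  tau e (psym s p) = psym s (tau e p).
Proof.
elim/gmod_ind: p => [a p hp|x y hx hy]; last by rewrite !raddfD /= hx hy.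
by rewrite (tau_homog _ (psym_homog s hp)) (tau_homog _ hp) linearZ.
Qed.

(** * The action of the operad on the free algebra *)

Section Action.
Variables (k : fieldType) (P : operad k) (L : Type) (deg : L -> int).
Local Notation G := (freeg P deg).
Local Notation wdeg := (wdeg deg).
Local Notation gen := (@gen k P L deg _).
Implicit Types (t u : seq G) (s v w : seq L).

(** [act t p s] is the operation [p] evaluated at the letters [s] followed by
    the elements [t] of the free algebra.  The elements are expanded one at a
    time from left to right, so that each new operation [q] only has to be
    moved past letters, whose degrees are known. *)
Fixpoint act t m (p : P m) s : G :=
  if t is x :: t' then
    lift (fun n (q : P n) v =>
      act t' (ins (m + n).-1 (size s) p (tau (wdeg s) q)) (s ++ v)) x
  else gen p s.

Lemma act_cons x t m (p : P m) s : act (x :: t) p s =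
  lift (fun n (q : P n) v =>
      act t (ins (m + n).-1 (size s) p (tau (wdeg s) q)) (s ++ v)) x.
Proof. by []. Qed.

Lemma act_nil m (p : P m) s : act [::] p s = gen p s.
Proof. by []. Qed.
Arguments act : simpl never.

Lemma act_lin t m c (p p' : P m) s : (size s + size t)%N = m ->
  act t (c *: p + p') s = c *: act t p s + act t p' s.
Proof.
elim: t m p p' s => [|x t IH] m p p' s /= hm.
  by rewrite !act_nil (adm_lin (gen_adm _ _)) // -hm addn0.
rewrite !act_cons -lift_famZ -lift_famD; apply: eq_lift => n q v hv.
by rewrite ins_linl IH // size_cat hv -hm; lia.
Qed.

(** Letters are never moved again once they are in place, so an exchange of two
    of them goes through the expansion of all later arguments. *)
Lemma act_swap t m (i j : 'I_m) (p : P m) v1 x y v2 :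
  j = i.+1 :> nat -> size v1 = i -> (size (v1 ++ x :: y :: v2) + size t)%N = m ->
  act t (psym (tperm i j) p) (v1 ++ x :: y :: v2)
    = sgn (deg x * deg y) *: act t p (v1 ++ y :: x :: v2).
Proof.
elim: t m i j p v2 => [|z t IH] m i j p v2 ij hi hm.
  by rewrite !act_nil (adm_swap (gen_adm _ _)) // -hm addn0.
rewrite !act_cons -lift_famZ; apply: eq_lift => n q v hv.
set s := v1 ++ x :: y :: v2; set s' := v1 ++ y :: x :: v2.
have es : size s' = size s by rewrite !size_cat.
have ew : wdeg s' = wdeg s by rewrite !wdegE; ring.
move: hm; rewrite -/s /= => hm.
have ss : (i.+1 < size s)%N by rewrite size_cat /=; lia.
have il : (i < (m + n).-1)%N by lia.
have jl : (j < (m + n).-1)%N by lia.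
rewrite (ins_tperm_l (i' := Ordinal il) (j' := Ordinal jl)) //=; try lia.
- rewrite -!catA /= IH //= ?es ?ew //.
  by move: hm; rewrite /s !size_cat /= !size_cat hv; lia.
- by rewrite /shift ifT //; lia.
by rewrite /shift ifT //; lia.
Qed.

(** The next step of the expansion depends on the coinvariants only: an exchange
    of letters inside the argument is one of letters already in place. *)
Lemma act_adm t m (p : P m) s : (size s + (size t).+1)%N = m ->
  adm deg (fun n (q : P n) v =>
      act t (ins (m + n).-1 (size s) p (tau (wdeg s) q)) (s ++ v)).
Proof.
move=> hm; split=> [n v hv c q q'|n i j q v1 x y v2 ij hi hn].
  by rewrite !linearP act_lin // size_cat hv; lia.
have il : (size s + i < (m + n).-1)%N by have := ltn_ord i; lia.
have jl : (size s + j < (m + n).-1)%N by have := ltn_ord j; lia.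
rewrite psym_tau (ins_tperm_r (i' := Ordinal il) (j' := Ordinal jl)) //; try lia.
rewrite !catA act_swap //=; try by rewrite ?ij ?size_cat; lia.
by rewrite -catA size_cat hn; lia.
Qed.

Lemma act_gen t m (p : P m) s n (q : P n) v : (size s + (size t).+1)%N = m -> size v = n ->
  act (gen q v :: t) p s
    = act t (ins (m + n).-1 (size s) p (tau (wdeg s) q)) (s ++ v).
Proof. by move=> hm hv; rewrite act_cons lift_gen //; apply: act_adm. Qed.

Lemma act_linG t1 t2 m (p : P m) s c x y :
  (size s + size t1 + (size t2).+1)%N = m ->
  act (t1 ++ (c *: x + y) :: t2) p s
    = c *: act (t1 ++ x :: t2) p s + act (t1 ++ y :: t2) p s.
Proof.
elim: t1 m p s => [|z t1 IH] m p s hm.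
  by rewrite !act_cons lift_lin //; apply: act_adm; rewrite -hm /=; lia.
rewrite !cat_cons !act_cons -lift_famZ -lift_famD; apply: eq_lift => n q v hv.
by rewrite IH // size_cat hv; move: hm => /=; lia.
Qed.

Lemma actDG t1 t2 m (p : P m) s x y : (size s + size t1 + (size t2).+1)%N = m ->
  act (t1 ++ (x + y) :: t2) p s = act (t1 ++ x :: t2) p s + act (t1 ++ y :: t2) p s.
Proof. by move=> hm; rewrite -[x]scale1r act_linG // !scale1r. Qed.

Lemma actD_cons t m (p : P m) s x y : (size s + (size t).+1)%N = m ->
  act ((x + y) :: t) p s = act (x :: t) p s + act (y :: t) p s.
Proof. by move=> hm; apply: (actDG (t1 := [::])); rewrite /= addn0. Qed.

Lemma act0G t1 t2 m (p : P m) s : (size s + size t1 + (size t2).+1)%N = m ->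
  act (t1 ++ 0 :: t2) p s = 0.
Proof.
by move=> hm; have := act_linG p (-1) 0 0 hm; rewrite scaler0 addr0 scaleN1r addNr.
Qed.

Lemma actZG t1 t2 m (p : P m) s c x : (size s + size t1 + (size t2).+1)%N = m ->
  act (t1 ++ (c *: x) :: t2) p s = c *: act (t1 ++ x :: t2) p s.
Proof. by move=> hm; rewrite -[c *: x]addr0 act_linG // act0G // addr0. Qed.

Lemma actDp t m (p p' : P m) s : (size s + size t)%N = m ->
  act t (p + p') s = act t p s + act t p' s.
Proof. by move=> hm; rewrite -[p]scale1r act_lin // !scale1r. Qed.

Lemma act0p t m s : (size s + size t)%N = m -> act t (0 : P m) s = 0.
Proof.
move=> hm; have := act_lin (-1) (0 : P m) 0 hm.
by rewrite scaler0 addr0 scaleN1r addNr.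
Qed.

Lemma actZp t m c (p : P m) s : (size s + size t)%N = m ->
  act t (c *: p) s = c *: act t p s.
Proof. by move=> hm; rewrite -[c *: p]addr0 act_lin // act0p // addr0. Qed.

(** ** Associativity *)

(** Both sides expand the entries of [u], on the left inside [b] and on the right
    after [b] has been inserted in [p]; sequential associativity of partial
    compositions identifies each step. *)
Lemma act_act_head t v m (p : P m) s n (b : P n) (u : seq G) l :
  (size s + (size t).+1)%N = m -> (size v + size u)%N = n -> l.+1 = (m + n)%N ->
  act (act u b v :: t) p s
    = act (u ++ t) (ins l (size s) p (tau (wdeg s) b)) (s ++ v).
Proof.
elim: u v n b l => [|x u IH] v n b l hm hn hl.
  have -> : l = (m + n).-1 by lia.
  by rewrite act_nil act_gen //; move: hn => /=; lia.
rewrite cat_cons; move: hn => /= hn.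
elim/freeg_ind: x => [a q w hw|x y hx hy]; last first.
  have hl' : (size (s ++ v) + (size (u ++ t)).+1)%N = l by rewrite !size_cat; lia.
  by rewrite (actD_cons _ _ _ hn) (actD_cons _ _ _ hl') (actD_cons _ _ _ hm) hx hy.
rewrite (act_gen _ _ hn hw).
have hn' : (size (v ++ w) + size u)%N = (n + a).-1 by rewrite size_cat hw; lia.
rewrite (IH _ _ _ (l + a).-1 hm hn'); last by lia.
rewrite act_gen //; last by rewrite !size_cat; lia.
rewrite tau_ins -tauD -wdeg_cat catA size_cat; congr (act _ _ _).
by rewrite (ins_seq (w := (n + a).-1) (i := size s) (j := size v)) //; lia.
Qed.

(** ** Degrees *)

Lemma gproj_adm n :
  adm deg (fun m (p : P m) w => gen (proj (n - wdeg w) p) w).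
Proof.
split=> [m v hv c p p'|m i j p v1 x y v2 ij hi hm].
  by rewrite linearP (adm_lin (gen_adm _ _)).
rewrite psym_proj (adm_swap (gen_adm _ _)) //.
by rewrite (_ : wdeg (v1 ++ x :: y :: v2) = wdeg (v1 ++ y :: x :: v2)) // !wdegE; ring.
Qed.

(** The grading of the free algebra is defined by its projections, so that
    homogeneous elements form a subspace and independence of degrees is
    immediate. *)
Definition gproj n : G -> G := liftL (gproj_adm n).
HB.instance Definition _ n := GRing.Linear.on (gproj n).

Lemma gproj_gen n m (p : P m) w : size w = m ->
  gproj n (gen p w) = gen (proj (n - wdeg w) p) w.
Proof. by move=> hw; rewrite /gproj /liftL lift_gen //; apply: gproj_adm. Qed.

Definition homogG (n : int) (x : G) : Prop := gproj n x = x.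

Lemma gen0 m w : size w = m -> gen (0 : P m) w = 0.
Proof. by move=> hw; rewrite (adm0 (gen_adm _ _)). Qed.

Lemma homogG_gen m (p : P m) w a : size w = m -> homog a p ->
  homogG (a + wdeg w) (gen p w).
Proof.
by move=> hw hp; rewrite /homogG gproj_gen // addrK (proj_homog _ hp) eqxx.
Qed.

Lemma gproj_gproj m n x : gproj m (gproj n x) = if m == n then gproj n x else 0.
Proof.
elim/freeg_ind: x => [l p w hw|x y hx hy]; last first.
  by rewrite !linearD /= hx hy; case: eqP => // _; rewrite addr0.
rewrite !gproj_gen // (proj_homog _ (homog_proj _ _)).
have -> : (n - wdeg w == m - wdeg w) = (m == n) by rewrite eq_sym; apply/eqP/eqP; lia.
by case: eqP => // _; rewrite gen0.
Qed.

Lemma homogG_gproj n x : homogG n (gproj n x).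
Proof. by rewrite /homogG gproj_gproj eqxx. Qed.

Lemma homogG0 n : homogG n 0.
Proof. by rewrite /homogG linear0. Qed.

Lemma homogGP n c x y : homogG n x -> homogG n y -> homogG n (c *: x + y).
Proof. by rewrite /homogG linearP /= => -> ->. Qed.

Lemma homogGD n x y : homogG n x -> homogG n y -> homogG n (x + y).
Proof. by move=> hx hy; rewrite -[x]scale1r; apply: homogGP. Qed.

Lemma homogGZ n c x : homogG n x -> homogG n (c *: x).
Proof. by move=> hx; rewrite -[c *: x]addr0; apply: homogGP => //; apply: homogG0. Qed.

Lemma homogG_ind n (Q : G -> Prop) :
  (forall m (p : P m) w, size w = m -> homog (n - wdeg w) p -> Q (gen p w)) ->
  (forall x y, Q x -> Q y -> Q (x + y)) ->
  forall x, homogG n x -> Q x.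
Proof.
move=> Qg QD x <-; elim/freeg_ind: x => [m p w hw|x y hx hy].
  by rewrite gproj_gen //; apply: Qg => //; apply: homog_proj.
by rewrite linearD; apply: QD.
Qed.

Lemma homogG_dec x : exists (s : seq int) (y : int -> G),
  [/\ uniq s, forall n, homogG n (y n) & x = \sum_(n <- s) y n].
Proof.
elim/freeg_ind: x => [m p w hw|x y [s [u [us hu ->]]] [s' [u' [us' hu' ->]]]].
  have [s [y [us hy ->]]] := homog_dec p.
  exists [seq n + wdeg w | n <- s], (fun n => gen (y (n - wdeg w)) w); split.
  - by rewrite map_inj_uniq //; apply: addIr.
  - by move=> n; rewrite -{1}[n](subrK (wdeg w)); apply: homogG_gen.
  rewrite big_map; elim: s {us} => [|n s IH]; first by rewrite !big_nil gen0.
  by rewrite !big_cons (admD _ _ (gen_adm _ _)) // IH addrK.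
exists (undup (s ++ s')), (fun n => (if n \in s then u n else 0) +
                                    (if n \in s' then u' n else 0)); split.
- exact: undup_uniq.
- by move=> n; apply: homogGD; case: ifP => // _; apply: homogG0.
rewrite big_split /=; congr (_ + _); apply: sum_extend; rewrite ?undup_uniq //.
  by move=> n; rewrite mem_undup mem_cat => ->.
by move=> n; rewrite mem_undup mem_cat orbC => ->.
Qed.

Lemma gproj_homog m n x : homogG n x -> gproj m x = if m == n then x else 0.
Proof. by move=> <-; rewrite gproj_gproj. Qed.

Lemma homogG_indep (s : seq int) (y : int -> G) :
  uniq s -> (forall n, homogG n (y n)) -> \sum_(n <- s) y n = 0 ->
  forall n, n \in s -> y n = 0.
Proof.
move=> us hy e n ns; have := congr1 (gproj n) e.
rewrite raddf_sum linear0 (bigD1_seq n) //= (gproj_homog n (hy n)) eqxx.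
rewrite big1 ?addr0 // => i ni.
by rewrite (gproj_homog n (hy i)) eq_sym (negPf ni).
Qed.

Fixpoint hom_all t (e : seq int) : Prop :=
  match t, e with
  | [::], [::] => True
  | x :: t', a :: e' => homogG a x /\ hom_all t' e'
  | _, _ => False
  end.

Definition sumz (e : seq int) : int := \sum_(a <- e) a.

Lemma act_homog t e m (p : P m) q s : (size s + size t)%N = m ->
  homog q p -> hom_all t e -> homogG (q + wdeg s + sumz e) (act t p s).
Proof.
rewrite /sumz.
elim: t e m p q s => [|x t IH] [|a e] //= m p q s hm hp.
  by move=> _; rewrite act_nil big_nil addr0; apply: homogG_gen => //; rewrite -hm addn0.
case=> hx ht; elim/homogG_ind: hx => [n b w hw hb|y z hy hz]; last first.
  by rewrite actD_cons //; apply: homogGD.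
rewrite act_gen //.
have hs : (size (s ++ w) + size t)%N = (m + n).-1 by rewrite size_cat; lia.
have := IH _ _ (ins (m + n).-1 (size s) p (tau (wdeg s) b)) _ _ hs
  (ins_homog _ _ hp (homog_tau _ hb)) ht.
by rewrite wdeg_cat big_cons; congr (homogG _ _); ring.
Qed.

(** ** Insertion behind other arguments *)

(** On the left [b] is inserted after the expansion of [t1], on the right before
    it: parallel associativity produces the sign. *)
Lemma act_act t1 e1 u t3 m (p : P m) n (b : P n) b' s l :
  hom_all t1 e1 -> homog b' b -> size u = n ->
  (size s + size t1 + (size t3).+1)%N = m -> l.+1 = (m + n)%N ->
  act (t1 ++ act u b [::] :: t3) p s
    = sgn (b' * (wdeg s + sumz e1))
        *: act (t1 ++ u ++ t3) (ins l (size s + size t1) p b) s.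
Proof.
rewrite /sumz.
elim: t1 e1 m p s l => [|x t1 IH] [|a e1] //= m p s l h1 hb hu hm hl.
  rewrite (act_act_head p b (l := l)) //; last by rewrite -hm addn0.
  rewrite cats0 big_nil addr0 addn0 (tau_homog _ hb) linearZ /= mulrC actZp //.
  by rewrite size_cat; lia.
case: h1 => hx h1; elim/homogG_ind: hx => [c q v hv hq|y z hy hz]; last first.
  by rewrite !actD_cons ?hy ?hz ?scalerDr // !size_cat; [lia | move=> /=; lia].
rewrite !act_gen //; try by rewrite !size_cat /=; lia.
rewrite (IH e1 _ _ _ (l + c).-1) //; try by rewrite ?size_cat; lia.
rewrite big_cons wdeg_cat size_cat.
rewrite (ins_par p (i := size s) (i' := (size s + (size t1).+1)%N) (p := a - wdeg v)
  (q := b') (w := l) (u := (m + c).-1)) //; try lia; last exact: homog_tau.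
rewrite actZp ?scalerA; last by rewrite !size_cat; lia.
by congr (_ *: _); rewrite -sgnD; sgn_tac.
Qed.

(** ** Symmetry *)

Lemma act_bswap1 t v' m (p : P m) s1 x s2 (rho : 'S_m) :
  is_bswap (size s1) 1 (size v') rho ->
  (size (s1 ++ x :: v' ++ s2) + size t)%N = m ->
  act t (psym rho p) (s1 ++ x :: v' ++ s2)
    = sgn (deg x * wdeg v') *: act t p (s1 ++ v' ++ x :: s2).
Proof.
elim: v' s1 rho => [|y v' IH] s1 rho hr hm.
  have -> : rho = 1%g.
    by apply/permP => z; apply: val_inj; rewrite perm1 /= hr /bswap; do ![case: ifP] => /=; lia.
  by rewrite psym1 wdegE mulr0 scale1r.
have im : (size s1 < m)%N by rewrite -hm size_cat /=; lia.
have jm : ((size s1).+1 < m)%N by rewrite -hm size_cat /=; lia.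
pose i := Ordinal im; pose j := Ordinal jm.
have -> : rho = (rho * tperm i j * tperm i j)%g by rewrite -mulgA tperm2 mulg1.
rewrite psymM act_swap //= -cat_rcons IH; last first.
- by rewrite -hm !size_cat size_rcons /= !size_cat /=; lia.
- move=> z; rewrite permM size_rcons; have := hr z.
  case: (tpermP i j (rho z)) => [->|->|/eqP n1 /eqP n2] /=.
  + by rewrite /bswap /=; do ![case: ifP] => /=; lia.
  + by rewrite /bswap /=; do ![case: ifP] => /=; lia.
  move: n1 n2; rewrite -!val_eqE /= => n1 n2 e.
  by move: n1 n2; rewrite e /bswap /=; do ![case: ifP] => /=; lia.
rewrite scalerA cat_rcons wdeg_cons -sgnD; congr (_ *: _); sgn_tac.
Qed.

(** A block jumps over another one letter at a time, starting with its last
    letter. *)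
Lemma act_bswap t v v' m (p : P m) s1 s2 (rho : 'S_m) :
  is_bswap (size s1) (size v) (size v') rho ->
  (size (s1 ++ v ++ v' ++ s2) + size t)%N = m ->
  act t (psym rho p) (s1 ++ v ++ v' ++ s2)
    = sgn (wdeg v * wdeg v') *: act t p (s1 ++ v' ++ v ++ s2).
Proof.
elim: v s1 rho p => [|x v IH] s1 rho p hr hm.
  have -> : rho = 1%g.
    by apply/permP => z; apply: val_inj; rewrite perm1 /= hr /bswap /=; do ![case: ifP] => /=; lia.
  by rewrite psym1 wdegE mul0r scale1r.
move: hm; rewrite !(size_cat, size_consE, cat_cons) => hm.
have [r1 h1] : exists r : 'S_m, is_bswap (size s1) 1 (size v') r.
  by apply: bswap_exists; lia.
have [r2 h2] : exists r : 'S_m, is_bswap (size s1).+1 (size v) (size v') r.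
  by apply: bswap_exists; lia.
have -> : rho = (r1 * r2)%g.
  apply/permP => z; apply: val_inj; rewrite permM /= hr h2 h1 /bswap /=.
  by do ![case: ifP] => /=; lia.
rewrite psymM -cat_rcons IH ?size_rcons //; last first.
  by rewrite !(size_cat, size_consE, size_rcons); lia.
rewrite cat_rcons act_bswap1 //; last by rewrite !(size_cat, size_consE); lia.
by rewrite scalerA wdeg_cons -sgnD; congr (_ *: _); sgn_tac.
Qed.

(** Once both elements are expanded into words, exchanging them exchanges two
    adjacent blocks of letters. *)
Lemma act_swapG t1 x y t2 m (i j : 'I_m) (p : P m) s a b :
  homogG a x -> homogG b y -> i = (size s + size t1)%N :> nat -> j = i.+1 :> nat ->
  (size s + size t1 + (size t2).+2)%N = m ->
  act (t1 ++ x :: y :: t2) (psym (tperm i j) p) s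
    = sgn (a * b) *: act (t1 ++ y :: x :: t2) p s.
Proof.
move=> hx hy.
elim: t1 m i j p s => [|z t1 IH] m i j p s /= hi ij hm; last first.
  rewrite !act_cons -lift_famZ; apply: eq_lift => n q v hv.
  have il : ((i + n).-1 < (m + n).-1)%N by lia.
  have jl : ((i + n) < (m + n).-1)%N by lia.
  rewrite (ins_tperm_l (i' := Ordinal il) (j' := Ordinal jl)) //=; try lia.
  - by apply: IH => /=; rewrite ?size_cat ?hv; lia.
  - by rewrite /shift ifF //; lia.
  by rewrite /shift ifF //; lia.
elim/homogG_ind: hx => [n q v hv hq|x1 x2 h1 h2]; last first.
  rewrite actD_cons /=; last by rewrite -hm addn0.
  rewrite (actDG (t1 := [:: y])) /=; last by lia.
  by rewrite h1 h2 scalerDr.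
elim/homogG_ind: hy => [n' q' v' hv' hq'|y1 y2 h1 h2]; last first.
  rewrite (actDG (t1 := [:: gen q v])) /=; last by lia.
  rewrite actD_cons /=; last by rewrite -hm addn0.
  by rewrite h1 h2 scalerDr.
rewrite addn0 in hi.
rewrite !act_gen //=; try by rewrite ?size_cat /=; lia.
have [rho hr] : exists r : 'S_((m + n).-1 + n').-1, is_bswap i n n' r.
  by apply: bswap_exists; lia.
rewrite !size_cat hv hv' -!hi.
rewrite (ins_block (w := (m + n').-1) (rho := rho) p _ _ _ _ _ (homog_tau _ hq) (homog_tau _ hq')) //; try lia.
have -> : ((m + n').-1 + n).-1 = ((m + n).-1 + n').-1 by lia.
rewrite !(tau_homog _ hq) !(tau_homog _ hq') !linearZ /= !insZl !linearZ /=.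
have hsz : (size ((s ++ v) ++ v') + size t2)%N = ((m + n).-1 + n').-1.
  by rewrite !size_cat; lia.
have hsz' : (size ((s ++ v') ++ v) + size t2)%N = ((m + n).-1 + n').-1.
  by rewrite !size_cat; lia.
rewrite !actZp // -!catA -[v']cats0 -[v]cats0 -!catA !cat0s.
rewrite (act_bswap (v := v) (v' := v')) ?cats0 -?hi ?hv ?hv' //; last first.
  by rewrite -hsz !size_cat; lia.
by rewrite !scalerA !wdegE -!sgnD; congr (_ *: _); sgn_tac.
Qed.

Lemma act_head_letter y t m (p : P m) s : (size s + (size t).+1)%N = m ->
  act (gen pid [:: y] :: t) p s = act t p (s ++ [:: y]).
Proof.
move=> hm; rewrite act_gen //.
have -> : (m + 1).-1 = m by lia.
rewrite (tau_homog _ (pid_homog P)) mulr0 sgn0 scale1r ins_idr //; lia.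
Qed.

Lemma act_letters t m (p : P m) s v : (size s + (size v + size t))%N = m ->
  act ([seq gen pid [:: y] | y <- v] ++ t) p s = act t p (s ++ v).
Proof.
elim: v s => [|y v IH] s hm; first by rewrite cats0.
rewrite /= act_head_letter ?size_cat ?size_map; last by move: hm => /=; lia.
by rewrite IH -?catA // size_cat; move: hm => /=; lia.
Qed.

Lemma gen_act m (p : P m) v : size v = m ->
  gen p v = act [seq gen pid [:: y] | y <- v] p [::].
Proof. by move=> hv; rewrite -[map _ _]cats0 act_letters // addn0. Qed.

End Action.
Arguments act : simpl never.

(** * Koszul signs *)

Section Koszul.
Variable k : fieldType.

(** A product over unordered pairs can be reindexed by a permutation, each pair
    being represented by its increasing enumeration. *)
Lemma pair_prod_perm m (s : 'S_m) (h : 'I_m -> 'I_m -> k) :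
  (forall i j, h i j = h j i) ->
  \prod_(i < m) \prod_(j < m | (i < j)%N) h (s i) (s j)
    = \prod_(i < m) \prod_(j < m | (i < j)%N) h i j.
Proof.
move=> hC; rewrite !pair_big_dep /=.
pose srt (p : 'I_m * 'I_m) := if (p.1 < p.2)%N then p else (p.2, p.1).
pose g (t : 'S_m) p := srt (t p.1, t p.2).
have gK (t : 'S_m) (p : 'I_m * 'I_m) : (p.1 < p.2)%N -> g t (g t^-1%g p) = p.
  case: p => x y /= xy; rewrite /g /srt /=.
  by case: (ltnP (t^-1%g x) (t^-1%g y)) => h1 /=; rewrite !permKV ?xy // ifF //; lia.
rewrite [RHS](reindex_onto (g s) (g s^-1%g)) /=; last by move=> p; apply: gK.
apply: eq_big => [[x y]|[x y] xy] /=; last first.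
  by rewrite /g /srt /=; case: ifP => _ //=; rewrite hC.
apply/idP/andP => [xy|[]].
  split; last by have := gK s^-1%g (x, y) xy; rewrite invgK => ->.
  have nxy : s x != s y by rewrite (inj_eq perm_inj) -val_eqE /=; lia.
  by rewrite /g /srt /=; case: ifP => //= h1; move: nxy; rewrite -val_eqE /=; lia.
move=> h1 /eqP h2.
have srt_le (q : 'I_m * 'I_m) : ((srt q).1 <= (srt q).2)%N.
  by rewrite /srt; case: ifP => /=; lia.
have := srt_le (s^-1%g (g s (x, y)).1, s^-1%g (g s (x, y)).2).
rewrite -/(g _ _) h2 /= leq_eqVlt => /orP[/eqP/val_inj xy|//].
by move: h1; rewrite xy /g /srt /= ltnn /= ltnn.
Qed.

Lemma koszul_perm m (s : 'S_m) (e : m.-tuple int) :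
  koszul s e = \prod_(i < m) \prod_(j < m | (i < j)%N)
    (if (s j < s i)%N then sgn (tnth e (s i) * tnth e (s j)) else 1 : k).
Proof. by apply: eq_bigr => i _; rewrite big_mkcondr. Qed.

(** A pair is inverted by [s * t] exactly when one, but not both, of [s] and [t]
    inverts it; pairs inverted twice contribute the square of a sign. *)
Lemma koszulM m (s t : 'S_m) (e : m.-tuple int) :
  koszul (s * t)%g e = koszul t e * koszul s (tperms e t) :> k.
Proof.
pose h (x y : 'I_m) : k :=
  if (x < y)%N != (t x < t y)%N then sgn (tnth e (t x) * tnth e (t y)) else 1.
have hC (x y : 'I_m) : h x y = h y x.
  rewrite /h mulrC; case: (ltngtP x y) => [||/val_inj -> //] xy;
  by case: (ltngtP (t x) (t y)) => // /val_inj/perm_inj e0; rewrite e0 ltnn in xy.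
have -> : koszul t e = \prod_(i < m) \prod_(j < m | (i < j)%N) h i j.
  rewrite koszul_perm; apply: eq_bigr => i _; apply: eq_bigr => j ij.
  rewrite /h ij; case: (ltngtP (t i) (t j)) => //= /val_inj/perm_inj e0.
  by rewrite e0 ltnn in ij.
rewrite -(pair_prod_perm s hC) !koszul_perm -big_split; apply: eq_bigr => i _.
rewrite -big_split; apply: eq_bigr => j ij /=.
rewrite !permM !tnth_mktuple /h.
have nij : s i != s j by rewrite (inj_eq perm_inj) -val_eqE /=; lia.
have ntij : t (s i) != t (s j) by rewrite (inj_eq perm_inj).
move: nij ntij; rewrite -!val_eqE /=.
by case: (ltngtP (s i) (s j)) => // _ _; case: (ltngtP (t (s i)) (t (s j))) => //= _ _;
  rewrite ?sgnK ?mulr1 ?mul1r.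
Qed.

Lemma val_tperm m (i j x : 'I_m) : tperm i j x =
  (if x == i :> nat then j else if x == j :> nat then i else x) :> nat.
Proof.
case: tpermP => [->|->|]; rewrite ?eqxx //; first by case: eqP => // ->.
by move=> /eqP + /eqP; rewrite -!val_eqE /= => /negPf -> /negPf ->.
Qed.

Lemma koszul_adj m (i j : 'I_m) (e : m.-tuple int) : j = i.+1 :> nat ->
  koszul (tperm i j) e = sgn (tnth e i * tnth e j) :> k.
Proof.
move=> ij; rewrite koszul_perm (bigD1 i) //= (bigD1 j) /=; last by rewrite ij.
rewrite tpermL tpermR ij ltnSn mulrC [tnth e j * _]mulrC mulrA.
have tE (x y : 'I_m) : (x < y)%N -> (x != i) || (y != j) -> (tperm i j x < tperm i j y)%N.
  by rewrite -!val_eqE /= !val_tperm; do ![case: ifP]; lia.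
rewrite big1 ?mulr1; last first.
  move=> x xi; apply: big1 => y xy.
  by rewrite ltnNge ltnW // tE // xi.
rewrite mul1r big1 ?mulr1 // => y /andP[xy yj].
have := tE i y xy; rewrite yj orbT tpermL ij => /(_ isT) h.
by rewrite ltnNge ltnW.
Qed.

Lemma tpermsM (T : Type) m (a : m.-tuple T) (s t : 'S_m) :
  tperms a (s * t) = tperms (tperms a t) s.
Proof. by apply: eq_from_tnth => j; rewrite !tnth_mktuple permM. Qed.

Lemma tperms1 (T : Type) m (a : m.-tuple T) : tperms a 1 = a.
Proof. by apply: eq_from_tnth => j; rewrite tnth_mktuple perm1. Qed.

Lemma koszul1 m (e : m.-tuple int) : koszul 1 e = 1 :> k.
Proof.
rewrite koszul_perm; apply: big1 => i _; apply: big1 => j ij.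
by rewrite !perm1 ifF //; lia.
Qed.

(** Any transposition is conjugate to one of closer points by an adjacent
    exchange, and transpositions generate. *)
Lemma perm_adj_ind m (Q : 'S_m -> Prop) :
  Q 1%g -> (forall s t, Q s -> Q t -> Q (s * t)%g) ->
  (forall i j : 'I_m, j = i.+1 :> nat -> Q (tperm i j)) -> forall s, Q s.
Proof.
move=> Q1 QM Qa.
have Qt n (i j : 'I_m) : j = (i + n).+1 :> nat -> Q (tperm i j).
  elim: n j => [|n IH] j ij; first by apply: Qa; rewrite ij addn0.
  have jm : ((i + n).+1 < m)%N by have := ltn_ord j; lia.
  pose j' := Ordinal jm.
  have -> : tperm i j = (tperm j' j * (tperm i j' * tperm j' j))%g.
    have := tpermJ i j' (tperm j' j); rewrite tpermL tpermD /conjg ?tpermV //.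
      by rewrite -val_eqE /=; lia.
    by rewrite -val_eqE /=; lia.
  apply: (QM); first by apply: Qa; rewrite /= ij; lia.
  by apply: QM; [apply: IH | apply: Qa; rewrite /= ij; lia].
have Qt' (i j : 'I_m) : Q (tperm i j).
  case: (ltngtP i j) => [ij|ij|/val_inj ->]; last by rewrite tperm1.
    by apply: (Qt (j - i.+1)%N); lia.
  by rewrite tpermC; apply: (Qt (i - j.+1)%N); lia.
move=> s; have [ts -> _] := prod_tpermP s.
by elim/big_ind: _ => // p _; apply: Qt'.
Qed.

(** With [koszulM] and [perm_adj_ind], symmetry has to be checked on adjacent
    arguments only.  The predicate [D] stands for homogeneity in whichever
    graded space the arguments are taken. *)
Lemma balanced_adj (P : operad k) (W : lmodType k) (T : Type) (D : T -> int -> Prop)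
    m (F : P m -> m.-tuple T -> W) :
  (forall (i j : 'I_m) p a (e : m.-tuple int), j = i.+1 :> nat ->
    (forall l, D (tnth a l) (tnth e l)) ->
    F (psym (tperm i j) p) a = sgn (tnth e i * tnth e j) *: F p (tperms a (tperm i j))) ->
  forall s p a (e : m.-tuple int), (forall l, D (tnth a l) (tnth e l)) ->
    F (psym s p) a = koszul s e *: F p (tperms a s).
Proof.
move=> Fa; elim/perm_adj_ind => [p a e _|s t hs ht p a e h|i j ij p a e h].
- by rewrite psym1 tperms1 koszul1 scale1r.
- rewrite psymM (ht _ _ _ h) (hs _ _ (tperms e t)); last first.
    by move=> l; rewrite !tnth_mktuple.
  by rewrite scalerA -koszulM tpermsM.
by rewrite (Fa i j p a e) // koszul_adj.
Qed.

Lemma tperms_adj (T : Type) m (a : m.-tuple T) (i j : 'I_m) : j = i.+1 :> nat ->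
  exists v1 v2, [/\ a = v1 ++ tnth a i :: tnth a j :: v2 :> seq T, size v1 = i
    & tperms a (tperm i j) = v1 ++ tnth a j :: tnth a i :: v2 :> seq T].
Proof.
move=> ij; have hm := ltn_ord j; rewrite ij in hm.
have si : (i < size a)%N by rewrite size_tuple.
have sj : (i.+1 < size a)%N by rewrite size_tuple.
have x0 := tnth a i.
have ea : a = take i a ++ tnth a i :: tnth a j :: drop i.+2 a :> seq T.
  rewrite !(tnth_nth x0) ij; apply: etrans (esym (cat_take_drop i a)) _.
  by rewrite (drop_nth x0 si) (drop_nth x0 sj).
have st : size (take i a) = i by rewrite size_takel // ltnW.
exists (take i a), (drop i.+2 a); split=> //.
apply: (@eq_from_nth _ x0) => [|l].
  by rewrite size_tuple !size_cat /= st size_drop size_tuple; lia.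
rewrite size_tuple => lm; rewrite -[l]/(nat_of_ord (Ordinal lm)) -tnth_nth tnth_mktuple.
rewrite nth_cat st /=.
case: tpermP => [/(congr1 val)/= ->|/(congr1 val)/= ->|/eqP n1 /eqP n2].
- by rewrite ltnn subnn.
- by rewrite ij ltnNge leqnSn /= subSnn.
move: n1 n2; rewrite -!val_eqE /= ij => n1 n2.
case: ltnP => li; first by rewrite (tnth_nth x0) nth_take.
have -> : (l - i = (l - i.+2).+2)%N by lia.
by rewrite /= nth_drop (tnth_nth x0) /=; congr nth; lia.
Qed.

End Koszul.

(** * Derivations of the free algebra *)

Section Derivation.
Variables (k : fieldType) (P : operad k) (L : Type) (deg : L -> int).
Local Notation G := (freeg P deg).
Local Notation wdeg := (wdeg deg).
Local Notation gen := (@gen k P L deg _).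
Variable dL : L -> G.
Hypothesis dL_homog : forall y, homogG (deg y + 1) (dL y).

Definition letter_elt (y : L) : G := gen pid [:: y].

Lemma homogG_letter y : homogG (deg y) (letter_elt y).
Proof.
have := @homogG_gen k P L deg 1 pid [:: y] 0 erefl (pid_homog P).
by rewrite add0r !wdegE addr0.
Qed.

Lemma act_pid (x : G) : act [:: x] (pid : P 1) [::] = x.
Proof.
elim/freeg_ind: x => [m p v hv|x y hx hy]; last by rewrite actD_cons // hx hy.
by rewrite act_gen // add1n /= wdeg_nil tau0 ins_idl.
Qed.

(** The entries of [t] are triples of an element, the value of the derivation on
    it and its degree: the derivation is not yet available when the Leibniz sum
    is used to define it. *)
Implicit Types (t : seq (G * G * int)) (u : seq G).
Definition elts t : seq G := [seq z.1.1 | z <- t].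
Definition degs t : seq int := [seq z.2 | z <- t].

Lemma size_elts t : size (elts t) = size t. Proof. exact: size_map. Qed.

(** The part of the Leibniz rule that differentiates the entries of [t], which
    stand between [u] and [u']; [e] is the degree of [u]. *)
Fixpoint leibniz u (e : int) t u' m (p : P m) : G :=
  if t is z :: t' then
    sgn e *: act (u ++ z.1.2 :: elts t' ++ u') (tau 1 p) [::]
      + leibniz (rcons u z.1.1) (e + z.2) t' u' p
  else 0.

Lemma leibniz_cat u e t1 t2 u' m (p : P m) :
  leibniz u e (t1 ++ t2) u' p =
    leibniz u e t1 (elts t2 ++ u') p + leibniz (u ++ elts t1) (e + sumz (degs t1)) t2 u' p.
Proof.
rewrite /sumz; elim: t1 u e => [|z t1 IH] u e.
  by rewrite /= cats0 big_nil addr0 add0r.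
by rewrite /= IH big_cons -addrA addrA cat_rcons /elts map_cat -catA addrA.
Qed.

Lemma leibniz_lin u e t u' m c (p p' : P m) : (size u + size t + size u')%N = m ->
  leibniz u e t u' (c *: p + p') = c *: leibniz u e t u' p + leibniz u e t u' p'.
Proof.
elim: t u e => [|z t IH] u e hm /=; first by rewrite scaler0 addr0.
rewrite IH ?size_rcons; last by move: hm => /=; lia.
rewrite linearP act_lin; last by rewrite !size_cat /= !size_cat size_map; move: hm => /=; lia.
by rewrite !scalerDr !scalerA mulrC addrACA.
Qed.

Lemma leibniz_swap_pre u1 x y u2 e t u' m (i j : 'I_m) (p : P m) a b :
  homogG a x -> homogG b y -> i = size u1 :> nat -> j = i.+1 :> nat ->
  (size (u1 ++ x :: y :: u2) + size t + size u')%N = m ->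
  leibniz (u1 ++ x :: y :: u2) e t u' (psym (tperm i j) p)
    = sgn (a * b) *: leibniz (u1 ++ y :: x :: u2) e t u' p.
Proof.
move=> hx hy hi ij; elim: t u2 e => [|z t IH] u2 e hm /=; first by rewrite scaler0.
have hm1 : (size (@nil L) + size u1 + (size (u2 ++ z.1.2 :: elts t ++ u')).+2)%N = m.
  by move: hm; rewrite !size_cat /= size_cat size_map; lia.
have hi1 : i = (size (@nil L) + size u1)%N :> nat by rewrite hi.
rewrite psym_tau -!catA /= (act_swapG _ hx hy hi1 ij hm1).
rewrite !rcons_cat /= IH; last first.
  by move: hm; rewrite !size_cat /= !size_rcons; lia.
by rewrite scalerDr !scalerA mulrC.
Qed.

Definition dgood (z : G * G * int) : Prop := homogG z.2 z.1.1 /\ homogG (z.2 + 1) z.1.2.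

(** The Leibniz sum is symmetric with the degrees of the undifferentiated
    entries: the extra sign of an entry of degree [a + 1] compensates the change
    of the sign in front of it. *)
Lemma leibniz_swap u e t1 z z' t2 u' m (i j : 'I_m) (p : P m) :
  dgood z -> dgood z' -> i = (size u + size t1)%N :> nat -> j = i.+1 :> nat ->
  (size u + size (t1 ++ z :: z' :: t2) + size u')%N = m ->
  leibniz u e (t1 ++ z :: z' :: t2) u' (psym (tperm i j) p)
    = sgn (z.2 * z'.2) *: leibniz u e (t1 ++ z' :: z :: t2) u' p.
Proof.
move=> [hx hdx] [hy hdy]; elim: t1 u e => [|w t1 IH] u e hi ij hm.
  rewrite /= -!cats1 -!catA /= (leibniz_swap_pre _ _ hx hy) //; last first.
  - by move: hm; rewrite !size_cat /=; lia.
  - by rewrite hi addn0.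
  have hm1 : (size (@nil L) + size u + (size (elts t2 ++ u')).+2)%N = m.
    by rewrite size_cat size_map; move: hm => /=; lia.
  have hi1 : i = (size (@nil L) + size u)%N :> nat by rewrite hi addn0.
  rewrite !psym_tau (act_swapG _ hdx hy hi1 ij hm1) (act_swapG _ hx hdy hi1 ij hm1).
  rewrite addrCA !scalerDr !scalerA -!sgnD; congr (_ *: _ + (_ *: _ + _ *: _)).
  - sgn_tac.
  - sgn_tac.
  by rewrite addrAC.
have hm' := hm; move: hm'; rewrite /= size_cat /= => hm'.
rewrite /= IH ?size_rcons /=; last first.
- by rewrite size_cat /=; lia.
- by [].
- by rewrite hi /=; lia.
rewrite scalerDr psym_tau; congr (_ + _).
rewrite /elts !map_cat /= -!catA /=.
have E r : u ++ w.1.2 :: [seq x.1.1 | x <- t1] ++ r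
    = (u ++ w.1.2 :: [seq x.1.1 | x <- t1]) ++ r by rewrite -catA.
rewrite !E (act_swapG _ hx hy) //=.
- by rewrite !scalerA mulrC.
- by rewrite size_cat /= size_map hi.
by rewrite !(size_cat, size_consE, size_elts, size_map); lia.
Qed.

Definition letter_data (y : L) : G * G * int := (letter_elt y, dL y, deg y).

Lemma dgood_letter y : dgood (letter_data y).
Proof. by split; [apply: homogG_letter | apply: dL_homog]. Qed.

Lemma gder_adm : adm deg (fun m (p : P m) v =>
  gen (cd p) v + leibniz [::] 0 [seq letter_data y | y <- v] [::] p).
Proof.
split=> [m v hv c p p'|m i j p v1 x y v2 ij hi hm].
  rewrite linearP (adm_lin (gen_adm _ _)) // leibniz_lin; last by rewrite size_map /= addn0.
  by rewrite scalerDr addrACA.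
rewrite psym_d (adm_swap (gen_adm _ _)) // scalerDr; congr (_ + _).
rewrite !map_cat /= (leibniz_swap _ _ (dgood_letter x) (dgood_letter y)) //.
  by rewrite size_map.
by rewrite -hm !size_cat /= !size_map /= addn0.
Qed.

(** The derivation that extends [dL] and the differential of the operad. *)
Definition gder : G -> G := liftL gder_adm.
HB.instance Definition _ := GRing.Linear.on gder.

Lemma gder_gen m (p : P m) v : size v = m ->
  gder (gen p v) = gen (cd p) v + leibniz [::] 0 [seq letter_data y | y <- v] [::] p.
Proof. by move=> hv; rewrite /gder /liftL lift_gen //; apply: gder_adm. Qed.

Lemma gder_letter y : gder (letter_elt y) = dL y.
Proof.
rewrite gder_gen // pid_d gen0 // add0r /= addr0 sgn0 scale1r.
by rewrite (tau_homog _ (pid_homog P)) mulr0 sgn0 scale1r act_pid.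
Qed.

Lemma hom_all_cat u1 e1 u2 e2 :
  hom_all u1 e1 -> hom_all u2 e2 -> hom_all (u1 ++ u2) (e1 ++ e2).
Proof. by elim: u1 e1 => [|x u1 IH] [|a e1] //= [hx h1] h2; split=> //; apply: IH. Qed.

Lemma sumz_cat e1 e2 : sumz (e1 ++ e2) = sumz e1 + sumz e2.
Proof. exact: big_cat. Qed.

Lemma sumz_cons a e : sumz (a :: e) = a + sumz e.
Proof. exact: big_cons. Qed.

Lemma sumz_nil : sumz [::] = 0.
Proof. exact: big_nil. Qed.

Definition sumzE := (sumz_cat, sumz_cons, sumz_nil).

Fixpoint dgoods t : Prop := if t is z :: t' then dgood z /\ dgoods t' else True.

Lemma hom_all_elts t : dgoods t -> hom_all (elts t) (degs t).
Proof. by elim: t => [|z t IH] //= [[hz _] /IH]. Qed.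

Lemma leibniz_homog u e t u' e' m (p : P m) q c :
  hom_all u e -> dgoods t -> hom_all u' e' -> homog q p ->
  (size u + size t + size u')%N = m ->
  homogG (q + 1 + sumz e + sumz (degs t) + sumz e') (leibniz u c t u' p).
Proof.
move=> hu ht hu' hp; elim: t u e c hu ht => [|z t IH] u e c hu /=.
  by move=> _ _; apply: homogG0.
case=> -[hz hdz] ht hm; apply: homogGD.
  apply: homogGZ.
  have hh : hom_all (u ++ z.1.2 :: elts t ++ u') (e ++ (z.2 + 1) :: degs t ++ e').
    by apply: hom_all_cat => //=; split=> //; apply: hom_all_cat => //; apply: hom_all_elts.
  have := act_homog (s := [::]) (m := m) _ (homog_tau 1 hp) hh.
  rewrite !sumzE wdegE addr0 => h.
  rewrite (_ : q + 1 + sumz e + (z.2 + sumz (degs t)) + sumz e'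
    = q + (sumz e + (z.2 + 1 + (sumz (degs t) + sumz e')))); last by ring.
  apply: h; rewrite !(size_cat, size_consE, size_elts, size_map) -hm /=; lia.
have := IH (rcons u z.1.1) (rcons e z.2) (c + z.2) _ ht.
rewrite -!cats1 !sumzE addr0 size_cat /= => h.
rewrite (_ : q + 1 + sumz e + (z.2 + sumz (degs t)) + sumz e'
  = q + 1 + (sumz e + z.2) + sumz (degs t) + sumz e'); last by ring.
by apply: h; [apply: hom_all_cat | lia].
Qed.

Lemma dgoods_letters v : dgoods [seq letter_data y | y <- v].
Proof. by elim: v => //= y v IH; split=> //; apply: dgood_letter. Qed.

Lemma degs_letters v : sumz (degs [seq letter_data y | y <- v]) = wdeg v.
Proof. by elim: v => [|y v IH]; rewrite /= !sumzE ?wdegE // IH. Qed.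

Lemma elts_letters v : elts [seq letter_data y | y <- v] = [seq letter_elt y | y <- v].
Proof. by rewrite /elts -map_comp. Qed.

Lemma gder_homog n x : homogG n x -> homogG (n + 1) (gder x).
Proof.
elim/homogG_ind => [m p v hv hp|y z hy hz]; last by rewrite linearD; apply: homogGD.
rewrite gder_gen //; apply: homogGD.
  have := homogG_gen deg hv (cd_homog hp); congr (homogG _ _); ring.
have := @leibniz_homog [::] [::] [seq letter_data y | y <- v] [::] [::] m p _ 0 I
  (dgoods_letters v) I hp.
rewrite degs_letters !sumzE size_map => h.
have -> : n + 1 = n - wdeg v + 1 + 0 + wdeg v + 0 by ring.
by apply: h; rewrite /= addn0.
Qed.

(** ** The Leibniz rule *)

(** The three parts of the Leibniz sum of [p] at a list with the entry [q v]
    become parts of the Leibniz sum of the composite of [p] and [q]: the entries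
    behind [q v], those in front of it, and those of [v]. *)
Section Leibniz.
Variables (v : seq G) (n : nat) (q : P n) (b : int).
Hypotheses (hv : size v = n) (hq : homog b q).
Local Notation x := (act v q [::]).

Lemma leibniz_pre u1 e1 u (c : int) t u' m (p : P m) l : hom_all u1 e1 ->
  (size u1 + (size u).+1 + size t + size u')%N = m -> l.+1 = (m + n)%N ->
  leibniz (u1 ++ x :: u) (c + b) t u' p
    = sgn (b * sumz e1) *: leibniz (u1 ++ v ++ u) c t u' (ins l (size u1) p q).
Proof.
move=> h1; elim: t u c => [|z t IH] u c hm hl /=; first by rewrite scaler0.
rewrite -!catA /= (act_act (s := [::]) (l := l) _ h1 hq) //=; last first.
  by move: hm; rewrite !(size_cat, size_consE, size_elts) /=; lia.
rewrite tau_ins (tau_homog _ hq) insZr actZp; last first.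
  by move: hm; rewrite !(size_cat, size_consE, size_elts) /=; lia.
rewrite !rcons_cat /= addrAC IH //; last by rewrite size_rcons; move: hm => /=; lia.
rewrite scalerDr !scalerA -!sgnD add0n wdegE add0r; congr (_ *: _ + _ *: _).
by sgn_tac.
Qed.

Lemma leibniz_post u e (c : int) t u' m (p : P m) l : hom_all u e -> dgoods t ->
  (size u + size t + (size u').+1)%N = m -> l.+1 = (m + n)%N ->
  leibniz u c t (x :: u') p
    = sgn (b * (sumz e + sumz (degs t)))
        *: leibniz u c t (v ++ u') (ins l (size u + size t) p q).
Proof.
elim: t u e c => [|z t IH] u e c hu /= ht hm hl; first by rewrite scaler0.
case: ht => -[hz hdz] ht.
have h1 : hom_all (u ++ z.1.2 :: elts t) (e ++ (z.2 + 1) :: degs t).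
  by apply: hom_all_cat => //=; split=> //; apply: hom_all_elts.
have := act_act (s := [::]) (l := l) (tau 1 p) h1 hq hv (t3 := u').
rewrite -!catA /= => -> //; last first.
  by rewrite !(size_cat, size_consE, size_elts) /=; lia.
have hu1 : hom_all (rcons u z.1.1) (rcons e z.2).
  by rewrite -!cats1; apply: hom_all_cat.
rewrite (IH _ _ _ hu1 ht); [|by rewrite size_rcons; lia|by []].
rewrite tau_ins (tau_homog _ hq) insZr actZp; last first.
  by rewrite !(size_cat, size_consE, size_elts) /=; lia.
have -> : (size (@nil L) + size (u ++ z.1.2 :: elts t) = size u + (size t).+1)%N.
  by rewrite !(size_cat, size_consE, size_elts).
have -> : (size (rcons u z.1.1) + size t = size u + (size t).+1)%N.
  by rewrite size_rcons; lia.
rewrite scalerDr !scalerA -!sgnD -cats1 !sumzE wdegE; congr (_ *: _ + _ *: _); sgn_tac.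
Qed.

Lemma leibniz_mid u1 e1 u (c : int) t u2 m (p : P m) l : hom_all u1 e1 ->
  (size u + size t)%N = n -> (size u1 + (size u2).+1)%N = m -> l.+1 = (m + n)%N ->
  act (u1 ++ leibniz u c t [::] q :: u2) (tau 1 p) [::]
    = sgn ((b + 1) * sumz e1) *: leibniz (u1 ++ u) (sumz e1 + c) t u2 (ins l (size u1) p q).
Proof.
move=> h1; elim: t u c => [|z t IH] u c hn hm hl /=.
  by rewrite act0G ?scaler0 // -hm addn0.
rewrite actDG; last by rewrite -hm.
rewrite actZG; last by rewrite -hm.
rewrite IH //; last by rewrite size_rcons; move: hn => /=; lia.
rewrite cats0 (act_act (s := [::]) (l := l) _ h1 (homog_tau 1 hq)) //; last first.
  by move: hn; rewrite !(size_cat, size_consE, size_elts) /=; lia.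
rewrite tau_ins (tau_homog _ hq) !insZr !actZp; last first.
- by move: hn; rewrite !(size_cat, size_consE, size_elts) /=; lia.
- by move: hn; rewrite !(size_cat, size_consE, size_elts) /=; lia.
rewrite -!catA /= rcons_cat -addrA scalerDr !scalerA -!sgnD add0n wdegE add0r.
by congr (_ *: _ + _ *: _); sgn_tac.
Qed.

End Leibniz.

Lemma leibniz_addl u1 x y u2 e t u' m (p : P m) :
  (size u1 + (size u2).+1 + size t + size u')%N = m ->
  leibniz (u1 ++ (x + y) :: u2) e t u' p
    = leibniz (u1 ++ x :: u2) e t u' p + leibniz (u1 ++ y :: u2) e t u' p.
Proof.
elim: t u2 e => [|z t IH] u2 e hm /=; first by rewrite addr0.
rewrite -!catA /= actDG; last first.
  by move: hm; rewrite !(size_cat, size_consE, size_elts) /=; lia.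
rewrite !rcons_cat /= IH ?size_rcons; last by move: hm => /=; lia.
by rewrite scalerDr addrACA.
Qed.

Lemma leibniz_add u e t1 x y dx dy a t2 u' m (p : P m) :
  (size u + size t1 + (size t2).+1 + size u')%N = m ->
  leibniz u e (t1 ++ (x + y, dx + dy, a) :: t2) u' p
    = leibniz u e (t1 ++ (x, dx, a) :: t2) u' p + leibniz u e (t1 ++ (y, dy, a) :: t2) u' p.
Proof.
elim: t1 u e => [|z t1 IH] u e hm /=.
  rewrite actDG; last by rewrite /= size_cat size_elts -hm /=; lia.
  rewrite -!cats1 leibniz_addl; last by rewrite /= -hm /=; lia.
  by rewrite scalerDr addrACA.
rewrite IH; last by rewrite size_rcons -hm /=; lia.
rewrite /elts !map_cat /= -!catA /=.
have E r : u ++ z.1.2 :: [seq w.1.1 | w <- t1] ++ r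
    = (u ++ z.1.2 :: [seq w.1.1 | w <- t1]) ++ r by rewrite -catA.
rewrite !E actDG; last first.
  by rewrite !(size_cat, size_consE, size_elts, size_map) -hm /=; lia.
by rewrite scalerDr addrACA.
Qed.

Definition with_der (z : G * int) : G * G * int := (z.1, gder z.1, z.2).

Fixpoint homs (t : seq (G * int)) : Prop :=
  if t is z :: t' then homogG z.2 z.1 /\ homs t' else True.

(** The Leibniz rule for evaluations at arbitrary elements; it holds by
    definition at letters, and the other elements are expanded one at a time. *)
Lemma gder_act_letters v (xs : seq (G * int)) m (p : P m) :
  homs xs -> (size v + size xs)%N = m ->
  let t := [seq letter_data y | y <- v] ++ [seq with_der z | z <- xs] in
  gder (act (elts t) p [::]) = act (elts t) (cd p) [::] + leibniz [::] 0 t [::] p.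
Proof.
move=> /=; elim: xs v m p => [|[x a] xs IH] v m p /=.
  move=> _ hm; rewrite cats0 elts_letters.
  have hv : size v = m by rewrite -hm addn0.
  by rewrite -!gen_act // gder_gen.
case=> hx hxs hm.
elim/homogG_ind: hx => [n q w hw hq|y z hy hz]; last first.
  rewrite [with_der _](_ : _ = (y + z, gder y + gder z, a)); last first.
    by rewrite /with_der /= linearD.
  rewrite leibniz_add; last by rewrite !size_map /= -hm; lia.
  move: hy hz; rewrite /elts !map_cat /= => hy hz.
  have hs : (size (@nil L) + size [seq i.1.1 | i <- [seq letter_data i | i <- v]] +
    (size [seq i.1.1 | i <- [seq with_der i | i <- xs]]).+1)%N = m.
    by rewrite !size_map -hm.
  by rewrite !actDG // linearD /= hy hz addrACA.
pose l := (m + n).-1.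
have hl : l.+1 = (m + n)%N by rewrite /l; lia.
set b := a - wdeg w in hq.
set A := [seq letter_data y | y <- v]; set B := [seq letter_data y | y <- w].
set X := [seq with_der z0 | z0 <- xs].
have sX : size X = size xs by rewrite size_map.
have sA : size (elts A) = size v by rewrite size_elts size_map.
have sB : size (elts B) = n by rewrite size_elts size_map.
have gB (q' : P n) : gen q' w = act (elts B) q' [::] by rewrite elts_letters; apply: gen_act.
have dB : gder (gen q w) = act (elts B) (cd q) [::] + leibniz [::] 0 B [::] q.
  by rewrite gder_gen // gB.
have hA : hom_all (elts A) (degs A) by apply: hom_all_elts; apply: dgoods_letters.
set E := elts A ++ elts B ++ elts X.
set s := sumz (degs A); pose S := sgn (b * s) : k; pose Q := ins l (size v) p q.
have hm1 : (size (@nil L) + size (elts A) + (size (elts X)).+1)%N = m.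
  by rewrite sA size_elts sX.
have sgnb : sgn b * sgn b = 1 :> k by apply: sgnK.
have act1 (p' : P m) (q' : P n) b' : homog b' q' ->
    act (elts A ++ act (elts B) q' [::] :: elts X) p' [::]
      = sgn (b' * s) *: act E (ins l (size v) p' q') [::].
  by move=> hq'; rewrite (act_act p' hA hq' sB hm1 hl) /= wdeg_nil add0r add0n sA.
have h2 : leibniz [::] 0 A (gen q w :: elts X) p = S *: leibniz [::] 0 A (elts B ++ elts X) Q.
  rewrite gB (leibniz_post (u := [::]) (e := [::]) sB hq 0 _ I (dgoods_letters v) _ hl); last first.
    by rewrite /= size_map size_elts sX.
  by rewrite sumz_nil add0r /= size_map.
have h3 : sgn s *: act (elts A ++ act (elts B) (cd q) [::] :: elts X) (tau 1 p) [::]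
    = S *: act E (ins l (size v) (tau 1 p) (cd q)) [::].
  rewrite (act1 _ _ _ (cd_homog hq)) scalerA -sgnD; congr (_ *: _); rewrite /S; sgn_tac.
have h4 : sgn s *: act (elts A ++ leibniz [::] 0 B [::] q :: elts X) (tau 1 p) [::]
    = S *: leibniz (elts A) s B (elts X) Q.
  rewrite (leibniz_mid sB hq 0 _ hA _ _ hl) ?cats0 ?addr0; last 2 first.
  - by rewrite /= size_map.
  - by rewrite sA size_elts sX.
  rewrite sA scalerA -sgnD; congr (_ *: _); rewrite /S; sgn_tac.
have h5 : leibniz (rcons (elts A) (gen q w)) (s + a) X [::] p
    = S *: leibniz (elts A ++ elts B) (s + wdeg w) X [::] Q.
  rewrite gB -cats1 (_ : s + a = s + wdeg w + b); last by rewrite /b; ring.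
  rewrite (leibniz_pre sB hq (u := [::]) _ _ hA _ hl) ?cats0 ?sA //.
  by rewrite /= sX; lia.
have eE : elts (A ++ with_der (gen q w, a) :: X) = elts A ++ gen q w :: elts X.
  by rewrite /elts map_cat.
have eE' : elts ([seq letter_data y | y <- v ++ w] ++ X) = E by rewrite /E /elts !map_cat catA.
have hE : (size (@nil L) + size E)%N = l by rewrite /= /E !size_cat sA sB size_elts sX; lia.
have := IH (v ++ w) l Q hxs; rewrite eE' => hIH.
rewrite eE {1}gB (act1 _ _ _ hq) linearZ /= -/S hIH; last by rewrite size_cat; lia.
rewrite /Q cd_ins actDp // -/Q map_cat -/A -/B -catA !leibniz_cat /= cats0 add0r -/s.
rewrite !cats0 degs_letters dB h2 h5 {1}gB (act1 _ _ _ hq) -/S.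
rewrite actDG; last by rewrite sA size_elts sX -hm.
rewrite !scalerDr h3 h4 /elts map_cat -/elts -!addrA; congr (_ + _).
exact: addrCA.
Qed.

Lemma gder_act (xs : seq (G * int)) m (p : P m) :
  homs xs -> size xs = m ->
  let t := [seq with_der z | z <- xs] in
  gder (act (elts t) p [::]) = act (elts t) (cd p) [::] + leibniz [::] 0 t [::] p.
Proof. exact: (gder_act_letters (v := [::])). Qed.

End Derivation.

(** * The action on tuples *)

Section TupleAction.
Variables (k : fieldType) (P : operad k) (L : Type) (deg : L -> int).
Local Notation G := (freeg P deg).
Local Notation wdeg := (wdeg deg).
Local Notation gen := (@gen k P L deg _).
Local Notation letter_elt := (@letter_elt k P L deg).
Variable dL : L -> G.
Hypothesis dL_homog : forall y, homogG (deg y + 1) (dL y).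
Local Notation gder := (gder dL_homog).

Definition gact m (p : P m) (a : m.-tuple G) : G := act a p [::].

Definition homogsG m (e : m.-tuple int) (a : m.-tuple G) : Prop :=
  forall j, homogG (tnth e j) (tnth a j).

Lemma val_tset (T : Type) m (a : m.-tuple T) (i : 'I_m) x :
  tset a i x = take i a ++ x :: drop i.+1 a :> seq T.
Proof.
have im := ltn_ord i.
have st : size (take i a) = i by rewrite size_takel // size_tuple ltnW.
apply: (@eq_from_nth _ x) => [|l].
  by rewrite size_tuple !size_cat /= st size_drop size_tuple; lia.
rewrite size_tuple => lm; rewrite -[l]/(nat_of_ord (Ordinal lm)) -tnth_nth tnth_mktuple.
rewrite nth_cat st /= -val_eqE /=.
case: ltngtP => li; last by rewrite li subnn.
  by rewrite (tnth_nth x) nth_take.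
have -> : (l - i = (l - i.+1).+1)%N by lia.
by rewrite /= nth_drop (tnth_nth x) /=; congr nth; lia.
Qed.

Lemma hom_all_tuple m (e : m.-tuple int) (a : m.-tuple G) : homogsG e a -> hom_all a e.
Proof.
case: m e a => [|m] e a; first by rewrite (tuple0 e) (tuple0 a).
move=> h; have {}h : forall i, (i < size a)%N -> homogG (nth 0 e i) (nth 0 a i).
  by rewrite size_tuple => i im; have := h (Ordinal im); rewrite !(tnth_nth 0).
have : size e = size a by rewrite !size_tuple.
elim: (tval a) (tval e) h => [|x s IH] [|b s'] //= h [hs]; split; first exact: (h 0%N).
by apply: IH => // i; apply: (h i.+1).
Qed.

Lemma sumz_tuple m (e : m.-tuple int) : sumz e = \sum_(j < m) tnth e j.
Proof. exact: big_tuple. Qed.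

Lemma sumz_take m (e : m.-tuple int) i :
  sumz (take i e) = \sum_(j < m | (j < i)%N) tnth e j.
Proof.
under eq_bigr => j _ do rewrite (tnth_nth 0).
have := size_tuple e; move: (tval e) => s <-.
elim: s i => [|a s IH] [|i] /=; rewrite ?sumz_nil ?sumz_cons ?IH.
- by rewrite big_ord0.
- by rewrite big_ord0.
- by rewrite big_pred0.
by rewrite [RHS]big_mkcond big_ord_recl /= -big_mkcond.
Qed.

Lemma gact_lin m : multilinear (@gact m).
Proof.
split=> [c p q a|p a i c x y]; rewrite /gact; first by rewrite act_lin ?size_tuple.
rewrite !val_tset act_linG // size_takel ?size_drop ?size_tuple; last exact: ltnW.
by have := ltn_ord i; rewrite /=; lia.
Qed.

Lemma gact_homog m (p : P m) q (e : m.-tuple int) (a : m.-tuple G) :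
  homog q p -> homogsG e a -> homogG (q + \sum_(j < m) tnth e j) (gact p a).
Proof.
move=> hp /hom_all_tuple ha; have := act_homog (s := [::]) _ hp ha.
by rewrite size_tuple wdeg_nil addr0 sumz_tuple; apply.
Qed.

Lemma gact_id (x : G) : gact pid [tuple x] = x.
Proof. exact: act_pid. Qed.

Lemma hom_all_take u e i : hom_all u e -> hom_all (take i u : seq G) (take i e).
Proof. by elim: u e i => [|x u IH] [|b e] [|i] //= [hx hu]; split=> //; apply: IH. Qed.

Lemma gact_comp m n l (e : l.+1 = (m + n)%N) (i : 'I_m)
    (p : P m) (b : P n) q (s1 s3 : seq G) (v : n.-tuple G)
    (t : l.-tuple G) (u : m.-tuple G) (d : l.-tuple int) :
  homog q b -> homogsG d t -> size s1 = i ->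
  t = s1 ++ v ++ s3 :> seq G -> u = s1 ++ gact b v :: s3 :> seq G ->
  gact (pcomp e i p b) t
    = sgn (q * \sum_(j < l | (j < i)%N) tnth d j) *: gact p u.
Proof.
move=> hq /hom_all_tuple hd hs1 ht hu; rewrite /gact ht hu.
have hm : (size (@nil L) + size s1 + (size s3).+1)%N = m.
  by rewrite -(size_tuple u) hu size_cat.
have hs : hom_all s1 (take i d).
  by have := hom_all_take i hd; rewrite ht take_size_cat.
rewrite (act_act p hs hq (size_tuple v) hm e) hs1 wdeg_nil add0r add0n insE.
rewrite scalerA (_ : sumz _ = \sum_(j < l | (j < i)%N) tnth d j) ?sgnK ?scale1r //.
by rewrite sumz_take.
Qed.



Lemma gact_sym m : forall (s : 'S_m) p (e : m.-tuple int) (a : m.-tuple G), homogsG e a ->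
  gact (psym s p) a = koszul s e *: gact p (tperms a s).
Proof.
move=> s p e a he.
apply: (balanced_adj (D := fun x b => homogG b x) (F := @gact m)) => //.
move=> {s p e a he} i j p a e ij he.
have [v1 [v2 [ea s1 ea']]] := tperms_adj a ij.
rewrite /gact ea ea' (act_swapG _ (he i) (he j)) //.
by have := size_tuple a; rewrite ea size_cat /= => ->.
Qed.

Lemma leibniz_sum u c t m (p : P m) :
  leibniz u c t [::] p = \sum_(j < size t) sgn (c + sumz (take j (degs t)))
    *: act (u ++ take j (elts t) ++ (nth (0, 0, 0) t j).1.2 :: drop j.+1 (elts t))
         (tau 1 p) [::] :> G.
Proof.
elim: t u c => [|z t IH] u c; first by rewrite big_ord0.
rewrite big_ord_recl /= cats0 sumz_nil addr0 drop0 IH; congr (_ + _).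
by apply: eq_bigr => j _; rewrite /= cat_rcons sumz_cons addrA.
Qed.

Lemma gact_d m (p : P m) q (e : m.-tuple int) (a : m.-tuple G) :
  homog q p -> homogsG e a ->
  gder (gact p a) = gact (cd p) a
    + \sum_(j < m) sgn (q + \sum_(i < m | (i < j)%N) tnth e i)
                     *: gact p (tset a j (gder (tnth a j))).
Proof.
move=> hp he; pose xs := zip a e.
have sae : size a = size e by rewrite !size_tuple.
have hxs : homs xs.
  have := hom_all_tuple he; rewrite /xs.
  by elim: (tval a) (tval e) => [|x s IH] [|b s'] //= [hx /IH].
have sxs : size xs = m by rewrite size_zip !size_tuple minnn.
set t := [seq with_der dL_homog z | z <- xs].
have et : elts t = a.
  by rewrite /elts /t -map_comp -[RHS](@unzip1_zip _ _ a e) ?sae.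
have dt : degs t = e.
  by rewrite /degs /t -map_comp -[RHS](@unzip2_zip _ _ a e) ?sae.
have H : gder (act (elts t) p [::]) = act (elts t) (cd p) [::] + leibniz [::] 0 t [::] p.
  exact: gder_act.
rewrite et in H; rewrite /gact H; congr (_ + _).
rewrite leibniz_sum size_map sxs; apply: eq_bigr => j _.
rewrite dt add0r sumz_take (tau_homog _ hp) mul1r actZp; last first.
  rewrite /= et size_cat /= size_takel ?size_drop ?size_tuple; last exact: ltnW.
  by have := ltn_ord j; lia.
rewrite scalerA -sgnD addrC /gact val_tset et.
rewrite (nth_map (0, 0)) ?sxs //= (nth_zip 0 0) //= (tnth_nth 0 a).
by congr (sgn (q + _) *: _).
Qed.

(** ** The square of the derivation *)

Lemma gact0 m (p : P m) (a : m.-tuple G) i : gact p (tset a i 0) = 0.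
Proof.
have := (gact_lin m).2 p a i (-1) 0 0.
by rewrite scaler0 addr0 scaleN1r addNr.
Qed.

Lemma tset_tnth (T : Type) m (a : m.-tuple T) i : tset a i (tnth a i) = a.
Proof. by apply: eq_from_tnth => j; rewrite tnth_mktuple; case: eqP => // ->. Qed.

Lemma gact_zero m (p : P m) (a : m.-tuple G) i : tnth a i = 0 -> gact p a = 0.
Proof. by move=> h; rewrite -(tset_tnth a i) h gact0. Qed.

Lemma tsetC (T : Type) m (a : m.-tuple T) i j x y : i != j ->
  tset (tset a i x) j y = tset (tset a j y) i x.
Proof.
move=> ij; apply: eq_from_tnth => l; rewrite !tnth_mktuple.
by case: eqP => // ->; rewrite eq_sym (negPf ij).
Qed.

(** The square of the derivation vanishes on an evaluation when it vanishes on
    all the arguments, the terms that differentiate two different arguments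
    cancelling in pairs. *)
Lemma gder_gder_act m (p : P m) q (e : m.-tuple int) (a : m.-tuple G) :
  homog q p -> homogsG e a -> (forall j, gder (gder (tnth a j)) = 0) ->
  gder (gder (gact p a)) = 0.
Proof.
move=> hp he h0.
rewrite (gact_d hp he) linearD /= (gact_d (cd_homog hp) he) cdd.
have -> : gact (0 : P m) a = 0.
  by have := (gact_lin m).1 (-1) 0 0 a; rewrite scaler0 addr0 scaleN1r addNr.
rewrite add0r raddf_sum /= -big_split /=.
pose ea j := tset e j (tnth e j + 1).
pose aj j := tset a j (gder (tnth a j)).
have hea j : homogsG (ea j) (aj j).
  move=> l; rewrite !tnth_mktuple; case: eqP => [_|_]; last exact: he.
  by apply: gder_homog; apply: he.
pose S (t : m.-tuple int) j := q + \sum_(i < m | (i < j)%N) tnth t i.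
pose F (j i : 'I_m) : G := (sgn (S e j) * sgn (S (ea j) i)) *: gact p (tset (aj j) i (gder (tnth (aj j) i))).
have FC (j i : 'I_m) : (i < j)%N -> F j i = - F i j.
  move=> ij; have nij : i != j by rewrite -val_eqE /=; lia.
  rewrite /F /aj !tnth_mktuple (negPf nij) eq_sym (negPf nij) tsetC 1?eq_sym // -scaleNr.
  congr (_ *: _); rewrite /S.
  have -> : \sum_(l < m | (l < i)%N) tnth (ea j) l = \sum_(l < m | (l < i)%N) tnth e l.
    apply: eq_bigr => l li; rewrite tnth_mktuple ifF //; apply/eqP => /(congr1 val) /=; lia.
  have -> : \sum_(l < m | (l < j)%N) tnth (ea i) l = \sum_(l < m | (l < j)%N) tnth e l + 1.
    rewrite (bigD1 i) //= [X in X + 1](bigD1 i) //= tnth_mktuple eqxx.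
    rewrite -!addrA [1 + _]addrC; congr (_ + (_ + _)).
    by apply: eq_bigr => l /andP[_ li]; rewrite tnth_mktuple (negPf li).
  rewrite !addrA !sgnD; rewrite [sgn 1]/sgn expr1z mulrN1 mulrN opprK mulrC; done.
have Fii (j : 'I_m) : F j j = 0.
  have /gact_zero h : tnth (tset (aj j) j (gder (tnth (aj j) j))) j = 0.
    by rewrite !tnth_mktuple eqxx.
  by rewrite /F h scaler0.
have -> : \sum_(j < m) (sgn (q + 1 + \sum_(i < m | (i < j)%N) tnth e i) *:
    gact (cd p) (aj j) + gder (sgn (S e j) *: gact p (aj j))) = \sum_(j < m) \sum_(i < m) F j i.
  apply: eq_bigr => j _.
  rewrite linearZ /= (gact_d hp (hea j)) scalerDr scaler_sumr addrA -scalerDl.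
  rewrite (_ : sgn _ + sgn _ = 0) ?scale0r ?add0r.
    by apply: eq_bigr => i _; rewrite scalerA.
  by rewrite addrAC sgnD [sgn 1]/sgn expr1z mulrN1 addNr.
have split1 (j : 'I_m) : \sum_(i < m) F j i
    = \sum_(i < m | (i < j)%N) F j i + \sum_(i < m | (j < i)%N) F j i.
  rewrite (bigID (fun i : 'I_m => (i < j)%N)) /=; congr (_ + _).
  rewrite (bigD1 j) ?ltnn //= Fii add0r; apply: eq_bigl => i.
  by rewrite -leqNgt -val_eqE /=; lia.
under eq_bigr => j _ do rewrite split1.
rewrite big_split /= [X in _ + X](exchange_big_dep xpredT) //= -big_split big1 // => j _.
rewrite /= (eq_bigr (fun i => - F i j)); last by move=> i /FC.
by rewrite sumrN addNr.
Qed.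

End TupleAction.

(** * Morphisms out of the free algebra *)

Section TupleLists.
Variables (k : fieldType) (P : operad k).
Implicit Types W : lmodType k.

(** Words are cut and pasted as sequences; being total, this extension needs no
    proof about their length. *)
Definition on_seq (T : Type) (W : lmodType k) m (f : m.-tuple T -> W) (s : seq T) : W :=
  if (insub s : option (m.-tuple T)) is Some a then f a else 0.

Lemma on_seqE T W m (f : m.-tuple T -> W) (a : m.-tuple T) : on_seq f a = f a.
Proof. by rewrite /on_seq valK. Qed.

Lemma on_seq_tuple T W m (f : m.-tuple T -> W) s (hs : size s == m) :
  on_seq f s = f (Tuple hs).
Proof. by rewrite -(on_seqE f). Qed.

Lemma cat_size_inj (T : Type) (s1 s2 t1 t2 : seq T) :
  s1 ++ t1 = s2 ++ t2 -> size s1 = size s2 -> s1 = s2 /\ t1 = t2.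
Proof.
move=> e hs; have := congr1 (take (size s1)) e; have := congr1 (drop (size s1)) e.
by rewrite take_size_cat // drop_size_cat // hs take_size_cat // drop_size_cat.
Qed.

Lemma tperms_adj_seq (T : Type) m (a : m.-tuple T) (i j : 'I_m) v1 x y v2 :
  j = i.+1 :> nat -> a = v1 ++ x :: y :: v2 :> seq T -> size v1 = i ->
  [/\ tnth a i = x, tnth a j = y & tperms a (tperm i j) = v1 ++ y :: x :: v2 :> seq T].
Proof.
move=> ij ea s1; have [w1 [w2 [ea' s1' ->]]] := tperms_adj a ij.
have [||-> [-> -> ->]] // := @cat_size_inj T w1 v1 (tnth a i :: tnth a j :: w2) (x :: y :: v2).
  by rewrite -ea -ea'.
by rewrite s1 s1'.
Qed.

Lemma tset_cat (T : Type) m (a : m.-tuple T) (i : 'I_m) s1 x s2 y :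
  a = s1 ++ x :: s2 :> seq T -> size s1 = i -> tset a i y = s1 ++ y :: s2 :> seq T.
Proof.
move=> ea s1i; rewrite val_tset ea -s1i take_size_cat // drop_cat.
by rewrite ltnNge leqnSn /= subSnn /= drop0.
Qed.

Section Multilinear.
Variables (V : gmod k) (W : lmodType k) (m : nat) (phi : P m -> m.-tuple V -> W).
Hypothesis hphi : multilinear phi.

Lemma on_seq_linp c p p' s :
  on_seq (phi (c *: p + p')) s = c *: on_seq (phi p) s + on_seq (phi p') s.
Proof.
rewrite /on_seq; case: insubP => [a _ _|_]; first by rewrite hphi.1.
by rewrite scaler0 addr0.
Qed.

Lemma on_seq_lin p s1 c x y s2 :
  on_seq (phi p) (s1 ++ (c *: x + y) :: s2)
    = c *: on_seq (phi p) (s1 ++ x :: s2) + on_seq (phi p) (s1 ++ y :: s2).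
Proof.
have [hm|hm] := boolP (size (s1 ++ x :: s2) == m); last first.
  by rewrite /on_seq !insubF ?scaler0 ?addr0 //; apply: negbTE; move: hm; rewrite !size_cat.
have im : (size s1 < m)%N by move: hm; rewrite size_cat /=; lia.
pose i := Ordinal im; pose a := Tuple hm.
have e z : s1 ++ z :: s2 = tset a i z :> seq V by rewrite (tset_cat z (erefl (tval a))).
by rewrite !e !on_seqE hphi.2.
Qed.

Lemma on_seqD p s1 x y s2 :
  on_seq (phi p) (s1 ++ (x + y) :: s2)
    = on_seq (phi p) (s1 ++ x :: s2) + on_seq (phi p) (s1 ++ y :: s2).
Proof. by rewrite -[x]scale1r on_seq_lin !scale1r. Qed.

Lemma on_seq0 p s1 s2 : on_seq (phi p) (s1 ++ 0 :: s2) = 0.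
Proof. by have := on_seq_lin p s1 (-1) 0 0 s2; rewrite scaler0 addr0 scaleN1r addNr. Qed.

Lemma on_seqZ p s1 c x s2 :
  on_seq (phi p) (s1 ++ (c *: x) :: s2) = c *: on_seq (phi p) (s1 ++ x :: s2).
Proof. by rewrite -[c *: x]addr0 on_seq_lin on_seq0 addr0. Qed.

End Multilinear.

(** The bridge between balancedness, which is about all permutations of graded
    elements, and admissibility, which is about adjacent letters. *)
Lemma adm_balanced (V : gmod k) (W : lmodType k) (L : Type) (deg : L -> int)
    (phi : forall m, P m -> m.-tuple V -> W) (b : L -> V) :
  (forall m, multilinear (@phi m)) -> (forall m, balanced (@phi m)) ->
  (forall y, homog (deg y) (b y)) ->
  adm deg (fun m (p : P m) v => on_seq (phi m p) (map b v)).
Proof.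
move=> hl hb hh; split=> [m v hv c p p'|m i j p v1 x y v2 ij hi hm].
  exact: on_seq_linp.
set w := v1 ++ _; have hw : size (map b w) == m by rewrite size_map; apply/eqP.
pose a := Tuple hw.
have he : size (map deg w) == m by rewrite size_map; apply/eqP.
pose e := Tuple he.
have ha : homogs e a.
  by move=> l; rewrite !(tnth_nth 0) /= !(nth_map x) // hm.
rewrite -[map b w]/(tval a) on_seqE (hb m _ p e a ha) koszul_adj //.
have ea : a = map b v1 ++ b x :: b y :: map b v2 :> seq V by rewrite /= /w map_cat.
have ee : e = map deg v1 ++ deg x :: deg y :: map deg v2 :> seq int by rewrite /= /w map_cat.
have [_ _ ea'] := tperms_adj_seq ij ea (etrans (size_map _ _) hi).
have [-> -> _] := tperms_adj_seq ij ee (etrans (size_map _ _) hi).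
by rewrite map_cat /= -ea' on_seqE.
Qed.

End TupleLists.

Section Morphism.
Variables (k : fieldType) (P : operad k) (L : Type) (deg : L -> int) (A : palg P).
Local Notation G := (freeg P deg).
Local Notation gen := (@gen k P L deg _).
Variable aL : L -> A.
Hypothesis aL_homog : forall y, homog (deg y) (aL y).

Definition pacts m (p : P m) (s : seq A) : A := on_seq (pact p) s.

Lemma gmor_adm : adm deg (fun m (p : P m) v => pacts p (map aL v)).
Proof. by apply: adm_balanced => // m; [apply: pact_lin | apply: pact_sym]. Qed.

(** The morphism of graded algebras determined by the images of the letters. *)
Definition gmor : G -> A := liftL gmor_adm.
HB.instance Definition _ := GRing.Linear.on gmor.

Lemma gmor_gen m (p : P m) v : size v = m -> gmor (gen p v) = pacts p (map aL v).
Proof. by move=> hv; rewrite /gmor /liftL lift_gen //; apply: gmor_adm. Qed.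

Lemma gmor_letter y : gmor (letter_elt P deg y) = aL y.
Proof.
rewrite gmor_gen //= /pacts -[[:: aL y]]/(tval [tuple aL y]) on_seqE.
exact: pact_id.
Qed.

Lemma gmor_homog n x : homogG n x -> homog n (gmor x).
Proof.
elim/homogG_ind => [m p v hv hp|y z hy hz]; last by rewrite linearD; apply: homogD.
rewrite gmor_gen //.
have hw : size (map aL v) == m by rewrite size_map hv.
have he : size (map deg v) == m by rewrite size_map hv.
rewrite /pacts (on_seq_tuple _ hw).
have := @pact_homog _ _ A m p _ (Tuple he) (Tuple hw) hp.
rewrite (_ : \sum_(j < m) tnth (Tuple he) j = wdeg deg v); last first.
  by rewrite -sumz_tuple /= /sumz /wdeg big_map.
rewrite subrK; apply=> j.
case: v hv hw he {hp} => [|y0 v] hv hw he; first by have := ltn_ord j; rewrite -[X in (_ < X)%N]hv.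
by rewrite !(tnth_nth 0) /= -!map_cons !(nth_map y0) // hv.
Qed.

Fixpoint homl (s : seq A) (e : seq int) : Prop :=
  match s, e with
  | [::], [::] => True
  | x :: s', a :: e' => homog a x /\ homl s' e'
  | _, _ => False
  end.

Lemma homl_size s e : homl s e -> size s = size e.
Proof. by elim: s e => [|x s IH] [|a e] //= [_ /IH ->]. Qed.

Lemma homl_nth s e i : homl s e -> homog (nth 0 e i) (nth 0 s i).
Proof.
elim: s e i => [|x s IH] [|a e] [|i] //=; try by move=> _; apply: homog0.
  by case.
by case=> _ /IH.
Qed.

Lemma homl_cat s e s' e' : homl s e -> homl s' e' -> homl (s ++ s') (e ++ e').
Proof. by elim: s e => [|x s IH] [|a e] //= [hx h1] h2; split=> //; apply: IH. Qed.

Lemma pacts_comp m n l i (p : P m) (b : P n) q s1 v s3 d :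
  l.+1 = (m + n)%N -> homog q b -> homl (s1 ++ v ++ s3) d -> size s1 = i ->
  size v = n -> (i + (size s3).+1)%N = m ->
  pacts (ins l i p b) (s1 ++ v ++ s3)
    = sgn (q * sumz (take i d)) *: pacts p (s1 ++ pacts b v :: s3).
Proof.
move=> e hq hd hi hv hm.
have ht : size (s1 ++ v ++ s3) == l by rewrite !size_cat; lia.
have hd' : size d == l by rewrite -(homl_size hd).
have hu : size (s1 ++ pacts b v :: s3) == m by rewrite size_cat /= hi hm.
have hv' : size v == n by apply/eqP.
have im : (i < m)%N by lia.
rewrite /pacts (on_seq_tuple _ ht) -[i in ins _ i]/(nat_of_ord (Ordinal im)) insE.
rewrite /pacts (on_seq_tuple (pact b) hv') in hu *; rewrite (on_seq_tuple (pact p) hu).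
have hdt : homogs (Tuple hd') (Tuple ht).
  by move=> j; rewrite !(tnth_nth 0); apply: homl_nth.
rewrite (pact_comp e p hq hdt (s1 := s1) (s3 := s3) (v := Tuple hv') (u := Tuple hu)) //.
by rewrite -sumz_take.
Qed.

Lemma pactsZ m c (p : P m) s : pacts (c *: p) s = c *: pacts p s.
Proof.
rewrite -[c *: p]addr0 /pacts (on_seq_linp (@pact_lin _ _ A m)).
suff -> : on_seq (pact (0 : P m)) s = 0 :> A by rewrite addr0.
by have := on_seq_linp (@pact_lin _ _ A m) (-1) 0 0 s; rewrite scaler0 addr0 scaleN1r addNr.
Qed.

Lemma homl_letters v : homl (map aL v) (map deg v).
Proof. by elim: v => //= y v IH; split. Qed.

Lemma homl_gmor t e : hom_all t e -> homl (map gmor t) e.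
Proof. by elim: t e => [|x t IH] [|a e] //= [hx /IH h]; split=> //; apply: gmor_homog. Qed.

(** Expanding an argument corresponds to the associativity axiom of the target.
    That axiom is about homogeneous elements, whence the hypothesis on [t]. *)
Lemma gmor_act_hom t e s m (p : P m) : hom_all t e -> (size s + size t)%N = m ->
  gmor (act t p s) = pacts p (map aL s ++ map gmor t).
Proof.
elim: t e s m p => [|x t IH] [|a e] //= s m p.
  by move=> _ hm; rewrite cats0 gmor_gen // -hm addn0.
case=> hx ht hm; elim/homogG_ind: hx => [n q v hv hq|y z hy hz]; last first.
  rewrite actD_cons // !linearD /= hy hz.
  by rewrite /pacts (on_seqD (@pact_lin _ _ A m)).
rewrite act_gen // gmor_gen // (IH e) //; last by rewrite size_cat; lia.
rewrite map_cat -catA.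
have hd : homl (map aL s ++ map aL v ++ map gmor t) (map deg s ++ map deg v ++ e).
  by do 2![apply: homl_cat; first exact: homl_letters]; apply: homl_gmor.
have hl : (m + n).-1.+1 = (m + n)%N by lia.
have hm1 : (size s + (size (map gmor t)).+1)%N = m by rewrite size_map.
have hv1 : size (map aL v) = n by rewrite size_map.
rewrite (pacts_comp p hl (homog_tau _ hq) hd (size_map _ _) hv1 hm1).
rewrite take_size_cat ?size_map // (tau_homog _ hq).
have -> : pacts (sgn (wdeg deg s * (a - wdeg deg v)) *: q) (map aL v)
   = sgn (wdeg deg s * (a - wdeg deg v)) *: pacts q (map aL v) by apply: pactsZ.
rewrite /pacts (on_seqZ (@pact_lin _ _ A m)) scalerA.
rewrite (_ : sumz _ = wdeg deg s) ?[_ * wdeg deg s]mulrC ?sgnK ?scale1r //.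
by rewrite /sumz /wdeg big_map.
Qed.

(** Identities between maps that are additive in each argument reduce to
    homogeneous arguments. *)
Lemma additive_ext (W : zmodType) (F F' : seq G -> W) m :
  (forall s1 x y s2, size (s1 ++ x :: s2) = m ->
     F (s1 ++ (x + y) :: s2) = F (s1 ++ x :: s2) + F (s1 ++ y :: s2)) ->
  (forall s1 x y s2, size (s1 ++ x :: s2) = m ->
     F' (s1 ++ (x + y) :: s2) = F' (s1 ++ x :: s2) + F' (s1 ++ y :: s2)) ->
  (forall s e, hom_all s e -> size s = m -> F s = F' s) ->
  forall s, size s = m -> F s = F' s.
Proof.
move=> FD FD' Fh s hs.
suff h t u e : hom_all u e -> size (u ++ t) = m -> F (u ++ t) = F' (u ++ t).
  exact: (h s [::] [::]).
elim: t u e => [|x t IH] u e hu hm; first by rewrite cats0 in hm *; apply: Fh hu hm.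
have [r [y [_ hy ->]]] := homogG_dec x.
have h1 n : F (u ++ y n :: t) = F' (u ++ y n :: t).
  rewrite -cat_rcons; apply: (IH _ (rcons e n)); last first.
    by move: hm; rewrite !size_cat size_rcons /=; lia.
  by rewrite -!cats1; apply: hom_all_cat.
have F0 : F (u ++ 0 :: t) = 0.
  by apply: (addrI (F (u ++ 0 :: t))); rewrite -FD ?addr0 // -hm !size_cat.
have F0' : F' (u ++ 0 :: t) = 0.
  by apply: (addrI (F' (u ++ 0 :: t))); rewrite -FD' ?addr0 // -hm !size_cat.
elim: r => [|n r IHr]; first by rewrite big_nil F0 F0'.
by rewrite big_cons FD ?FD' ?h1 ?IHr // -hm !size_cat.
Qed.

Lemma gmor_act m (p : P m) (a : m.-tuple G) :
  gmor (gact p a) = pact p [tuple of map gmor a].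
Proof.
rewrite /gact -on_seqE /= -/(pacts p (map gmor a)).
apply: (additive_ext (F := fun s => gmor (act s p [::])) (m := m)
  (F' := fun s => pacts p (map gmor s))) => [s1 x y s2 h|s1 x y s2 h|s e hs h|].
- by rewrite actDG ?linearD // -h size_cat.
- by rewrite !map_cat /= linearD /pacts (on_seqD (@pact_lin _ _ A m)).
- exact: (gmor_act_hom (s := [::]) p hs h).
exact: size_tuple.
Qed.

End Morphism.

(** * Subalgebras spanned by words in a set of letters *)

Section Span.
Variables (k : fieldType) (P : operad k) (L : Type) (deg : L -> int).
Local Notation G := (freeg P deg).
Local Notation wdeg := (wdeg deg).
Local Notation gen := (@gen k P L deg _).
Implicit Types E : L -> Prop.

Fixpoint word_in E (v : seq L) : Prop :=
  if v is y :: v' then E y /\ word_in E v' else True.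

Lemma word_in_cat E v w : word_in E v -> word_in E w -> word_in E (v ++ w).
Proof. by elim: v => //= y v IH [hy hv] hw; split=> //; apply: IH. Qed.

Lemma word_inS E E' v : (forall y, E y -> E' y) -> word_in E v -> word_in E' v.
Proof. by move=> h; elim: v => //= y v IH [/h hy /IH]. Qed.

Section GSpan.
Implicit Types D : seq L -> Prop.

(** Sets of words rather than of letters, so that the subalgebra generated by a
    set of letters and the vector space with these letters as a basis are two
    instances. *)
Inductive gspan D : G -> Prop :=
| Span0 : gspan D 0
| SpanD x y of gspan D x & gspan D y : gspan D (x + y)
| SpanGen m (p : P m) v of size v = m & D v : gspan D (gen p v).

Lemma gspanS D D' x : (forall v, D v -> D' v) -> gspan D x -> gspan D' x.
Proof.
move=> h; elim=> [|y z _ hy _ hz|m p v hv hD]; [exact: Span0 | exact: SpanD |].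
by apply: SpanGen => //; apply: h.
Qed.

Lemma spanZ D c x : gspan D x -> gspan D (c *: x).
Proof.
elim=> [|y z _ hy _ hz|m p v hv hD].
- by rewrite scaler0; apply: Span0.
- by rewrite scalerDr; apply: SpanD.
by rewrite -(admZ _ _ (gen_adm P deg)) //; apply: SpanGen.
Qed.

Lemma spanN D x : gspan D x -> gspan D (- x).
Proof. by rewrite -scaleN1r; apply: spanZ. Qed.

Lemma span_gproj D n x : gspan D x -> gspan D (gproj n x).
Proof.
elim=> [|y z _ hy _ hz|m p v hv hD].
- by rewrite linear0; apply: Span0.
- by rewrite linearD; apply: SpanD.
by rewrite gproj_gen //; apply: SpanGen.
Qed.

Lemma span_homog_ind D n (Q : G -> Prop) : Q 0 ->
  (forall x y, Q x -> Q y -> Q (x + y)) ->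
  (forall m (p : P m) v, size v = m -> D v -> homog (n - wdeg v) p -> Q (gen p v)) ->
  forall x, gspan D x -> homogG n x -> Q x.
Proof.
move=> Q0 QD Qg x hx <-; elim: hx => [|y z _ hy _ hz|m p v hv hD].
- by rewrite linear0.
- by rewrite linearD; apply: QD.
by rewrite gproj_gen //; apply: Qg => //; apply: homog_proj.
Qed.

Lemma span_gen_ind D (Q : G -> Prop) : Q 0 ->
  (forall x y, Q x -> Q y -> Q (x + y)) ->
  (forall m (p : P m) v b, size v = m -> D v -> homog b p -> Q (gen p v)) ->
  forall x, gspan D x -> Q x.
Proof.
move=> Q0 QD Qg x; elim=> [//|y z _ hy _ hz|m p v hv hD]; first exact: QD.
elim/gmod_ind: p => [b p hp|p q hp hq]; first exact: Qg hp.
by rewrite (admD _ _ (gen_adm P deg)) //; apply: QD.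
Qed.

Definition in_span D : {pred G} := fun x => `[< gspan D x >].

Lemma in_spanP D x : reflect (gspan D x) (x \in in_span D).
Proof. exact: asboolP. Qed.

Fact in_span_closed D : submod_closed (in_span D).
Proof.
split; first by apply/in_spanP; apply: Span0.
by move=> c x y /in_spanP hx /in_spanP hy; apply/in_spanP; apply: SpanD => //; apply: spanZ.
Qed.
HB.instance Definition _ D := GRing.isSubmodClosed.Build k G (in_span D) (in_span_closed D).

Definition subG D := {x : G | x \in in_span D}.
HB.instance Definition _ D := [isSub of subG D for @sval G (fun x => x \in in_span D)].
HB.instance Definition _ D := [Choice of subG D by <:].
HB.instance Definition _ D := [SubChoice_isSubLmodule of subG D by <:].

Definition inG D x (hx : gspan D x) : subG D := exist _ x (introT (in_spanP D x) hx).

Lemma subG_span D (x : subG D) : gspan D (val x).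
Proof. by apply/in_spanP; apply: valP. Qed.

Definition homogS D (n : int) (x : subG D) : Prop := homogG n (val x).

Lemma homogS0 D n : @homogS D n 0.
Proof. exact: homogG0. Qed.

Lemma homogSP D n c (x y : subG D) : homogS n x -> homogS n y -> homogS n (c *: x + y).
Proof. exact: homogGP. Qed.

Lemma val_sumG D (I : Type) (r : seq I) (F : I -> subG D) :
  val (\sum_(i <- r) F i) = \sum_(i <- r) val (F i).
Proof. exact: raddf_sum. Qed.

Lemma homogS_dec D (x : subG D) : exists (s : seq int) (y : int -> subG D),
  [/\ uniq s, forall n, homogS n (y n) & x = \sum_(n <- s) y n].
Proof.
have [s [y [us hy e]]] := homogG_dec (val x).
exists s, (fun n => inG (span_gproj n (subG_span x))); split=> // [n|].
  exact: homogG_gproj.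
apply: val_inj; rewrite val_sumG [LHS]e; apply: eq_big_seq => n ns /=.
rewrite e raddf_sum (bigD1_seq n) //= (gproj_homog n (hy n)) eqxx big1 ?addr0 // => i ni.
by rewrite (gproj_homog n (hy i)) eq_sym (negPf ni).
Qed.

Lemma homogS_indep D (s : seq int) (y : int -> subG D) :
  uniq s -> (forall n, homogS n (y n)) -> \sum_(n <- s) y n = 0 ->
  forall n, n \in s -> y n = 0.
Proof.
move=> us hy e n ns; apply: val_inj.
apply: (homogG_indep us hy _ ns).
by rewrite -val_sumG e.
Qed.

Definition span_gmod D : gmod k :=
  Gmod (@homogS0 D) (@homogSP D) (@homogS_dec D) (@homogS_indep D).

End GSpan.


Local Notation span E := (gspan (word_in E)).

Lemma spanS E E' x : (forall y, E y -> E' y) -> span E x -> span E' x.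
Proof. by move=> h; apply: gspanS => v; apply: word_inS. Qed.

Lemma span_act E t m (p : P m) s : (size s + size t)%N = m ->
  word_in E s -> (forall i, (i < size t)%N -> span E (nth 0 t i)) -> span E (act t p s).
Proof.
elim: t m p s => [|x t IH] m p s hm hs ht.
  by rewrite act_nil; apply: SpanGen => //; rewrite -hm addn0.
have htl i : (i < size t)%N -> span E (nth 0 t i) by move=> it; apply: (ht i.+1).
have := ht 0%N isT => /= hx; elim: hx => [|y z _ hy _ hz|n q v hv hE].
- by rewrite (act0G (t1 := [::])) /=; [apply: Span0 | rewrite addn0].
- by rewrite actD_cons //; apply: SpanD.
rewrite act_gen //; apply: IH => //; last exact: word_in_cat.
by rewrite size_cat hv; move: hm => /=; lia.
Qed.

Lemma span_letter E y : E y -> span E (letter_elt P deg y).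
Proof. by move=> hy; apply: SpanGen. Qed.

Lemma span_leibniz E u c t u' m (p : P m) :
  (size u + size t + size u')%N = m ->
  (forall i, (i < size u)%N -> span E (nth 0 u i)) ->
  (forall i, (i < size u')%N -> span E (nth 0 u' i)) ->
  (forall i, (i < size t)%N -> span E (nth (0, 0, 0) t i).1.1) ->
  (forall i, (i < size t)%N -> span E (nth (0, 0, 0) t i).1.2) ->
  span E (leibniz u c t u' p : G).
Proof.
elim: t u c => [|z t IH] u c hm hu hu' h1 h2 /=; first exact: Span0.
have h1' i : (i < size t)%N -> span E (nth (0, 0, 0) t i).1.1 by apply: (h1 i.+1).
have h2' i : (i < size t)%N -> span E (nth (0, 0, 0) t i).1.2 by apply: (h2 i.+1).
apply: SpanD.
  apply: spanZ; apply: span_act => //.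
    by rewrite size_cat /= size_cat size_elts -hm /=; lia.
  move=> i; rewrite nth_cat; case: (ltnP i (size u)) => [iu _|iu hi]; first exact: hu.
  move: hi; rewrite size_cat /= size_cat size_elts => hi.
  case ei : (i - size u)%N => [|j] /=; first exact: (h2 0%N).
  rewrite nth_cat size_elts; case: (ltnP j (size t)) => jt; first by rewrite (nth_map (0, 0, 0)) //; apply: h1'.
  apply: hu'; move: (size u) (size t) (size u') iu hi jt ei => a b d; lia.
apply: IH => //; first by rewrite size_rcons -hm /=; lia.
move=> i; rewrite size_rcons nth_rcons => hi.
case: (ltngtP i (size u)) => iu; [exact: hu | lia | exact: (h1 0%N)].
Qed.

End Span.
Arguments inG {k P L deg D x} hx.
Notation span E := (gspan (word_in E)).

(** ** The algebra structure *)

Section Subalgebra.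
Variables (k : fieldType) (P : operad k) (L : Type) (deg : L -> int).
Local Notation G := (freeg P deg).
Local Notation gen := (@gen k P L deg _).
Variable dL : L -> G.
Hypothesis dL_homog : forall y, homogG (deg y + 1) (dL y).
Local Notation gder := (gder dL_homog).

(** It suffices to check on letters that the derivation preserves the span and
    has square zero there. *)
Definition dclosed (E : L -> Prop) : Prop :=
  forall y, E y -> span E (dL y) /\ gder (dL y) = 0.

Section OneSet.
Variable E : L -> Prop.
Hypothesis hE : dclosed E.
Local Notation S := (span_gmod P deg (word_in E)).

Lemma span_gder x : span E x -> span E (gder x).
Proof.
elim=> [|y z _ hy _ hz|m p v hv hv'].
- by rewrite linear0; apply: Span0.
- by rewrite linearD; apply: SpanD.
rewrite gder_gen //; apply: SpanD; first exact: SpanGen.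
have hw i : (i < size v)%N -> exists2 y, E y & nth (0, 0, 0) [seq letter_data dL y | y <- v] i
    = letter_data dL y.
  by elim: v {hv} hv' i => [|y v IH] //= [hy hv'] [|i] //= hi; [exists y | apply: IH].
apply: span_leibniz => //.
- by rewrite size_map /= addn0.
- by move=> i; rewrite size_map => /hw[y hy ->]; apply: span_letter.
by move=> i; rewrite size_map => /hw[y hy ->]; case: (hE hy).
Qed.

Lemma gen_gact m (p : P m) v (hv : size [seq letter_elt P deg y | y <- v] == m) :
  gen p v = gact p (Tuple hv).
Proof. by apply: gen_act; move: hv; rewrite size_map => /eqP. Qed.

Lemma homogs_letters m v (hv : size [seq letter_elt P deg y | y <- v] == m)
  (he : size [seq deg y | y <- v] == m) : homogsG (Tuple he) (Tuple hv).
Proof.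
have hv' : size v = m by rewrite -(eqP hv) size_map.
case: v hv he hv' => [|y0 v] hv he hv' j; first by have := ltn_ord j; rewrite -[X in (_ < X)%N]hv'.
rewrite !(tnth_nth 0) /= -!map_cons !(nth_map y0) ?hv' //.
exact: homogG_letter.
Qed.

Lemma nth_word_in v i y0 : word_in E v -> (i < size v)%N -> E (nth y0 v i).
Proof. by elim: v i => [|y v IH] [|i] //= [hy hv] hi //; apply: IH. Qed.

Lemma gder_gder x : span E x -> gder (gder x) = 0.
Proof.
elim/span_gen_ind => [|y z hy hz|m p v b hv hv' hp].
- by rewrite !linear0.
- by rewrite !linearD /= hy hz addr0.
have hw : size [seq letter_elt P deg y | y <- v] == m by rewrite size_map hv.
have he : size [seq deg y | y <- v] == m by rewrite size_map hv.
rewrite (gen_gact _ hw) (gder_gder_act hp (homogs_letters hw he)) // => j.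
case: v hv hv' hw he => [|y0 v] hv hv' hw he; first by have := ltn_ord j; rewrite -[X in (_ < X)%N]hv.
rewrite (tnth_nth 0) /= -map_cons (nth_map y0) ?hv // gder_letter.
by case: (hE (nth_word_in y0 hv' (i := j) _)); rewrite ?hv.
Qed.

Definition sub_d (x : S) : S := inG (span_gder (subG_span x)).

Lemma sub_d_linear : linear sub_d.
Proof. by move=> c x y; apply: val_inj; rewrite /= linearP. Qed.
HB.instance Definition _ := GRing.isLinear.Build k S S _ sub_d sub_d_linear.

Lemma sub_d_homog n (x : S) : homog n x -> homog (n + 1) (sub_d x).
Proof. exact: gder_homog. Qed.

Lemma sub_dd (x : S) : sub_d (sub_d x) = 0.
Proof. by apply: val_inj; rewrite /= gder_gder //; exact: (subG_span x). Qed.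

Definition sub_complex : complex k := @Complex k S sub_d sub_d_homog sub_dd.

Lemma span_gact m (p : P m) (a : m.-tuple S) : span E (gact p (map_tuple val a)).
Proof.
apply: span_act => [||i]; rewrite ?size_tuple // => hi.
by rewrite (nth_map 0) ?size_tuple //; exact: (subG_span (nth 0 a i)).
Qed.

Definition sub_act m (p : P m) (a : m.-tuple sub_complex) : sub_complex := inG (span_gact p a).

Lemma map_tset (T T' : Type) (f : T -> T') m (a : m.-tuple T) i x :
  map_tuple f (tset a i x) = tset (map_tuple f a) i (f x).
Proof. by apply: eq_from_tnth => j; rewrite tnth_map !tnth_mktuple tnth_map; case: ifP. Qed.

Lemma map_tperms (T T' : Type) (f : T -> T') m (a : m.-tuple T) s :
  map_tuple f (tperms a s) = tperms (map_tuple f a) s.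
Proof. by apply: eq_from_tnth => j; rewrite tnth_map !tnth_mktuple tnth_map. Qed.

Lemma homogs_val m (e : m.-tuple int) (a : m.-tuple sub_complex) :
  homogs e a -> homogsG e (map_tuple val a).
Proof. by move=> h j; rewrite tnth_map; apply: h. Qed.

Lemma sub_act_lin m : multilinear (@sub_act m).
Proof.
split=> [c p q a|p a i c x y]; apply: val_inj => /=; first exact: (gact_lin P deg m).1.
by rewrite !map_tset (gact_lin P deg m).2.
Qed.

Lemma sub_act_homog m (p : P m) q (e : m.-tuple int) (a : m.-tuple sub_complex) :
  homog q p -> homogs e a -> homog (q + \sum_(j < m) tnth e j) (sub_act p a).
Proof. by move=> hp /homogs_val h; apply: (gact_homog hp h). Qed.

Lemma sub_act_d m (p : P m) q (e : m.-tuple int) (a : m.-tuple sub_complex) :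
  homog q p -> homogs e a ->
  cd (sub_act p a) = sub_act (cd p) a
    + \sum_(j < m) sgn (q + \sum_(i < m | (i < j)%N) tnth e i)
                     *: sub_act p (tset a j (cd (tnth a j))).
Proof.
move=> hp /homogs_val h; apply: val_inj.
rewrite [RHS]raddfD raddf_sum [LHS](gact_d dL_homog hp h); congr (_ + _).
apply: eq_bigr => j _.
rewrite tnth_map.
by have := map_tset val a j (cd (tnth a j)); rewrite [in X in _ = X -> _]/= => <-.
Qed.

Lemma sub_act_sym m : balanced (@sub_act m).
Proof.
move=> s p e a /homogs_val h; apply: val_inj => /=.
by rewrite (gact_sym s p h) map_tperms.
Qed.

Lemma sub_act_id x : sub_act pid [tuple x] = x.
Proof. by apply: val_inj; rewrite /= (_ : map_tuple _ _ = [tuple val x]) ?gact_id //; apply: val_inj. Qed.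

Lemma sub_act_comp m n l (e : l.+1 = (m + n)%N) (i : 'I_m)
      (p : P m) (b : P n) q (s1 s3 : seq sub_complex) (v : n.-tuple sub_complex)
      (t : l.-tuple sub_complex) (u : m.-tuple sub_complex) (d : l.-tuple int) :
    homog q b -> homogs d t -> size s1 = i ->
    t = s1 ++ v ++ s3 :> seq sub_complex -> u = s1 ++ sub_act b v :: s3 :> seq sub_complex ->
    sub_act (pcomp e i p b) t
      = sgn (q * \sum_(j < l | (j < i)%N) tnth d j) *: sub_act p u.
Proof.
move=> hq /homogs_val hd hs1 ht hu; apply: val_inj => /=.
rewrite (gact_comp e p hq hd (s1 := map val s1) (s3 := map val s3) (v := map_tuple val v)
  (u := map_tuple val u)) //.
- by rewrite size_map.
- by rewrite /= ht !map_cat.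
by rewrite /= hu !map_cat.
Qed.

Definition subalg : palg P :=
  Palg sub_act_lin sub_act_homog sub_act_d sub_act_sym sub_act_id sub_act_comp.

End OneSet.
End Subalgebra.

(** ** Inclusions, unions and restrictions of morphisms *)

Section Stages.
Variables (k : fieldType) (P : operad k) (L : Type) (deg : L -> int).
Local Notation G := (freeg P deg).
Local Notation gen := (@gen k P L deg _).
Local Notation letter := (letter_elt P deg).
Variable dL : L -> G.
Hypothesis dL_homog : forall y, homogG (deg y + 1) (dL y).
Local Notation gder := (gder dL_homog).
Local Notation dclosed := (dclosed dL_homog).
Local Notation subalg := (@subalg k P L deg dL dL_homog _).
Implicit Types E : L -> Prop.

Section Incl.
Variables (E E' : L -> Prop) (hE : dclosed E) (hE' : dclosed E').
Hypothesis EE' : forall y, E y -> E' y.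

Definition incl_fun (x : subalg hE) : subalg hE' := inG (spanS EE' (subG_span x)).

Lemma incl_linear : linear incl_fun.
Proof. by move=> c x y; apply: val_inj. Qed.
HB.instance Definition _ :=
  GRing.isLinear.Build k (subalg hE) (subalg hE') _ incl_fun incl_linear.

Lemma incl_homog : graded incl_fun.
Proof. by []. Qed.

Lemma incl_d x : incl_fun (cd x) = cd (incl_fun x).
Proof. exact: val_inj. Qed.

Lemma incl_act m (p : P m) (a : m.-tuple (subalg hE)) :
  incl_fun (pact p a) = pact p [tuple of map incl_fun a].
Proof.
apply: val_inj => /=; congr gact; apply: eq_from_tnth => j.
by rewrite !tnth_map.
Qed.

Definition incl : palg_hom (subalg hE) (subalg hE') :=
  PalgHom (phom := incl_fun) incl_homog incl_d incl_act.

End Incl.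

(** An element involves finitely many letters. *)
Lemma union_span (E : nat -> L -> Prop) E' x :
  (forall q y, E q y -> E q.+1 y) -> (forall y, E' y -> exists q, E q y) ->
  span E' x -> exists q, gspan (deg := deg) (P := P) (word_in (E q)) x.
Proof.
move=> Einc hE'.
have Ele q q' y : (q <= q')%N -> E q y -> E q' y.
  by move=> /subnKC <-; elim: (q' - q)%N => [|n IH] hq; rewrite ?addn0 // addnS; apply: Einc; apply: IH.
elim=> [|y z _ [q hq] _ [q' hq']|m p v hv hvE].
- by exists 0%N; apply: Span0.
- exists (maxn q q'); apply: SpanD.
    by apply: spanS hq => a; apply: Ele; apply: leq_maxl.
  by apply: spanS hq' => a; apply: Ele; apply: leq_maxr.
suff [q hq] : exists q, word_in (E q) v by exists q; apply: SpanGen.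
elim: v hvE {hv} => [|y v IH] /=; first by exists 0%N.
case=> /hE'[q hq] /IH[q' hq']; exists (maxn q q'); split.
  by apply: Ele hq; apply: leq_maxl.
by apply: word_inS hq' => a; apply: Ele; apply: leq_maxr.
Qed.

Lemma incl_is_union (E : nat -> L -> Prop) E' (hE : forall q, dclosed (E q))
    (hE' : dclosed E') (Einc : forall q y, E q y -> E q.+1 y)
    (EE' : forall q y, E q y -> E' y) :
  (forall y, E' y -> exists q, E q y) ->
  is_union (fun q => incl (hE q) (hE q.+1) (Einc q)) (fun q => incl (hE q) hE' (EE' q)).
Proof.
move=> hex; split=> [q x|q x y e|y].
- exact: val_inj.
- by apply: val_inj; have := congr1 val e.
have [q hq] := union_span Einc hex (subG_span y).
by exists q, (inG hq); apply: val_inj.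
Qed.

(** ** The algebra on no letters *)

(** The coefficient of the empty word, which inverts the unit map. *)
Definition const_fam : family P L (P 0) := fun m p v =>
  if v is [::] then cast 0 p else 0.

Lemma const_fam_adm : adm deg const_fam.
Proof.
split=> [m v hv c p p'|m i j p v1 x y v2 ij hi hm].
  case: v hv => [|y v] hv /=; last by rewrite scaler0 addr0.
  by case: _ / hv in p p' *; rewrite !cast_id.
by case: v1 {hi hm} => [|z v1] /=; rewrite scaler0.
Qed.

Lemma unit_map_gen E (hE : dclosed E) u : val (unit_map (subalg hE) u) = gen u [::].
Proof. by rewrite /= /gact act_nil. Qed.

Lemma unit_map_inj E (hE : dclosed E) : injective (unit_map (subalg hE)).
Proof.
move=> u u' e; have : val (unit_map (subalg hE) u) = val (unit_map (subalg hE) u') by rewrite e.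
rewrite !unit_map_gen => /(congr1 (lift const_fam)).
by rewrite !(lift_gen _ const_fam_adm) // /const_fam /= !cast_id.
Qed.

Lemma is_P0_empty E (hE : dclosed E) : (forall y, ~ E y) -> is_P0 (subalg hE).
Proof.
move=> E0; exists (fun x : subalg hE => lift const_fam (val x)) => [u|x].
  by rewrite unit_map_gen lift_gen //; [rewrite /const_fam /= cast_id | apply: const_fam_adm].
apply: val_inj; rewrite unit_map_gen.
have := subG_span x; move: (val x) => z; elim=> [|a b _ ha _ hb|m p v hv].
- by rewrite lift_zero ?gen0 //; apply: const_fam_adm.
- rewrite lift_add; last exact: const_fam_adm.
  by rewrite (admD _ _ (gen_adm P deg)) // ha hb.
case: v hv => [|y v] hv /=; last by case=> /E0.
move=> _; case: _ / hv in p *; rewrite lift_gen //; last exact: const_fam_adm.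
by rewrite /const_fam /= cast_id.
Qed.

(** ** Restriction of morphisms *)

Section Restrict.
Variables (A : palg P) (aL : L -> A).
Hypothesis aL_homog : forall y, homog (deg y) (aL y).
Local Notation gmor := (gmor aL_homog).
Variables (E : L -> Prop) (hE : dclosed E).
Hypothesis hA : forall y, E y -> gmor (dL y) = cd (aL y).

(** Both sides satisfy the same Leibniz rule, so they agree as soon as they agree
    on letters. *)
Lemma gmor_gder x : span E x -> gmor (gder x) = cd (gmor x).
Proof.
elim/span_gen_ind => [|y z hy hz|m p v b hv hv' hp].
- by rewrite !linear0.
- by rewrite !linearD /= hy hz.
have hw : size [seq letter y | y <- v] == m by rewrite size_map hv.
have he : size [seq deg y | y <- v] == m by rewrite size_map hv.
have hh := homogs_letters hw he.
have hf : homogs (Tuple he) (map_tuple gmor (Tuple hw)).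
  by move=> j; rewrite tnth_map; apply: gmor_homog; apply: hh.
rewrite (gen_gact _ hw) (gact_d dL_homog hp hh) linearD /= !gmor_act.
rewrite (pact_d hp hf); congr (_ + _); rewrite raddf_sum; apply: eq_bigr => j _.
rewrite /= linearZ /= gmor_act; congr (_ *: pact p _).
rewrite -[[tuple of _]]/(map_tuple gmor _) map_tset; congr tset.
rewrite tnth_map.
case: v hv hv' hw he hh hf => [|y0 v] hv hv' hw he hh hf.
  by have := ltn_ord j; rewrite -[X in (_ < X)%N]hv.
rewrite (tnth_nth 0) /= -map_cons (nth_map y0) ?hv // gder_letter gmor_letter.
by apply: hA; apply: nth_word_in; rewrite ?hv.
Qed.

Definition sub_mor_fun (x : subalg hE) : A := gmor (val x).

Lemma sub_mor_linear : linear sub_mor_fun.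
Proof. by move=> c x y; rewrite /sub_mor_fun !linearP. Qed.
HB.instance Definition _ :=
  GRing.isLinear.Build k (subalg hE) A _ sub_mor_fun sub_mor_linear.

Lemma sub_mor_homog : graded sub_mor_fun.
Proof. by move=> n x; apply: gmor_homog. Qed.

Lemma sub_mor_d x : sub_mor_fun (cd x) = cd (sub_mor_fun x).
Proof. by apply: gmor_gder; apply: subG_span. Qed.

Lemma sub_mor_act m (p : P m) (a : m.-tuple (subalg hE)) :
  sub_mor_fun (pact p a) = pact p [tuple of map sub_mor_fun a].
Proof.
rewrite /sub_mor_fun [LHS]gmor_act; congr (pact p); apply: eq_from_tnth => j.
by rewrite !tnth_map.
Qed.

Definition sub_mor : palg_hom (subalg hE) A :=
  PalgHom (phom := sub_mor_fun) sub_mor_homog sub_mor_d sub_mor_act.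

End Restrict.

(** ** Freeness *)

(** The algebra of words in [E] is free on any graded space [V] with basis the
    letters of [E].  The basis is left abstract because a KS-extension needs the
    space [V] to be a given direct sum. *)
Section Free.
Variables (E : L -> Prop) (hE : dclosed E) (V : gmod k).
Variables (iota : {linear V -> subalg hE}) (b : L -> V).
Hypothesis iota_b : forall y, E y -> val (iota (b y)) = letter y.
Hypothesis b_homog : forall y, homog (deg y) (b y).
Hypothesis b_ind : forall Q : V -> Prop, Q 0 -> (forall x y, Q x -> Q y -> Q (x + y)) ->
  (forall c y, E y -> Q (c *: b y)) -> forall v, Q v.

Lemma free_letters : graded iota -> free_on iota.
Proof.
move=> iota_h; split=> // [|W phi hl hb]; first by move=> c x y; rewrite linearP.
pose F : family P L W := fun m p v => on_seq (phi m p) (map b v).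
have aF : adm deg F by apply: adm_balanced.
pose hfun (x : subalg hE) : W := lift F (val x).
have hlin : linear hfun by move=> c x y; rewrite /hfun /= lift_lin.
pose hL := GRing.isLinear.Build k (subalg hE) W _ hfun hlin.
pose h : {linear subalg hE -> W} := HB.pack hfun hL.
have hE1 m (p : P m) (ys : seq L) (t : seq V) : (size ys + size t)%N = m -> word_in E ys ->
    lift F (act (map (fun v => val (iota v)) (map b ys ++ t)) p [::])
      = on_seq (phi m p) (map b ys ++ t).
  elim: t ys => [|v t IH] ys hm hys.
    rewrite !cats0 (_ : map _ _ = map letter ys); last first.
      elim: ys {hm} hys => //= y ys IH [hy hys]; rewrite iota_b //; congr (_ :: _); exact: IH.
    by rewrite -gen_act ?lift_gen // -hm addn0.
  have hm' : (size (@nil L) + size [seq val (iota v) | v <- map b ys] +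
      (size [seq val (iota v) | v <- t]).+1)%N = m by rewrite !size_map -hm.
  move: hm => /= hm; elim/b_ind: v => [|x y hx hy|c y hy].
  - rewrite map_cat /= linear0 act0G // (on_seq0 (hl m)).
    by rewrite lift_zero.
  - rewrite map_cat /= linearD actDG // lift_add //= (on_seqD (hl m)) -hx -hy.
    by rewrite !map_cat.
  rewrite map_cat /= linearZ /= actZG // lift_scale // (on_seqZ (hl m)); congr (_ *: _).
  have hr : word_in E (rcons ys y) by rewrite -cats1; apply: word_in_cat.
  have sr : (size (rcons ys y) + size t)%N = m by rewrite size_rcons; lia.
  by have := IH _ sr hr; rewrite map_rcons cat_rcons map_cat /=.
have hphi m (p : P m) (v : m.-tuple V) : h (pact p [tuple of map iota v]) = phi m p v.
  rewrite -[RHS]on_seqE -(hE1 m p [::] v) ?size_tuple //=.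
  rewrite /hfun /= /gact; congr (lift F (act _ p [::])).
  exact: esym (map_comp val iota v).
exists h => // h' hh' x.
have hs := subG_span x.
suff key z : span E z -> forall hz : span E z, h' (inG hz) = h (inG hz).
  by have := key _ hs hs; rewrite (_ : inG hs = x) //; apply: val_inj.
elim=> [hz|y1 y2 h1 IH1 h2 IH2 hz|m p v hv hvE hz].
- by rewrite (_ : inG hz = 0) ?linear0 //; apply: val_inj.
- have e : inG hz = inG h1 + inG h2 :> subalg hE by apply: val_inj.
  by rewrite e (linearD h') (linearD h) IH1 IH2.
have hvb : size (map b v) == m by rewrite size_map hv.
have -> : inG hz = pact p [tuple of map iota (Tuple hvb)].
  apply: val_inj; rewrite /= /gact gen_act //; congr (act _ p [::]) => /=.
  elim: v {hv hz hvb} hvE => //= y v IH [hy hvE].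
  by rewrite iota_b //; congr (_ :: _); apply: IH.
by rewrite hh' hphi.
Qed.

End Free.
End Stages.

(** * KS-extensions by sets of letters *)

Section KS.
Variables (k : fieldType) (P : operad k) (L : Type) (deg : L -> int).
Hypothesis Pconn : op_connected P.
Local Notation G := (freeg P deg).
Local Notation gen := (@gen k P L deg _).
Local Notation letter := (letter_elt P deg).
Variable dL : L -> G.
Hypothesis dL_homog : forall y, homogG (deg y + 1) (dL y).
Local Notation gder := (gder dL_homog).
Local Notation dclosed := (dclosed dL_homog).
Local Notation subalg := (@subalg k P L deg dL dL_homog _).
Implicit Types E N : L -> Prop.

Definition one_in E (v : seq L) : Prop := exists2 y, E y & v = [:: y].

(** Words of length one only involve [P 1], which is spanned by the unit: they
    span the vector space with basis [E]. *)
Definition letters_gmod E : gmod k := span_gmod P deg (one_in E).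

Lemma span_one_letter E y : E y -> gspan (one_in E) (letter y).
Proof. by move=> hy; apply: SpanGen => //; exists y. Qed.

Definition letter_basis E (y : L) : letters_gmod E :=
  if pselect (E y) is left h then inG (span_one_letter h) else 0.

Lemma val_letter_basis E y : E y -> val (letter_basis E y) = letter y.
Proof. by rewrite /letter_basis; case: pselect. Qed.

Lemma letter_basis0 E y : ~ E y -> letter_basis E y = 0.
Proof. by rewrite /letter_basis; case: pselect. Qed.

Lemma letter_basis_homog E y : homog (deg y) (letter_basis E y).
Proof.
rewrite /letter_basis; case: pselect => [h|_]; last exact: homog0.
exact: homogG_letter.
Qed.

Lemma gen1 (p : P 1) y : exists c : k, gen p [:: y] = c *: letter y.
Proof.
have [c ->] := Pconn.2 p; exists c.
by rewrite (admZ _ _ (gen_adm P deg)).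
Qed.

Lemma letters_ind E (Q : letters_gmod E -> Prop) : Q 0 ->
  (forall x y, Q x -> Q y -> Q (x + y)) ->
  (forall c y, E y -> Q (c *: letter_basis E y)) -> forall v, Q v.
Proof.
move=> Q0 QD Ql v.
suff key z : gspan (one_in E) z -> forall hz : gspan (one_in E) z, Q (inG hz).
  have hv := subG_span v; have := key _ hv hv; rewrite (_ : inG hv = v) //.
  exact: val_inj.
elim=> [hz|x y hx IHx hy IHy hz|m p w hw [y hy ew] hz].
- by rewrite (_ : inG hz = 0) //; apply: val_inj.
- rewrite (_ : inG hz = (inG hx : letters_gmod E) + inG hy); first exact: (QD).
  exact: val_inj.
subst w; case: _ / hw in p hz *; have [c ec] := gen1 p y.
rewrite (_ : inG hz = c *: letter_basis E y); first exact: Ql.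
by apply: val_inj; rewrite /= ec -(val_letter_basis hy).
Qed.

Lemma one_in_word E v : one_in E v -> word_in E v.
Proof. by case=> y hy ->. Qed.

Section Iota.
Variables (E N : L -> Prop) (hE : dclosed E).
Hypothesis NE : forall y, N y -> E y.

Definition letters_incl (x : letters_gmod N) : subalg hE :=
  inG (spanS NE (gspanS (@one_in_word N) (subG_span x))).

Lemma letters_incl_linear : linear letters_incl.
Proof. by move=> c x y; apply: val_inj. Qed.
HB.instance Definition _ :=
  GRing.isLinear.Build k (letters_gmod N) (subalg hE) _ letters_incl letters_incl_linear.

End Iota.

Lemma free_on_letters E (hE : dclosed E) :
  free_on (letters_incl hE (fun y (h : E y) => h)).
Proof.
have h y (hy : E y) : val (letters_incl hE (fun y (h : E y) => h) (letter_basis E y)) = letter y.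
  by rewrite -(val_letter_basis hy).
exact: (free_letters h (@letter_basis_homog E) (@letters_ind E)).
Qed.

Section Extension.
Variables (E E' : L -> Prop) (hE : dclosed E) (hE' : dclosed E').
Hypothesis EE' : forall y, E y -> E' y.
Variable n : int.
Hypothesis hN : forall y, E' y -> ~ E y -> deg y = n /\ span E (dL y).

Let N y := E' y /\ ~ E y.

Lemma new_in y : N y -> E' y. Proof. by case. Qed.

Lemma letters_d_span (x : letters_gmod N) : span E (gder (val x)).
Proof.
elim/letters_ind: x => [|x y hx hy|c y hy].
- by rewrite linear0; apply: Span0.
- by rewrite linearD; apply: SpanD.
have -> : val (c *: letter_basis N y) = c *: letter y by rewrite -(val_letter_basis hy).
rewrite linearZ; apply: spanZ; rewrite /= gder_letter.
by case: hy => hy ny; have [] := hN hy ny.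
Qed.

Definition letters_d (x : letters_gmod N) : subalg hE := inG (letters_d_span x).

Lemma letters_d_linear : linear letters_d.
Proof. by move=> c x y; apply: val_inj; rewrite /= linearP. Qed.
HB.instance Definition _ :=
  GRing.isLinear.Build k (letters_gmod N) (subalg hE) _ letters_d letters_d_linear.

Lemma letters_conc : concentrated (letters_gmod N) n.
Proof.
elim/letters_ind => [|x y hx hy|c y hy]; first exact: homog0.
  exact: homogD.
apply: homogZ; have [hy1 hy2] := hy; have [<- _] := hN hy1 hy2.
exact: letter_basis_homog.
Qed.

Definition ext_basis (y : L) : dsum (letters_gmod E) (letters_gmod N) :=
  (letter_basis E y, letter_basis N y).

Definition ext_iota (x : dsum (letters_gmod E) (letters_gmod N)) : subalg hE' :=
  incl hE hE' EE' (letters_incl hE (fun y (h : E y) => h) x.1) + letters_incl hE' new_in x.2.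

Lemma ext_iota_linear : linear ext_iota.
Proof.
by move=> c x y; rewrite /ext_iota /= !linearP scalerDr addrACA.
Qed.
HB.instance Definition _ :=
  GRing.isLinear.Build k (dsum (letters_gmod E) (letters_gmod N)) (subalg hE') _
    ext_iota ext_iota_linear.

(** The new letters span the attached space, and the derivation of [G] restricted
    to them is the attaching map. *)
Lemma KS_incl : 0 < n -> KS_extension n (incl hE hE' EE').
Proof.
move=> n0; split=> //.
exists (letters_gmod E), (letters_incl hE (fun y (h : E y) => h)), (letters_gmod N),
  (letters_incl hE' new_in), letters_d; split.
- exact: free_on_letters.
- exact: letters_conc.
- move=> v; split; first exact: (gder_homog dL_homog (letters_conc v)).
  apply: val_inj; rewrite /= (gder_gder hE') //.
  exact: (subG_span (letters_incl hE' new_in v)).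
- by move=> v; apply: val_inj.
rewrite -[fun x => _]/ext_iota.
apply: (free_letters (b := ext_basis)).
- move=> y hy; change (val (letter_basis E y) + val (letter_basis N y) = letter y).
  case: (pselect (E y)) => hyE.
    rewrite val_letter_basis // letter_basis0 ?raddf0 ?addr0 //.
    by case.
  by rewrite letter_basis0 // raddf0 add0r val_letter_basis.
- by move=> y; split; apply: letter_basis_homog.
- move=> Q Q0 QD Ql [x z].
  have -> : (x, z) = (x, 0) + (0, z) :> dsum (letters_gmod E) (letters_gmod N).
    by congr (_, _); rewrite /= ?addr0 ?add0r.
  apply: (QD).
    elim/letters_ind: x => [//|x y hx hy|c y hy].
      rewrite (_ : (x + y, 0) = (x, 0) + (y, 0) :> dsum _ (letters_gmod N)); first exact: (QD).
      by congr (_, _); rewrite addr0.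
    rewrite (_ : (c *: letter_basis E y, 0) = c *: ext_basis y); first by apply: (Ql); apply: EE'.
    by congr (_, _); rewrite /= (@letter_basis0 N) ?scaler0 // => -[].
  elim/letters_ind: z => [//|x1 y hx hy|c y hy].
    rewrite (_ : (0, x1 + y) = (0, x1) + (0, y) :> dsum (letters_gmod E) _); first exact: (QD).
    by congr (_, _); rewrite addr0.
  rewrite (_ : (0, c *: letter_basis N y) = c *: ext_basis y); first by apply: (Ql); case: hy.
  by congr (_, _); rewrite /= (@letter_basis0 E) ?scaler0 //; case: hy.
move=> m [x z] [hx hz]; apply: homogD; [exact: hx | exact: hz].
Qed.

End Extension.
End KS.

(** * The algebra of all letters *)

(** The degree, the differential as a formal expression in other letters, and the
    image in the target algebra.  Expressions may be ill-formed or of the wrong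
    degree: [gen] and the projections in [dlet] and [alet] make sense of them. *)
Inductive letter (k : fieldType) (P : operad k) (A : Type) : Type :=
  Letter of int & seq ({m : nat & P m} * seq (letter P A)) & A.

Section Letters.
Variables (k : fieldType) (P : operad k) (A : palg P).
Local Notation L := (letter P A).

Definition ldeg (y : L) : int := let: Letter n _ _ := y in n.
Local Notation G := (freeg P ldeg).

Definition dlet (y : L) : G :=
  let: Letter n s _ := y in
  gproj (n + 1) (\sum_(g <- s) gen ldeg (projT2 g.1) g.2).

Definition alet (y : L) : A := let: Letter n _ a := y in proj n a.

Lemma dlet_homog y : homogG (ldeg y + 1) (dlet y).
Proof. by case: y => n s a; apply: homogG_gproj. Qed.

Lemma alet_homog y : homog (ldeg y) (alet y).
Proof. by case: y => n s a; apply: homog_proj. Qed.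

Lemma letter_exists n (x : G) (a : A) : homogG (n + 1) x -> homog n a ->
  exists y : L, [/\ ldeg y = n, dlet y = x & alet y = a].
Proof.
move=> hx ha.
pose f (g : raw P L) : {m : nat & P m} * seq L := (existT (fun m => P m : Type) (size (projT1 g)) (projT2 g), projT1 g).
exists (Letter n [seq f g | g : raw P L <- generic_quotient.repr x] a); split=> //=.
  by rewrite big_map /= -freeg_sum.
by rewrite (proj_homog _ ha) eqxx.
Qed.


Local Notation gder := (gder (@dlet_homog)).
Local Notation gmor := (gmor (@alet_homog)).
Local Notation lspan N := (gspan (one_in N)).
Local Notation lelt := (letter_elt P ldeg).
Implicit Types (E N : L -> Prop) (n : int) (x z : G) (a : A).

(** ** The cone of the morphism to the target *)

(** Cocycles and coboundaries of the mapping cone, which in degree [n] consists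
    of pairs of an element of degree [n + 1] and one of degree [n].  The choice
    of signs in its differential does not affect the coboundaries. *)
Definition cone_cocycle E n x a : Prop :=
  [/\ span E x, homogG (n + 1) x, homog n a, gder x = 0 & gmor x = cd a].

Definition cone_bound E n x a : Prop := exists y b,
  [/\ span E y, homogG n y, homog (n - 1) b, x = gder y & a - gmor y = cd b].

Definition acyclic E n : Prop := forall x a, cone_cocycle E n x a -> cone_bound E n x a.

Lemma cone_bound_lin E n c x a x' a' :
  cone_bound E n x a -> cone_bound E n x' a' ->
  cone_bound E n (c *: x + x') (c *: a + a').
Proof.
move=> [y [b [sy hy hb -> eb]]] [y' [b' [sy' hy' hb' -> eb']]].
exists (c *: y + y'), (c *: b + b'); split.
- by apply: SpanD => //; apply: spanZ.
- exact: homogGP.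
- exact: homogP.
- by rewrite linearP.
by rewrite (linearP gmor) (linearP cd) -eb -eb' opprD addrACA scalerBr.
Qed.

Lemma cone_bound0 E n : cone_bound E n 0 0.
Proof.
exists 0, 0; split.
- exact: Span0.
- exact: homogG0.
- exact: homog0.
- by rewrite (linear0 gder).
by rewrite (linear0 gmor) (linear0 cd) subrr.
Qed.

Lemma cone_boundS E E' n x a : (forall y, E y -> E' y) ->
  cone_bound E n x a -> cone_bound E' n x a.
Proof.
move=> h [y [b [sy hy hb e eb]]]; exists y, b; split=> //; exact: spanS sy.
Qed.

(** The sets of letters whose formal data define a map of complexes. *)
Record good r E : Prop := Good {
  good_d : dclosed (@dlet_homog) E;
  good_f : forall y, E y -> gmor (dlet y) = cd (alet y);
  good_deg : forall y, E y -> r.+1%:Z <= ldeg y }.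

Lemma lspan_homog N n : (forall y, N y -> ldeg y = n) -> forall (Pconn : op_connected P) z,
  lspan N z -> homogG n z.
Proof.
move=> hN Pconn z; elim=> [|x y _ hx _ hy|m p v hv [y hy ey]].
- exact: homogG0.
- exact: homogGD.
subst v; case: _ / hv in p *; have [c ->] := gen1 ldeg Pconn p y.
by apply: homogGZ; rewrite -(hN _ hy); apply: homogG_letter.
Qed.

(** A basis of the cohomology of the cone in degree [n], given by letters.
    Independence and generation are stated for linear combinations [z] of
    letters, whose class is the pair of [gder z] and [gmor z]. *)
Record attaching E n N : Prop := Attaching {
  att_deg : forall y, N y -> ldeg y = n;
  att_cocycle : forall y, N y -> cone_cocycle E n (dlet y) (alet y);
  att_indep : forall z, lspan N z -> cone_bound E n (gder z) (gmor z) -> z = 0;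
  att_span : forall x a, cone_cocycle E n x a ->
    exists2 z, lspan N z & cone_bound E n (x - gder z) (a - gmor z) }.

(** A maximal independent set of letters generates: a class that is not
    generated is that of a letter, because every pair of the right degrees is,
    and this letter could be added. *)
Lemma attaching_exists (Pconn : op_connected P) E n : exists N, attaching E n N.
Proof.
pose Q (N : classical_sets.set L) := [/\ forall y, N y -> ldeg y = n,
  forall y, N y -> cone_cocycle E n (dlet y) (alet y) &
  forall z, lspan N z -> cone_bound E n (gder z) (gmor z) -> z = 0].
have [|N [[N1 N2 N3] Nmax]] := @classical_sets.Zorn_bigcup L Q.
  move=> F FQ Ftot; split=> [y [X FX Xy]|y [X FX Xy]|z hz].
  - by have [h _ _] := FQ X FX; apply: h.
  - by have [_ h _] := FQ X FX; apply: h.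
  suff : z = 0 \/ exists2 X, F X & lspan X z.
    by case=> // -[X FX hX]; have [_ _ h] := FQ X FX; apply: h.
  elim: hz => [|x y _ hx _ hy|m p v hv [y [X FX Xy] ey]]; first by left.
    case: hx => [->|[X FX hX]]; first by rewrite add0r.
    case: hy => [->|[Y FY hY]]; first by right; exists X; rewrite ?addr0.
    right; have [XY|YX] := Ftot X Y FX FY.
      by exists Y => //; apply: SpanD => //; apply: gspanS hX => v [y' /XY hy' ->]; exists y'.
    by exists X => //; apply: SpanD => //; apply: gspanS hY => v [y' /YX hy' ->]; exists y'.
  by right; exists X => //; apply: SpanGen => //; exists y.
exists N; split=> // x a hxa; have [hx hx1 ha dx fx] := hxa.
have [y0 [e1 e2 e3]] := letter_exists hx1 ha.
case: (pselect (N y0)) => hy0.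
  exists (lelt y0); first by apply: span_one_letter.
  by rewrite gder_letter gmor_letter e2 e3 !subrr; apply: cone_bound0.
pose N' : classical_sets.set L := fun y => N y \/ y = y0.
have NN' : classical_sets.proper N N'.
  split=> [y hy|h]; first by left.
  by apply: hy0; apply: h; right.
have := Nmax N' NN'; rewrite /Q => nQ.
have [z [hz [bz z0]]] : exists z, lspan N' z /\ cone_bound E n (gder z) (gmor z) /\ z <> 0.
  apply: contrapT => hno; apply: nQ; split.
  - by move=> y [/N1//|->].
  - by move=> y [/N2//|->]; rewrite e2 e3.
  move=> z hz bz; apply: contrapT => z0; apply: hno; exists z; split=> //; split=> //.
(* The relation [z] that breaks independence involves [y0], with coefficient [c]. *)
have [z1 [c [hz1 ez]]] : exists z1 c, lspan N z1 /\ z = z1 + c *: lelt y0.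
  elim: hz {bz z0} => [|u v _ [u1 [c [hu ->]]] _ [v1 [d [hv ->]]]|m p v hv [y hy ey]].
  - by exists 0, 0; split; [apply: Span0 | rewrite scale0r addr0].
  - exists (u1 + v1), (c + d); split; first exact: SpanD.
    by rewrite scalerDl addrACA.
  subst v; case: _ / hv in p *; have [c ->] := gen1 ldeg Pconn p y.
  case: hy => [hy|->]; last by exists 0, c; split; [apply: Span0 | rewrite add0r].
  exists (c *: lelt y), 0; split; last by rewrite scale0r addr0.
  by apply: spanZ; apply: span_one_letter.
have [c0|c0] := eqVneq c 0.
  by case: z0; apply: N3 => //; rewrite ez c0 scale0r addr0.
exists (- c^-1 *: z1); first exact: spanZ.
have := cone_bound_lin c^-1 bz (cone_bound0 E n).
rewrite ez (linearD gder) (linearD gmor) (linearZ_LR gder) (linearZ_LR gmor) /= gder_letter gmor_letter.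
rewrite e2 e3 !addr0 !scalerDr !scalerA mulVf // !scale1r.
rewrite (linearZ_LR gder) (linearZ_LR gmor) /= !scaleNr !opprK.
by rewrite [_ + x]addrC [_ + a]addrC.
Qed.

End Letters.

(** * Degree estimates *)

Section Degrees.
Variables (k : fieldType) (P : operad k) (A : palg P) (r : nat).
Hypotheses (Pconn : op_connected P) (Pred : op_reduced P \/ op_unitary P) (Ptame : tame r P).
Local Notation L := (letter P A).
Local Notation ldeg := (@ldeg k P A).
Local Notation G := (freeg P ldeg).
Local Notation gen := (@gen k P L ldeg _).
Local Notation gder := (gder (@dlet_homog k P A)).
Local Notation gmor := (gmor (@alet_homog k P A)).
Local Notation lspan N := (gspan (deg := ldeg) (P := P) (one_in N)).
Implicit Types (E N : L -> Prop) (n : int) (x z : G) (a : A).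

Lemma P0_homog (u : P 0) : homog 0 u.
Proof.
case: Pred => [h|[u0 [_ h0 h]]]; first by rewrite (h u); apply: homog0.
by have [c ->] := h u; apply: homogZ.
Qed.

Lemma P1_homog (p : P 1) : homog 0 p.
Proof. by have [c ->] := Pconn.2 p; apply: homogZ; apply: pid_homog. Qed.

Lemma word_deg E (D : int) v : (forall y, E y -> D <= ldeg y) -> word_in E v ->
  (size v)%:Z * D <= wdeg ldeg v.
Proof.
move=> hE; elim: v => [|y v IH] /=; first by rewrite wdeg_nil; lia.
by case=> /hE hy /IH; rewrite wdegE -addn1 PoszD mulrDl; lia.
Qed.

Lemma word_or E N v : word_in (fun y => E y \/ N y) v ->
  word_in E v \/ exists v1 y v2, v = v1 ++ y :: v2 /\ N y.
Proof.
elim: v => [|y v IH] /=; first by left.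
case=> -[hy|hy] hv; last by right; exists [::], y, v.
case: (IH hv) => [h|[v1 [y' [v2 [-> h]]]]]; first by left.
by right; exists (y :: v1), y', v2.
Qed.

Lemma word_deg1 E (D : int) v1 y v2 : (forall y, E y -> D <= ldeg y) ->
  word_in E (v1 ++ y :: v2) ->
  ldeg y + (size v1 + size v2)%N%:Z * D <= wdeg ldeg (v1 ++ y :: v2).
Proof.
move=> hE hw.
have [h1 h2] : word_in E v1 /\ word_in E v2.
  by elim: v1 hw => [[]//|a v1 IH] /= [ha /IH[]].
have := word_deg hE h1; have := word_deg hE h2.
by rewrite !wdegE PoszD mulrDl; lia.
Qed.

(** The form in which tameness is used: an operation with at least two inputs
    vanishes when the total degree leaves it too little room. *)
Lemma gen_zero m (p : P m) v j : size v = m -> (2 <= m)%N ->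
  homog (j - wdeg ldeg v) p -> j - wdeg ldeg v <= (1 - m%:Z) * (1 + r%:Z) -> gen p v = 0.
Proof. by move=> hv m2 hp hq; rewrite (Ptame m2 hq hp) gen0. Qed.

Lemma gen1_zero (p : P 1) y j : homog (j - wdeg ldeg [:: y]) p -> j != ldeg y ->
  gen p [:: y] = 0.
Proof.
move=> hp hj; rewrite (homog_uniq hp (P1_homog p)) ?gen0 //.
by rewrite !wdegE addr0 subr_eq0.
Qed.

Lemma gen_P0 (p : P 0) j : homog (j - wdeg ldeg [::]) p -> j != 0 -> gen p [::] = 0.
Proof.
move=> hp hj; rewrite (homog_uniq hp (P0_homog p)) ?gen0 //.
by rewrite wdegE subr0.
Qed.

Section LowDegrees.
Variables (E N : L -> Prop) (n : int).
Let E' y := E y \/ N y.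
Hypothesis N_deg : forall y, N y -> ldeg y = n.

(** A word of length [m >= 2] with a letter of degree [n] has degree at least
    [n + (m - 1) * (r + 1)], and by tameness the operation in front of it has
    degree more than [(1 - m) * (r + 1)]. *)
Lemma span_low x j : (forall y, E' y -> r.+1%:Z <= ldeg y) -> span E' x -> homogG j x ->
  j <= n -> exists x0 z, [/\ x = x0 + z, span E x0, lspan N z & j != n -> z = 0].
Proof.
move=> hdeg hx hj jn; move: x hx hj.
apply: span_homog_ind => [|x y [x0 [z [-> hx hz ez]]] [y0 [t [-> hy ht et]]]|m p v hv hE hp].
- by exists 0, 0; split; rewrite ?addr0 //; apply: Span0.
- exists (x0 + y0), (z + t); split; [by rewrite addrACA | exact: SpanD | exact: SpanD |].
  by move=> h; rewrite ez // et // addr0.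
case: (word_or hE) => [h|[v1 [y [v2 [ev hy]]]]].
  by exists (gen p v), 0; split; rewrite ?addr0 //; [apply: SpanGen | apply: Span0].
have hw : word_in E' (v1 ++ y :: v2) by rewrite -ev.
have hd := word_deg1 hdeg hw.
have hm : (size v1 + size v2).+1 = m by rewrite -hv ev size_cat /=; lia.
have : (0 < m)%N by rewrite -hm.
rewrite leq_eqVlt => /orP[/eqP m1|m2]; last first.
  exists 0, 0; split=> //; try exact: Span0.
  rewrite addr0 (gen_zero hv m2 hp) //.
  by move: m2 hd; rewrite -ev (N_deg hy) -hm; nia.
have e : v = [:: y].
  by rewrite ev; move: m1; rewrite -hm; case: (v1) => [|? ?] //=; case: (v2).
rewrite e in hv hp *; case: _ / hv in p hp *.
have [ej|nj] := eqVneq j n.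
  exists 0, (gen p [:: y]); split=> //; rewrite ?add0r //; first exact: Span0.
  by apply: SpanGen => //; exists y.
exists 0, 0; split=> //; try exact: Span0.
by rewrite addr0 (gen1_zero hp) // (N_deg hy).
Qed.

(** The same count with letters of degree at least [r + 2] gains [m - 1], which
    excludes such words from degree [n + 1] too; single letters of degree [n]
    are not there either. *)
Lemma span_low2 x : (forall y, E' y -> r.+2%:Z <= ldeg y) -> span E' x ->
  homogG (n + 1) x -> span E x.
Proof.
move=> hdeg hx hj; move: x hx hj.
apply: span_homog_ind => [|x y hx hy|m p v hv hE hp]; [exact: Span0 | exact: SpanD |].
case: (word_or hE) => [h|[v1 [y [v2 [ev hy]]]]]; first exact: SpanGen.
suff -> : gen p v = 0 by apply: Span0.
have hw : word_in E' (v1 ++ y :: v2) by rewrite -ev.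
have hd := word_deg1 hdeg hw.
have hm : (size v1 + size v2).+1 = m by rewrite -hv ev size_cat /=; lia.
have : (0 < m)%N by rewrite -hm.
rewrite leq_eqVlt => /orP[/eqP m1|m2]; last first.
  rewrite (gen_zero hv m2 hp) //.
  by move: m2 hd; rewrite -ev (N_deg hy) -hm; nia.
have e : v = [:: y].
  by rewrite ev; move: m1; rewrite -hm; case: (v1) => [|? ?] //=; case: (v2).
rewrite e in hv hp *; case: _ / hv in p hp *.
by rewrite (gen1_zero hp) // (N_deg hy); lia.
Qed.

End LowDegrees.

End Degrees.

(** * The tower of extensions *)

Section Tower.
Variables (k : fieldType) (P : operad k) (A : palg P) (r : nat).
Hypotheses (Pconn : op_connected P) (Pred : op_reduced P \/ op_unitary P) (Ptame : tame r P).
Local Notation L := (letter P A).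
Local Notation ldeg := (@ldeg k P A).
Local Notation G := (freeg P ldeg).
Local Notation gen := (@gen k P L ldeg _).
Local Notation dhom := (@dlet_homog k P A).
Local Notation gder := (gder (@dlet_homog k P A)).
Local Notation gmor := (gmor (@alet_homog k P A)).
Local Notation lspan N := (gspan (deg := ldeg) (P := P) (one_in N)).
Local Notation good := (@good k P A r).
Implicit Types (E N : L -> Prop) (n : int) (x z : G) (a : A).

Section Attach.
Variables (E N : L -> Prop) (n : int).
Hypotheses (hE : good E) (hN : attaching E n N) (rn : r.+1%:Z <= n).
Let E' y := E y \/ N y.

Lemma attach_sub y : E y -> E' y. Proof. by left. Qed.

Lemma good_attach : good E'.
Proof.
split=> y [hy|hy].
- by have [h1 h2] := good_d hE hy; split=> //; apply: spanS attach_sub h1.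
- by have [h1 _ _ h2 _] := att_cocycle hN hy; split=> //; apply: spanS attach_sub h1.
- exact: good_f hE _ hy.
- by have [_ _ _ _] := att_cocycle hN hy.
- exact: good_deg hE _ hy.
by rewrite (att_deg hN hy).
Qed.

Lemma lspan_sub z : lspan N z -> span E' z.
Proof. by apply: gspanS => v [y hy ->] /=; split=> //; right. Qed.

(** A class is that of a combination [z] of new letters, which bounds it in the
    extension. *)
Lemma attach_kills x a : cone_cocycle E n x a -> cone_bound E' n x a.
Proof.
move=> hxa; have [z hz [y [b [sy hy hb e1 e2]]]] := att_span hN hxa.
have hzn := lspan_homog (att_deg hN) Pconn hz.
exists (y + z), b; split=> //.
- by apply: SpanD; [apply: spanS attach_sub sy | apply: lspan_sub].
- exact: homogGD.
- by rewrite linearD /= -e1 subrK.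
by rewrite linearD /= -e2 opprD addrA addrAC.
Qed.

(** A new class below degree [n] would involve new letters, by [span_low] through
    a combination [z] of them; being a cocycle of the extended cone, it says that
    the class attached to [z] is zero, against independence. *)
Lemma attach_acyclic i : i < n -> (forall j, j < n -> acyclic E j) -> acyclic E' i.
Proof.
move=> hin hac x a [hx hx1 ha dx fx].
have hi1 : i + 1 <= n by lia.
have [x0 [z [ex hx0 hz z0]]] :=
  span_low Pconn Ptame (att_deg hN) (good_deg good_attach) hx hx1 hi1.
suff z00 : z = 0.
  apply: (cone_boundS attach_sub); apply: (hac _ hin); split=> //.
  by move: hx0; rewrite ex z00 addr0.
have [ei|ni] := eqVneq (i + 1) n; last exact: z0.
have hzn := lspan_homog (att_deg hN) Pconn hz.
have ez : z = x - x0 by rewrite ex addrAC subrr add0r.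
have ex0 : x0 = x - z by rewrite ex addrK.
rewrite ei in hx1.
apply: (att_indep hN hz); exists (- x0), a; split.
- exact: spanN.
- by rewrite ex0 -scaleN1r; apply: homogGZ; apply: homogGD => //; rewrite -scaleN1r; apply: homogGZ.
- by rewrite -ei addrK.
- by rewrite ez linearB /= dx sub0r linearN.
by rewrite linearN /= opprK -fx ex addrC linearD.
Qed.

(** By [span_low2] the cocycles of the cone in degree [n] are not new, so they
    have been killed. *)
Lemma attach_acyclic_top : (forall y, E' y -> r.+2%:Z <= ldeg y) -> acyclic E' n.
Proof.
move=> hdeg x a [hx hx1 ha dx fx].
have hx0 := span_low2 Pconn Ptame (att_deg hN) hdeg hx hx1.
by apply: attach_kills; split.
Qed.

End Attach.

(** The coefficient of a letter, with values in [P 1]; it shows that letters are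
    linearly independent. *)
Definition coef_fam (y : L) : family P L (P 1) := fun m p v =>
  if `[< v = [:: y] >] then cast 1 p else 0.

Lemma coef_fam_adm y : adm ldeg (coef_fam y).
Proof.
split=> [m v hv c p p'|m i j p v1 x z v2 ij hi hm]; rewrite /coef_fam.
  case: asboolP => ev; last by rewrite scaler0 addr0.
  by subst v; case: _ / hv in p p' *; rewrite !cast_id.
rewrite !ifF ?scaler0 //; apply/asboolP => /(congr1 size); rewrite size_cat /=; lia.
Qed.

Lemma coef_letter y y' : lift (coef_fam y) (letter_elt P ldeg y') =
  if `[< y' = y >] then pid else 0.
Proof.
rewrite (lift_gen _ (coef_fam_adm y)) // /coef_fam cast_id.
by congr (if _ then _ else _); apply/asboolP/asboolP => [[]|->].
Qed.

Lemma letter_neq0 y : letter_elt P ldeg y <> 0.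
Proof.
move=> h; have := coef_letter y y; rewrite h (lift_zero (coef_fam_adm y)).
by case: asboolP => // _ /eqP; rewrite eq_sym (negPf Pconn.1).
Qed.

Lemma attaching_acyclic E N n : attaching E n N -> acyclic E n -> forall y, ~ N y.
Proof.
move=> hN hac y hy; apply: (@letter_neq0 y); apply: (att_indep hN).
  by apply: span_one_letter.
by rewrite gder_letter gmor_letter; apply: hac; apply: (att_cocycle hN).
Qed.

Definition new_letters E n : L -> Prop := sval (cid (attaching_exists Pconn E n)).

Lemma new_lettersP E n : attaching E n (new_letters E n).
Proof. exact: (svalP (cid (attaching_exists Pconn E n))). Qed.

Definition step n E : L -> Prop := fun y => E y \/ new_letters E n y.
Definition inner n E q := iter q (step n) E.
Definition inner_lim n E : L -> Prop := fun y => exists q, inner n E q y.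

Definition outer_deg (i : nat) : int := (r.+1 + i)%N%:Z.
(** The stage before the extensions of degree [outer_deg i]; each degree is
    treated countably often, as the kernel created by one extension has to be
    killed by the next. *)
Fixpoint outer i : L -> Prop :=
  if i is i'.+1 then inner_lim (outer_deg i') (outer i') else fun _ => False.
Definition total : L -> Prop := fun y => exists i, outer i y.

Lemma inner_inc n E q y : inner n E q y -> inner n E q.+1 y.
Proof. by left. Qed.

Lemma good_union (F : nat -> L -> Prop) :
  (forall q, good (F q)) -> good (fun y => exists q, F q y).
Proof.
move=> hF; split=> y [q hq].
- have [h1 h2] := good_d (hF q) hq; split=> //.
  by apply: spanS h1 => y' hy'; exists q.
- exact: good_f (hF q) _ hq.
exact: good_deg (hF q) _ hq.
Qed.

Lemma acyclic_union (F : nat -> L -> Prop) n : (forall q y, F q y -> F q.+1 y) ->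
  (forall q x a, cone_cocycle (F q) n x a -> exists q', cone_bound (F q') n x a) ->
  acyclic (fun y => exists q, F q y) n.
Proof.
move=> Finc hF x a [hx hx1 ha dx fx].
have [q hq] := union_span Finc (fun y h => h) hx.
have [|q' hb] := hF q x a; first by split.
by apply: cone_boundS hb => y hy; exists q'.
Qed.

Lemma outer_deg_ge i : r.+1%:Z <= outer_deg i.
Proof. rewrite /outer_deg; lia. Qed.

Lemma good_inner n E q : r.+1%:Z <= n -> good E -> good (inner n E q).
Proof. by move=> hn hE; elim: q => //= q IH; apply: (good_attach IH (new_lettersP _ _) hn). Qed.

Lemma good_outer i : good (outer i).
Proof.
elim: i => [|i IH] /=; first by split.
by apply: good_union => q; apply: good_inner => //; apply: outer_deg_ge.
Qed.

Lemma good_stage i q : good (inner (outer_deg i) (outer i) q).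
Proof. by apply: good_inner; [apply: outer_deg_ge | apply: good_outer]. Qed.

Lemma good_total : good total.
Proof. exact: good_union good_outer. Qed.

Lemma outer_inc i y : outer i y -> outer i.+1 y.
Proof. by exists 0%N. Qed.

Lemma inner_acyclic n E q i : r.+1%:Z <= n -> good E -> i < n ->
  (forall j, j < n -> acyclic E j) -> acyclic (inner n E q) i.
Proof.
move=> hn hE hi hac; elim: q i hi => [|q IH] i hi /=; first exact: hac.
by apply: (attach_acyclic (good_inner q hn hE) (new_lettersP _ _)).
Qed.

Lemma inner_lim_acyclic n E i : r.+1%:Z <= n -> good E -> i <= n ->
  (forall j, j < n -> acyclic E j) -> acyclic (inner_lim n E) i.
Proof.
move=> hn hE hi hac; apply: acyclic_union => [q y|q x a hxa]; first exact: inner_inc.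
have [ei|ni] := eqVneq i n.
  by exists q.+1; rewrite ei in hxa *; apply: (attach_kills (new_lettersP _ _)).
have hac' : acyclic (inner n E q) i by apply: inner_acyclic => //; rewrite lt_neqAle ni.
by exists q; apply: hac'.
Qed.

(** ** The base of the tower *)

Lemma span_none x : span (fun _ : L => False) x -> exists u : P 0, x = gen u [::].
Proof.
elim=> [|y z _ [u ->] _ [v ->]|m p v hv].
- by exists 0; rewrite gen0.
- by exists (u + v); rewrite (admD _ _ (gen_adm P ldeg)).
case: v hv => [|y v] hv /=; last by case.
by case: _ / hv in p * => _; exists p.
Qed.

Lemma gmor_unit (u : P 0) : gmor (gen u [::]) = unit_map A u.
Proof. by rewrite gmor_gen // /pacts -[map _ _]/(tval [tuple]) on_seqE. Qed.

Lemma gen_nil_homog0 (u : P 0) : homogG 0 (gen u [::]).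
Proof.
by have := homogG_gen ldeg (w := [::]) erefl (P0_homog Pred u); rewrite wdegE addr0.
Qed.

Lemma homog_gen_nil (u : P 0) j : homogG j (gen u [::]) -> j != 0 -> gen u [::] = 0.
Proof.
move=> h hj; rewrite -h (gproj_homog j (gen_nil_homog0 u)) (negPf hj) //.
Qed.

Lemma gder_nil (u : P 0) : gder (gen u [::]) = 0.
Proof.
have h := homogG_gen ldeg (w := [::]) erefl (P0_homog Pred u).
rewrite gder_gen //= addr0 (homog_uniq (cd_homog (P0_homog Pred u)) (P0_homog Pred _)) //.
by rewrite gen0.
Qed.

(** The cone of [P 0 -> A] has no cohomology up to the connectivity of [A]:
    degree [-1] is the injectivity of the unit in cohomology, degree [0] its
    surjectivity, and in the other degrees only [A] contributes. *)
Lemma acyclic_base s i : alg_connected s A -> i <= s%:Z -> acyclic (fun _ : L => False) i.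
Proof.
move=> [c1 c2 c3 c4] hi x a [hx hx1 ha _ fx].
have [u eu] := span_none hx; rewrite eu in hx1 fx *.
have triv : gen u [::] = 0 -> cd a = 0 -> (exists2 b : A, homog (i - 1) b & a = cd b) ->
    cone_bound (fun _ : L => False) i (gen u [::]) a.
  move=> -> _ [b hb ->]; exists 0, b; split=> //.
  - exact: Span0.
  - exact: homogG0.
  - by rewrite linear0.
  by rewrite linear0 subr0.
have da : gen u [::] = 0 -> cd a = 0 by move=> e; rewrite -fx e linear0.
have [e1|ne1] := eqVneq i (- 1).
  have u0 : u = 0 by apply: c2; exists a; [rewrite sub0r -e1 | rewrite -gmor_unit].
  have z0 : gen u [::] = 0 by rewrite u0 gen0.
  by apply: triv => //; [apply: da | apply: c1; [rewrite e1|split=> //; apply: da]].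
have z0 : gen u [::] = 0 by apply: (homog_gen_nil hx1); lia.
have hda := da z0.
have [e0|ne0] := eqVneq i 0.
  rewrite e0 in ha hx1 *.
  have [v [b hb eb]] := c3 a (conj ha hda).
  exists (gen v [::]), b; split=> //.
  - by apply: SpanGen.
  - exact: gen_nil_homog0.
  - by rewrite z0 gder_nil.
  by rewrite gmor_unit.
apply: triv => //.
have [neg|pos] := ltP i 0; first by apply: c1.
by apply: c4; [lia | split].
Qed.

Section Connected.
Hypothesis Aconn : alg_connected r A.

Lemma outer_acyclic i j : j < outer_deg i -> acyclic (outer i) j.
Proof.
elim: i j => [|i IH] j hj.
  by apply: (acyclic_base Aconn); move: hj; rewrite /outer_deg; lia.
apply: inner_lim_acyclic => //; [exact: outer_deg_ge | exact: good_outer |].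
by move: hj; rewrite /outer_deg; lia.
Qed.

(** A cocycle of degree [n] is already one at a stage of index larger than [n],
    where it bounds. *)
Lemma total_acyclic n : acyclic total n.
Proof.
apply: acyclic_union => [q y|q x a [hx hx1 ha dx fx]]; first exact: outer_inc.
exists (q + `|n|.+1)%N.
have hq : forall y, outer q y -> outer (q + `|n|.+1)%N y.
  by elim: (`|n|.+1) => [|m IH] y hy; rewrite ?addn0 // addnS; apply: outer_inc; apply: IH.
apply: outer_acyclic; first by rewrite /outer_deg; lia.
by split=> //; apply: spanS hq hx.
Qed.

End Connected.

(** ** Targets of higher connectivity *)

Section MoreConnected.
Hypothesis Aconn : alg_connected r.+1 A.

Lemma step_acyclic E n : acyclic E n -> forall y, step n E y -> E y.
Proof. by move=> hac y [//|hy]; have := attaching_acyclic (new_lettersP E n) hac hy. Qed.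

Lemma inner_stable E n q : acyclic E n -> forall y, inner n E q y -> E y.
Proof.
move=> hac; elim: q => [//|q IH] y /=.
have e : inner n E q = E.
  apply/funext => z; apply/propext; split; first exact: IH.
  by elim: (q) => //= q' IHq hz; left; apply: IHq.
by rewrite -/(inner n E q) e; apply: step_acyclic.
Qed.

Lemma outer1_empty y : ~ outer 1 y.
Proof.
move=> [q hq]; apply: (inner_stable (q := q) (acyclic_base Aconn _)) hq.
by rewrite /outer_deg; lia.
Qed.

Lemma outer_ldeg i y : outer i y -> r.+2%:Z <= ldeg y.
Proof.
case: i => [//|i]; elim: i y => [|i IH] y; first by move/outer1_empty.
case=> q; elim: q y => [|q IHq] y /=; first exact: IH.
case=> [|hy]; first exact: IHq.
by rewrite (att_deg (new_lettersP _ _) hy) /outer_deg; lia.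
Qed.

Lemma total_ldeg y : total y -> r.+2%:Z <= ldeg y.
Proof. by case=> i; apply: outer_ldeg. Qed.

(** After one step the cone is acyclic in the degree at hand, so the next steps
    attach nothing ([inner_stable]). *)
Lemma outer_step i y : outer i.+1 y -> step (outer_deg i) (outer i) y.
Proof.
case: i => [|i] hy; first by have := outer1_empty hy.
have [q hq] := hy; set n := outer_deg _; set E := outer _.
have hE : good E by apply: good_outer.
have hac : acyclic (step n E) n.
  apply: (attach_acyclic_top (new_lettersP _ _)) => z hz.
  by apply: (@outer_ldeg i.+2); exists 1%N.
case: q hq => [|q]; first by left.
rewrite /inner iterSr -/(inner n (step n E) q).
exact: inner_stable.
Qed.

End MoreConnected.
End Tower.

(** * Finite type *)

HB.instance Definition _ (k : fieldType) (P : operad k) (A : Type) := gen_eqMixin (letter P A).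
HB.instance Definition _ (k : fieldType) (P : operad k) (A : Type) := gen_choiceMixin (letter P A).

Section LinearCombinations.
Variables (k : fieldType) (V : lmodType k).
Implicit Types (S : seq V) (x : V).

Definition lcomb S x : Prop := exists c : nat -> k, x = \sum_(i < size S) c i *: S`_i.

Lemma lcomb0 S : lcomb S 0.
Proof. by exists (fun=> 0); rewrite big1 // => i _; rewrite scale0r. Qed.

Lemma lcombP S a x y : lcomb S x -> lcomb S y -> lcomb S (a *: x + y).
Proof.
move=> [c ->] [d ->]; exists (fun i => a * c i + d i).
by rewrite scaler_sumr -big_split; apply: eq_bigr => i _; rewrite scalerDl scalerA.
Qed.

Lemma lcombD S x y : lcomb S x -> lcomb S y -> lcomb S (x + y).
Proof. by rewrite -{2}[x]scale1r; apply: lcombP. Qed.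

Lemma lcombZ S a x : lcomb S x -> lcomb S (a *: x).
Proof. by move=> h; rewrite -[a *: x]addr0; apply: lcombP => //; apply: lcomb0. Qed.

Lemma lcomb_mem S x : x \in S -> lcomb S x.
Proof.
move=> xS; have hi : (index x S < size S)%N by rewrite index_mem.
exists (fun i => (i == index x S)%:R).
rewrite (bigD1 (Ordinal hi)) //= eqxx scale1r nth_index // big1 ?addr0 // => i ni.
by rewrite (_ : (_ == _) = false) ?scale0r //; apply: negbTE.
Qed.

Lemma lcomb_sum S (I : Type) (s : seq I) (Q : pred I) (F : I -> V) :
  (forall i, Q i -> lcomb S (F i)) -> lcomb S (\sum_(i <- s | Q i) F i).
Proof. by move=> h; elim/big_ind: _ => //; [apply: lcomb0 | apply: lcombD]. Qed.

Lemma sum_mulmx m n (w : 'rV[k]_m) (R : 'M[k]_(m, n)) (v : 'I_n -> V) :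
  \sum_i (w *m R) 0 i *: v i = \sum_l w 0 l *: \sum_i R l i *: v i.
Proof.
transitivity (\sum_i \sum_l (w 0 l * R l i) *: v i).
  by apply: eq_bigr => i _; rewrite mxE scaler_suml.
rewrite exchange_big; apply: eq_bigr => l _.
by rewrite scaler_sumr; apply: eq_bigr => i _; rewrite scalerA.
Qed.

End LinearCombinations.

Fixpoint words (T : Type) (s : seq T) (b : nat) : seq (seq T) :=
  [::] :: if b is b'.+1 then [seq y :: w | y <- s, w <- words s b'] else [::].

Lemma mem_words (T : eqType) (s v : seq T) b :
  (v \in words s b) = (size v <= b)%N && all (mem s) v.
Proof.
elim: b v => [|b IH] [|y v] //=; rewrite in_cons /=.
apply/allpairsP/andP => [[[y' w] /= [hy hw [-> ->]]]|[hv /andP[hy hw]]].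
  by move: hw; rewrite IH /= => /andP[h1 h2]; rewrite ltnS h1 hy h2.
by exists (y, v); split=> //=; rewrite IH -ltnS hv.
Qed.

Section FiniteType.
Variables (k : fieldType) (P : operad k) (A : palg P) (r : nat).
Hypotheses (Pconn : op_connected P) (Pred : op_reduced P \/ op_unitary P) (Ptame : tame r P).
Local Notation L := (letter P A).
Local Notation ldeg := (@ldeg k P A).
Local Notation G := (freeg P ldeg).
Local Notation gen := (@gen k P L ldeg _).
Local Notation gder := (gder (@dlet_homog k P A)).
Local Notation gmor := (gmor (@alet_homog k P A)).
Implicit Types (E N : L -> Prop) (n : int) (x z : G).

Definition finite_in E n : Prop := exists S : seq G,
  (forall x, x \in S -> span E x /\ homogG n x) /\
  (forall x, span E x -> homogG n x -> lcomb S x).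

Lemma word_in_all E (s v : seq L) : (forall y, y \in s -> E y) -> all (mem s) v -> word_in E v.
Proof. by move=> hs; elim: v => //= y v IH /andP[/hs hy /IH]. Qed.

Lemma gen_comb m (v : seq L) (S : seq (P m)) (c : nat -> k) : size v = m ->
  gen (\sum_(i < size S) c i *: S`_i) v = \sum_(i < size S) c i *: gen S`_i v.
Proof.
move=> hv; elim: (index_enum _) => [|i s IH]; first by rewrite !big_nil gen0.
by rewrite !big_cons (adm_lin (gen_adm P ldeg)) // IH.
Qed.

(** In a given degree only finitely many words occur: the length and the
    degrees of the letters of a word are bounded by its degree, because
    letters have degree at least [r + 2] and the operad is [r]-tame. *)
Lemma span_finite E n : op_finite_type P -> (forall y, E y -> r.+2%:Z <= ldeg y) ->
  (exists s : seq L, forall y, E y -> ldeg y <= n -> y \in s) -> finite_in E n.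
Proof.
move=> Pfin hdeg [s0 hs0]; pose s := [seq y <- s0 | `[< E y >]].
have sE y : y \in s -> E y by rewrite mem_filter => /andP[/asboolP].
have Es y : E y -> ldeg y <= n -> y \in s.
  by move=> hy hn; rewrite mem_filter hs0 // andbT; apply/asboolP.
have f_ex (w : seq L) := cid (Pfin (size w) (n - wdeg ldeg w)).
pose f w := sval (f_ex w).
have f1 w e : e \in f w -> homog (n - wdeg ldeg w) e.
  by have [h _] := svalP (f_ex w); apply: h.
have f2 w p : homog (n - wdeg ldeg w) p -> lcomb (f w) p.
  by have [_ h] := svalP (f_ex w); apply: h.
pose W := words s (`|n|.+1)%N.
pose S : seq G := flatten [seq [seq gen e w | e <- f w] | w <- W].
have SW w e : w \in W -> e \in f w -> gen e w \in S.
  move=> hw he; apply/flattenP; exists [seq gen e w | e <- f w]; first by apply/mapP; exists w.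
  by apply/mapP; exists e.
exists S; split=> [x /flattenP[S' /mapP[w hw ->] /mapP[e he ->]]|].
  move: hw; rewrite mem_words => /andP[_ hw].
  split; first by apply: SpanGen => //; apply: word_in_all sE hw.
  by rewrite -[n](subrK (wdeg ldeg w)); apply: homogG_gen => //; apply: f1.
move=> x hx; move: x hx; apply: span_homog_ind => [|x y|m p v hv hE hp].
- exact: lcomb0.
- exact: lcombD.
suff [h0|hW] : gen p v = 0 \/ v \in W; first by rewrite h0; apply: lcomb0.
  case: _ / hv in p hp *; have [c ->] := f2 _ _ hp.
  rewrite gen_comb //; apply: lcomb_sum => i _; apply: lcombZ; apply: lcomb_mem.
  by apply: SW => //; apply: mem_nth.
rewrite mem_words; case: m p hv hp => [|[|m]] p hv hp.
- by right; rewrite hv (size0nil hv).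
- case: v hv hE hp => [|y [|]] // hv [hy _] hp.
  have [e|ne] := eqVneq n (ldeg y); last by left; apply: (gen1_zero Pconn hp).
  by right; rewrite /= Es // e.
case: (lerP (n - wdeg ldeg v) ((1 - m.+2%:Z) * (1 + r%:Z))) => hq.
  by left; apply: (gen_zero Ptame hv _ hp hq).
(* From here on [p] may be nonzero, so [hq] bounds the length and the letters of [v]. *)
right; apply/andP; split.
  by have := word_deg hdeg hE; rewrite hv; move: hq; nia.
apply/allP => y /splitPr hy; case: hy hv hE hp hq => v1 v2 hv hE hp hq.
have hy : E y by elim: v1 hE {hv hp hq} => [[]//|a v1 IH] /= [_ /IH].
apply: Es => //; have := word_deg1 hdeg hE.
have -> : (size v1 + size v2 = m.+1)%N by move: hv; rewrite size_cat /=; lia.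
move: hq; rewrite (_ : 1 - m.+2%:Z = - m.+1%:Z) ?mulNr; last by lia.
have -> : m.+1%:Z * r.+2%:Z = m.+1%:Z * (1 + r%:Z) + m.+1%:Z by rewrite -[r.+2]addn2 PoszD; ring.
move: (wdeg _ _) (m.+1%:Z * (1 + r%:Z)) (ldeg y) => w a d; lia.
Qed.

(** A basis of the cohomology of the cone is finite: a linear relation between
    the differentials turns combinations of letters into cocycles of the
    target, and a linear relation between their classes contradicts
    independence. *)
Lemma attaching_bound E n N S (T : seq A) : attaching E n N ->
  (forall x, span E x -> homogG (n + 1) x -> lcomb S x) ->
  (forall x : A, cocycle n x ->
     exists c : nat -> k, coboundary n (x - \sum_(i < size T) c i *: T`_i)) ->
  forall s : seq L, uniq s -> (forall y, y \in s -> N y) -> (size s <= size S + size T)%N.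
Proof.
move=> hN hS hT s us sN; rewrite leqNgt; apply/negP => hK.
set K := size s in hK.
pose y (i : 'I_K) := tnth (in_tuple s) i.
have yN i : N (y i) by apply: sN; rewrite /y mem_tnth.
have [X hX] : exists X : 'M[k]_(K, size S), forall i, dlet (y i) = \sum_j X i j *: S`_j.
  have h i : exists c : nat -> k, dlet (y i) = \sum_(j < size S) c j *: S`_j.
    by have [h1 h2 _ _ _] := att_cocycle hN (yN i); apply: hS.
  exists (\matrix_(i, j) sval (cid (h i)) j) => i.
  by rewrite {1}(svalP (cid (h i))); apply: eq_bigr => j _; rewrite mxE.
pose R := kermx X.
have RX l : \sum_i R l i *: dlet (y i) = 0.
  have := sum_mulmx (row l R) X (fun j => S`_j).
  rewrite -row_mul mulmx_ker row0 big1 => [e|j _]; last by rewrite mxE scale0r.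
  by rewrite [RHS]e; apply: eq_bigr => i _; rewrite -hX [in RHS]mxE.
pose al l := \sum_i R l i *: alet (y i).
have [Y [b hY]] : exists (Y : 'M[k]_(K, size T)) (b : 'I_K -> A),
    forall l, homog (n - 1) (b l) /\ al l = \sum_j Y l j *: T`_j + cd (b l).
  have h l : exists cb : (nat -> k) * A, homog (n - 1) cb.2 /\
      al l = \sum_(j < size T) cb.1 j *: T`_j + cd cb.2.
    have [|c [b hb eb]] := hT (al l); last first.
      by exists (c, b); split=> //=; rewrite -eb addrC subrK.
    split.
      apply: homog_sum => i _; apply: homogZ; rewrite -(att_deg hN (yN i)).
      exact: alet_homog.
    rewrite /al raddf_sum -[RHS](linear0 gmor) -(RX l) raddf_sum.
    apply: eq_bigr => i _; rewrite /= (linearZ_LR cd) (linearZ_LR gmor) /=; congr (_ *: _).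
    by have [_ _ _ _ ->] := att_cocycle hN (yN i).
  exists (\matrix_(l, j) (sval (cid (h l))).1 j), (fun l => (sval (cid (h l))).2) => l.
  have [h1 h2] := svalP (cid (h l)); split=> //.
  by rewrite {1}h2; congr (_ + _); apply: eq_bigr => j _; rewrite mxE.
(* Otherwise the rank of [R] is at most that of [Y], and [X] has too few columns. *)
have nz : kermx Y *m R != 0.
  apply/eqP => /mulmx0_rank_max; rewrite /R !mxrank_ker.
  by have := rank_leq_col X; have := rank_leq_col Y; lia.
have [l0 hl0] : exists l0, row l0 (kermx Y *m R) != 0.
  apply: contrapT => hno; case/eqP: nz; apply/row_matrixP => l.
  by rewrite row0; apply/eqP; apply: contrapT => /negP h; apply: hno; exists l.
pose w := row l0 (kermx Y); pose c := w *m R.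
have wY : w *m Y = 0 by rewrite /w -row_mul mulmx_ker row0.
have c0 : c != 0 by rewrite /c /w -row_mul.
pose z : G := \sum_i c 0 i *: letter_elt P ldeg (y i).
have z0 : z = 0.
  apply: (att_indep hN).
    rewrite /z; elim/big_ind: _ => [|u v|i _]; [exact: Span0 | exact: SpanD |].
    by apply: spanZ; apply: span_one_letter.
  have e1 : gder z = 0.
    rewrite /z raddf_sum -[RHS](_ : \sum_i c 0 i *: dlet (y i) = 0).
      by apply: eq_bigr => i _; rewrite /= linearZ /= gder_letter.
    by rewrite sum_mulmx big1 // => l _; rewrite RX scaler0.
  have e2 : gmor z = cd (\sum_l w 0 l *: b l).
    have -> : gmor z = \sum_i c 0 i *: alet (y i).
      by rewrite /z raddf_sum; apply: eq_bigr => i _; rewrite /= linearZ /= gmor_letter.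
    rewrite sum_mulmx -/al raddf_sum.
    transitivity (\sum_l (w 0 l *: (\sum_j Y l j *: T`_j) + w 0 l *: cd (b l))).
      by apply: eq_bigr => l _; rewrite -scalerDr -(hY l).2.
    rewrite big_split /= -sum_mulmx wY big1 ?add0r => [|j _]; last by rewrite mxE scale0r.
    by apply: eq_bigr => l _; rewrite /= linearZ.
  exists 0, (\sum_l w 0 l *: b l); split.
  - exact: Span0.
  - exact: homogG0.
  - by apply: homog_sum => l _; apply: homogZ; apply: (hY l).1.
  - by rewrite e1 linear0.
  by rewrite linear0 subr0.
case/eqP: c0; apply/rowP => i; rewrite [RHS]mxE.
have := congr1 (liftL (coef_fam_adm (y i))) z0.
rewrite linear0 /z raddf_sum (bigD1 i) //= big1 => [|j ji].
  rewrite addr0 linearZ /= /liftL coef_letter ifT; last exact/asboolP.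
  by move/eqP; rewrite scaler_eq0 (negPf Pconn.1) orbF => /eqP.
rewrite linearZ /= /liftL coef_letter ifF ?scaler0 //; apply/asboolP => /eqP.
by rewrite /y !(tnth_nth (y i)) nth_uniq // val_eqE (negPf ji).
Qed.

Lemma finite_of_bound (Q : L -> Prop) K :
  (forall s : seq L, uniq s -> (forall y, y \in s -> Q y) -> (size s <= K)%N) ->
  exists s : seq L, forall y, Q y -> y \in s.
Proof.
move=> hK; apply: contrapT => hno.
suff [s [us hs es]] : exists s : seq L, [/\ uniq s, forall y, y \in s -> Q y & size s = K.+1].
  by have := hK s us hs; rewrite es ltnn.
elim: (K.+1) => [|n [s [us hs es]]]; first by exists [::].
have [y [hy ys]] : exists y, Q y /\ y \notin s.
  apply: contrapT => h; apply: hno; exists s => y hy.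
  by apply: contrapT => /negP ys; apply: h; exists y.
exists (y :: s); split; rewrite /= ?ys ?es //.
by move=> z; rewrite inE => /orP[/eqP ->|/hs].
Qed.

Section Total.
Hypotheses (Pfin : op_finite_type P) (Aconn : alg_connected r.+1 A) (Acoh : coh_finite_type A).
Local Notation outer := (@outer k P A r Pconn).
Local Notation total := (@total k P A r Pconn).

Lemma outer_finite i : exists s : seq L, forall y, outer i y -> y \in s.
Proof.
elim: i => [|i [s hs]]; first by exists [::].
have [S [_ hS]] : finite_in (outer i) (outer_deg r i + 1).
  apply: span_finite => //; first exact: outer_ldeg.
  by exists s => y hy _; apply: hs.
have [T [_ hT]] := Acoh (outer_deg r i).
have hN := new_lettersP Pconn (outer i) (outer_deg r i).
have [s' hs'] := finite_of_bound (attaching_bound hN hS hT).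
exists (s ++ s') => y hy; rewrite mem_cat.
by have [/hs ->|/hs' ->] := outer_step Pred Ptame Aconn hy; rewrite ?orbT.
Qed.

(** Letters attached later have larger degrees. *)
Lemma outer_low i j y : outer (i + j) y -> ldeg y < outer_deg r i -> outer i y.
Proof.
elim: j => [|j IH]; first by rewrite addn0.
rewrite addnS => hy hd; apply: IH => //.
have [//|hn] := outer_step Pred Ptame Aconn hy.
by move: hd; rewrite (att_deg (new_lettersP _ _ _) hn) /outer_deg; lia.
Qed.

Lemma total_finite n : finite_in total n.
Proof.
apply: span_finite => //; first exact: total_ldeg.
have [s hs] := outer_finite `|n|.+1; exists s => y [i hy] hn; apply: hs.
have hd : ldeg y < outer_deg r `|n|.+1 by rewrite /outer_deg; lia.
apply: (@outer_low _ i) => //; rewrite addnC.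
by elim: (`|n|.+1) => [|m IH]; rewrite ?addn0 // addnS; apply: outer_inc.
Qed.

End Total.
End FiniteType.

(** * The minimal model *)

Section Model.
Variables (k : fieldType) (P : operad k) (A : palg P) (r : nat).
Hypotheses (Pconn : op_connected P) (Pred : op_reduced P \/ op_unitary P) (Ptame : tame r P).
Local Notation L := (letter P A).
Local Notation ldeg := (@ldeg k P A).
Local Notation dhom := (@dlet_homog k P A).
Local Notation gen := (@gen k P L ldeg _).
Local Notation total := (@total k P A r Pconn).
Local Notation outer := (@outer k P A r Pconn).
Local Notation stage i q := (inner Pconn (outer_deg r i) (outer i) q).
Local Notation subalg h := (subalg (good_d h)).

Let Mgood := good_total A r Pconn.
Let Sgood i q := good_stage A r Pconn i q.

Definition model : palg P := subalg Mgood.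
Definition model_map : palg_hom model A := sub_mor (good_d Mgood) (good_f Mgood).

(** Below degree [r + 1] there is no room for letters. *)
Lemma span_deg_low E (x : freeg P ldeg) i : (forall y, E y -> r.+1%:Z <= ldeg y) ->
  span E x -> homogG i x -> i < r.+1%:Z ->
  exists u : P 0, x = gen u [::] /\ (i != 0 -> gen u [::] = 0).
Proof.
move=> hdeg hx hi ir; move: x hx hi.
apply: span_homog_ind => [|x y [u [-> hu]] [v [-> hv]]|m p v hv hE hp].
- by exists 0; rewrite gen0.
- exists (u + v); rewrite (admD _ _ (gen_adm P ldeg)) //; split=> // h.
  by rewrite hu // hv // addr0.
case: m p hv hp => [|m] p hv hp.
  by rewrite (size0nil hv) in hp *; exists p; split=> // i0; apply: (gen_P0 Pred hp).
exists 0; rewrite gen0 //; split=> //.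
case: m p hv hp => [|m] p hv hp; last first.
  apply: (gen_zero Ptame hv _ hp) => //.
  by have := word_deg hdeg hE; rewrite hv; nia.
case: v hv hE hp => [|y [|]] // hv [hy _] hp.
by apply: (gen1_zero Pconn hp); have := hdeg y hy; lia.
Qed.

Lemma model_deg0 (x : model) : homog 0 x <-> exists u : P 0, x = unit_map model u.
Proof.
split=> [hx|[u ->]]; last first.
  by rewrite /homog /= /homogS (unit_map_gen (good_d Mgood)); apply: (gen_nil_homog0 A Pred).
have [//|u [e _]] := span_deg_low (good_deg Mgood) (subG_span x) hx.
by exists u; apply: val_inj; rewrite (unit_map_gen (good_d Mgood)).
Qed.

Lemma model_low (i : int) : i < r%:Z -> i != 0 -> forall x : model, homog i x -> x = 0.
Proof.
move=> ir i0 x hx.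
have [|u [e hu]] := span_deg_low (good_deg Mgood) (subG_span x) hx; first by lia.
by apply: val_inj; rewrite e hu.
Qed.

Lemma outer_total i y : outer i y -> total y.
Proof. by exists i. Qed.

Lemma stage_outer i q y : stage i q y -> outer i.+1 y.
Proof. by exists q. Qed.

(** Only the set of letters matters, so this applies to one step of a degree as
    well as to a degree completed in one step. *)
Lemma KS_step (E E' : L -> Prop) n (hE : good r E) (hE' : good r E')
    (EE' : forall y, E y -> E' y) :
  (forall y, E' y -> step Pconn n E y) -> 0 < n ->
  KS_extension n (incl (good_d hE) (good_d hE') EE').
Proof.
move=> hs n0; apply: KS_incl => // y hy nhy.
have [//|hn] := hs y hy.
by have [h1 _ _ _ _] := att_cocycle (new_lettersP _ _ _) hn; rewrite (att_deg (new_lettersP _ _ _) hn).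
Qed.

Lemma model_minimal : sullivan_minimal r model.
Proof.
exists (fun i q => subalg (Sgood i q)),
  (fun i q => incl (good_d (Sgood i q)) (good_d (Sgood i q.+1))
     (fun y => @inner_inc _ _ _ _ _ _ q y)),
  (fun i q => incl (good_d (Sgood i q)) (good_d (Sgood i.+1 0)) (@stage_outer i q)),
  (fun i => incl (good_d (Sgood i 0)) (good_d Mgood) (@outer_total i)).
split.
- by apply: is_P0_empty => y [].
- by move=> i q; apply: KS_step.
- by move=> i; apply: incl_is_union.
exact: (incl_is_union (fun i => good_d (Sgood i 0)) (good_d Mgood)
  (fun i y => @stage_outer i 0 y) outer_total).
Qed.

Lemma model_minimal_seq : alg_connected r.+1 A -> sullivan_minimal_seq r model.
Proof.
move=> Aconn.
pose hO i := good_outer A r Pconn i.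
exists (fun i => subalg (hO i)),
  (fun i => incl (good_d (hO i)) (good_d (hO i.+1)) (@outer_inc _ _ _ _ _ i)),
  (fun i => r.+1 + i)%N,
  (fun i => incl (good_d (hO i)) (good_d Mgood) (@outer_total i)).
split.
- by apply: is_P0_empty => y [].
- by move=> i; apply: KS_step => // y; apply: outer_step.
- by move=> i; apply/andP; split; lia.
exact: (incl_is_union (fun i => good_d (hO i)) (good_d Mgood)).
Qed.

Lemma model_quasi_iso : alg_connected r A -> quasi_iso model_map.
Proof.
move=> Aconn n; have hac := total_acyclic Pred Ptame Aconn (Pconn := Pconn); split.
  move=> x [hx dx] [b hb eb].
  have [|y [b' [sy hy _ e _]]] := hac (n - 1) (val x) b.
    split=> //; [exact: subG_span | by rewrite subrK | exact: (congr1 val dx)].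
  by exists (inG sy) => //; apply: val_inj.
move=> y [hy dy].
have [|x [b [sx hx hb e1 e2]]] := hac n 0 y.
  split=> //; [exact: Span0 | exact: homogG0 | by rewrite linear0 | by rewrite dy linear0].
exists (inG sx); last by exists b.
by split=> //; apply: val_inj.
Qed.

Lemma model_finite_type : op_finite_type P -> alg_connected r.+1 A -> coh_finite_type A ->
  finite_type model.
Proof.
move=> Pfin Aconn Acoh n.
have [S [hS1 hS2]] := total_finite Pconn Pred Ptame Pfin Aconn Acoh n.
pose g x : model := if pselect (span total x) is left h then inG h else 0.
have gE x : x \in S -> val (g x) = x.
  by move=> /hS1[h _]; rewrite /g; case: pselect.
exists (map g S); split=> [x /mapP[y hy ->]|x hx].
  by rewrite /homog /= /homogS gE //; case: (hS1 y hy).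
have [c hc] := hS2 _ (subG_span x) hx; exists c.
apply: val_inj; rewrite [LHS]hc val_sumG size_map; apply: eq_bigr => i _.
by rewrite (nth_map 0) // [RHS]linearZ /= gE // mem_nth.
Qed.

End Model.

Theorem theorem4p6 (k : fieldType) (hk : [pchar k] =i pred0) (r : nat)
    (P : operad k) (Pconn : op_connected P)
    (Pred : op_reduced P \/ op_unitary P) (Ptame : tame r P)
    (A : palg P) (Aconn : alg_connected r A) :
  exists (M : palg P) (f : palg_hom M A),
    [/\ sullivan_minimal_model r f,
        injective (unit_map M)
          /\ (forall x : M, homog 0 x <-> exists u : P 0%N, x = unit_map M u),
        forall i : int, i < r%:Z -> i != 0 -> forall x : M, homog i x -> x = 0,
        alg_connected r.+1 A -> sullivan_minimal_seq r M
      & op_finite_type P -> alg_connected r.+1 A -> coh_finite_type A -> finite_type M].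
Proof.
exists (model A r Pconn), (model_map A r Pconn); split.
- by split; [apply: model_minimal | apply: model_quasi_iso].
- by split; [apply: unit_map_inj | apply: model_deg0].
- exact: model_low.
- exact: model_minimal_seq.
exact: model_finite_type.
Qed.
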